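(* If $u_0$ is a (real-valued) real-analytic function on $S^1$, then the Cauchy problem $$u_t+uu_x+\partial_xA^{-1}\big[3\mu(u)u\big]=0,\qquad u(0,x)=u_0(x),$$ has a holomorphic solution near $t=0$. More precisely: (i) There exists $\Delta>0$ such that $u_0\in G^{\Delta,s+1}\subset A(\Delta)$ for any $s\ge0$. (ii) With such a $\Delta$, if $s>1/2$, there exists a positive time $T_\Delta=T(u_0,s,\Delta)$ such that for every $d\in\,]0,1[$, the Cauchy problem has a unique solution which is a holomorphic function valued in $G^{\Delta d,s+1}$ in the disk $D(0,T_\Delta(1-d))$. Furthermore, when $\Delta$ is fixed, the analytic lifespan $T_\Delta$ satisfies, for $u_0\ne0$, $$T_\Delta=\frac{\mathrm{const.}}{\|u_0\|_{\Delta,s+1}},$$ where $\mathrm{const.}$ is a positive constant which does not depend on $u_0$ (it may depend on $s$ and $\Delta$).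
   Context: $S^1=\mathbb R/\mathbb Z$; $L^2(S^1)$ denotes real-valued square-integrable functions; $\hat\varphi(k)=\int_{S^1}\varphi(x)e^{-2k\pi ix}\,dx$; $\langle k\rangle=(1+k^2)^{1/2}$. For $\delta\ge0,s\ge0$, $G^{\delta,s}=\{\varphi\in L^2(S^1):\|\varphi\|_{\delta,s}<\infty\}$ with $\|\varphi\|_{\delta,s}^2=\sum_{k\in\mathbb Z}\langle k\rangle^{2s}e^{4\pi\delta|k|}|\hat\varphi(k)|^2$. For $\delta>0$, $A(\delta)$ is the space of functions $f:S^1\to\mathbb R$ having an analytic continuation to $S(\delta)=\{x+iy\in\mathbb C:|y|<\delta\}$. $\mu(\varphi)=\int_{S^1}\varphi\,dx$ (integration in $x$), $A(\varphi)=\mu(\varphi)-\varphi_{xx}$ (operator, not to be confused with the space $A(\delta)$), whose inverse is $A^{-1}(\varphi)=\hat\varphi(0)+\sum_{k\ne0}\frac{\hat\varphi(k)}{(2\pi k)^2}e^{2k\pi ix}$. $D(0,r)=\{t\in\mathbb C:|t|<r\}$. For complex $t$ the values of a holomorphic function of $t$ are taken in the complexification of $G^{\delta,s+1}$ (complex-valued functions, same norm), with $\mu$, $A^{-1}$, $\partial_x$ and products extended by the same formulas. *)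

(* Defs.v *)
From HB Require Import structures.
From mathcomp Require Import all_boot all_order all_algebra.
From mathcomp Require Import complex.
From mathcomp Require Import all_classical all_reals all_analysis.

Set Implicit Arguments.
Unset Strict Implicit.
Unset Printing Implicit Defensive.

Import Order.TTheory GRing.Theory Num.Theory.
Import numFieldNormedType.Exports.

Local Open Scope classical_set_scope.
Local Open Scope ring_scope.
Local Open Scope complex_scope.

(* Functions on the circle R/Z are 1-periodic functions on R.  Elements of L^2
   are represented by functions, with almost everywhere equality as the
   equality of classes; the norm below only depends on the class. *)
Definition periodic1 (R : realType) (T : Type) (f : R -> T) : Prop :=
  forall x, f (x + 1) = f x.

(* For K = R this is real analyticity, for K = R[i] complex analyticity. *)
Definition analytic_on (K : numFieldType) (D : set K) (f : K -> K) : Prop :=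
  forall z, D z -> exists (a : nat -> K) (r : K), 0 < r /\
    forall h, `|h| < r ->
      (series (fun n => a n * h ^+ n) : nat -> K^o) @ \oo --> (f (z + h) : K^o).

Section circle.
Variable R : realType.
Implicit Types (f g : R -> R[i]) (delta s : R).

Definition cplx (phi : R -> R) : R -> R[i] := fun x => (phi x)%:C.

Definition expi (y : R) : R[i] := cos y +i* sin y.

Definition square_integrable (phi : R -> R) : Prop :=
  measurable_fun (`[0, 1] : set R) phi /\
  lebesgue_measure.-integrable (`[0, 1] : set R) (fun x => (phi x ^+ 2)%:E).

Definition L2 f : Prop :=
  [/\ periodic1 f, square_integrable (fun x => complex.Re (f x))
    & square_integrable (fun x => complex.Im (f x))].

(* mu(f), the integral of f over the circle *)
Definition mean f : R[i] :=
  \int[lebesgue_measure]_(x in `[0, 1]) complex.Re (f x) +i*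
  \int[lebesgue_measure]_(x in `[0, 1]) complex.Im (f x).

Definition fourier f (k : int) : R[i] :=
  mean (fun x => f x * expi (- (2 * pi * k%:~R * x))).

Definition japanese (k : int) : R := Num.sqrt (1 + k%:~R ^+ 2).

(* Extended-real valued: +oo for f in L^2 outside of the space. *)
Definition Gnorm delta s f : \bar R :=
  sqrte (\esum_(k in [set: int])
    (japanese k `^ (2 * s) * expR (4 * pi * delta * `|k|%:~R)
       * (complex.Re `|fourier f k|) ^+ 2)%:E).

(* The complexification of G^{delta,s}. *)
Definition GC delta s f : Prop := L2 f /\ (Gnorm delta s f < +oo)%E.

Definition G delta s (phi : R -> R) : Prop := GC delta s (cplx phi).

Definition strip delta : set R[i] := [set z | `|complex.Im z| < delta].

Definition Aspace delta (phi : R -> R) : Prop :=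
  periodic1 phi /\
  exists F : R[i] -> R[i],
    analytic_on (strip delta) F /\ forall x : R, F x%:C = (phi x)%:C.

(* G^{delta,s} is a space of classes, A(delta) a space of functions: the
   inclusion means that each class has a representative in A(delta). *)
Definition G_sub_A delta s : Prop :=
  forall phi, G delta s phi -> exists2 f, Aspace delta f &
    {ae @lebesgue_measure R, forall x, phi x = f x}.

Definition dx f : R -> R[i] := fun x =>
  derive1 (fun y => complex.Re (f y)) x +i* derive1 (fun y => complex.Im (f y)) x.

(* A^{-1}, the inverse of f |-> mean f - f_xx; the sum over k <> 0 is written
   by grouping the terms k and -k. *)
Definition Ainv f : R -> R[i] := fun x =>
  let term (k : int) : R[i] :=
    fourier f k / ((2 * pi * k%:~R) ^+ 2)%:C * expi (2 * pi * k%:~R * x) in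
  fourier f 0 +
  limn (fun n => \sum_(1 <= k < n) (term k%:Z + term (- k%:Z)) : R[i]^o).

Definition disk (r : R) : set R[i] := [set t | `|t| < r%:C].

(* g is the complex derivative at t of the GC delta s - valued map u. *)
Definition is_tderiv delta s (u : R[i] -> R -> R[i]) (t : R[i]) g : Prop :=
  GC delta s g /\
  Gnorm delta s (fun x => h^-1 * (u (t + h) x - u t x) - g x)
    @[h --> (0 : R[i]^o)^'] --> 0%E.

Definition holomorphic_into delta s (D : set R[i]) (u : R[i] -> R -> R[i])
    : Prop :=
  forall t, D t -> GC delta s (u t) /\ exists g, is_tderiv delta s u t g.

(* The class u t is represented by its continuous representative (for
   delta > 0 there is exactly one, and it is smooth), so that d/dx is the
   classical derivative and the equation can be read pointwise. *)
Definition holomorphic_solution delta s (D : set R[i]) (u0 : R -> R)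
    (u : R[i] -> R -> R[i]) : Prop :=
  [/\ holomorphic_into delta s D u,
      forall t, D t -> continuous (u t : R -> R[i]^o),
      forall t, D t -> exists2 ut, is_tderiv delta s u t ut &
        forall x, ut x + u t x * dx (u t) x
                  + dx (Ainv (fun y => 3 * mean (u t) * u t y)) x = 0
    & forall x, u 0 x = (u0 x)%:C].

End circle.

(* Main.v *)
Require Import Defs.
From mathcomp Require Import all_boot all_order all_algebra.
From mathcomp Require Import complex.
From mathcomp Require Import all_classical all_reals all_analysis.
From mathcomp Require Import measurable_realfun.
From mathcomp Require Import ring lra zify.

Set Implicit Arguments.
Unset Strict Implicit.
Unset Printing Implicit Defensive.

Import Order.TTheory GRing.Theory Num.Theory.
Import numFieldNormedType.Exports.

Local Open Scope classical_set_scope.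
Local Open Scope ring_scope.

(** The proof works with Fourier coefficients [c : int -> R[i]], in the spaces
    given by the pointwise bounds [|c k| <= A * gw d k], where
    [gw d k = (1 + |k|) ^ (- 3 / 2) * exp (- 2 pi d |k|)]; the predicate is
    [decay c d A].  Up to an arbitrarily small loss in [d] these are the
    coefficients of the functions of [G^{d,s}]; since [s + 1 > 3 / 2] there is no
    loss in one direction ([GC_decay]).  The weights [(1 + |k|) ^ (- 3 / 2)] are
    summable and stable by convolution, so these spaces are algebras, with a
    constant that does not depend on [d] ([decay_conv]).  An integrable function
    whose Fourier coefficients vanish is zero almost everywhere
    ([fourier0_ae]): its integrals over intervals vanish, because the indicator
    functions of intervals are bounded limits of trigonometric polynomials.
    Hence continuous functions with summable coefficients are the sums of their
    Fourier series ([synth_fourier]).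

    Part (i).  The Cauchy estimates of a real analytic function are uniform over
    a period by compactness.  Integration by parts turns them into the bounds
    [|2 pi k| ^ n |c k| <= C M ^ n n!], and summation over [n] gives exponential
    decay ([analytic_fourier]).  Conversely, exponentially decaying coefficients
    define a continuation to the strip, by expanding the complex exponentials
    ([strip_ext_analytic]).

    Part (ii).  In Fourier coefficients the equation reads
    [c' = - (2 pi i k) * bil c c], where [bil] is a bilinear form that is
    bounded at fixed width ([equation_fourier], [decay_bil]), while the factor
    [2 pi i k] costs [1 / e] for a loss [e] of width ([decay_deriv]).  This is
    the setting of the abstract Cauchy-Kovalevskaya theorem.

    For existence, the coefficients of the power series in [t] are defined by
    recursion.  They satisfy bounds of the form
    [B * growth ^ n / ((n + 1) ^ 2 * E ^ n)] in the width [Delta (1 - E)], for all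
    [E] at once ([coef_decay]).  In the inductive step, the convolution of the
    factors [(n + 1) ^ - 2] is bounded by a multiple of such a factor, and the
    division by [n + 1] compensates the price of the derivative when the width
    is reduced from [Delta (1 - E (n + 1) / (n + 2))] to [Delta (1 - E)].  So the
    series converges in the width [Delta d] for [|t| < (1 - d) / growth], where
    [growth] is a constant times the norm of the initial datum: this is the
    formula for the lifespan.  The sum is differentiable in the norm
    ([tseries_is_tderiv]) and, products being Cauchy products, it satisfies the
    equation ([tseries_equation]).

    For uniqueness, two solutions are compared along the ray from [0] to [t].
    The derivative of the difference of their coefficients is at most
    [C * |k| * M] times the weight, if [M] bounds the difference.  Measured in a
    width that decreases linearly in time, with speed [L], this integrates to
    [(C / L) * M] times the weight, which is at most [M / 2] for large [L]
    ([gronwall_half]).  So the difference vanishes until the width is used up,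
    that is, for a time that does not depend on the starting point, and finitely
    many steps reach [t] ([gronwall], [solution_unique]). *)

(** * The modulus of complex numbers *)

Section Modulus.
Variable R : realType.
Implicit Types (z w : R[i]) (x : R).

Definition cmod z : R := complex.Re `|z|.

Lemma cmodE z : `|z| = (cmod z)%:C%C.
Proof. by rewrite /cmod normc_def. Qed.

Lemma cmod_ge0 z : 0 <= cmod z.
Proof. by rewrite -ler0c -cmodE normr_ge0. Qed.

Lemma cmodD z w : cmod (z + w) <= cmod z + cmod w.
Proof. by rewrite -lecR rmorphD /= -!cmodE ler_normD. Qed.

Lemma cmodM z w : cmod (z * w) = cmod z * cmod w.
Proof. by apply: complexI; rewrite rmorphM /= -!cmodE normrM. Qed.

Lemma cmodN z : cmod (- z) = cmod z.
Proof. by rewrite /cmod normrN. Qed.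

Lemma cmodBC z w : cmod (z - w) = cmod (w - z).
Proof. by rewrite /cmod distrC. Qed.

Lemma cmodB z w : cmod (z - w) <= cmod z + cmod w.
Proof. by rewrite -(cmodN w) cmodD. Qed.

Lemma cmodV z : cmod z^-1 = (cmod z)^-1.
Proof. by apply: complexI; rewrite fmorphV /= -!cmodE normfV. Qed.

Lemma cmodX z n : cmod (z ^+ n) = cmod z ^+ n.
Proof. by apply: complexI; rewrite rmorphXn /= -!cmodE normrX. Qed.

Lemma cmod_real x : cmod x%:C%C = `|x|.
Proof. by rewrite /cmod normc_def /= expr0n addr0 sqrtr_sqr. Qed.

Lemma cmod0 : cmod 0 = 0.
Proof. by rewrite /cmod normr0. Qed.

Lemma cmod1 : cmod 1 = 1.
Proof. by rewrite /cmod normr1. Qed.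

Lemma cmod_nat n : cmod n%:R = n%:R.
Proof. by rewrite /cmod normr_nat -[n%:R](rmorph_nat (real_complex R)). Qed.

Lemma cmod_i : cmod 'i%C = 1.
Proof. by rewrite /cmod normc_def /= expr0n expr1n add0r sqrtr1. Qed.

Lemma cmod_eq0 z : cmod z = 0 -> z = 0.
Proof. by move=> h; apply/eqP; rewrite -normr_eq0 cmodE h. Qed.

Lemma normRe_le z : `|complex.Re z| <= cmod z.
Proof.
rewrite /cmod normc_def /= -sqrtr_sqr; apply: ler_wsqrtr.
by rewrite lerDl sqr_ge0.
Qed.

Lemma normIm_le z : `|complex.Im z| <= cmod z.
Proof.
rewrite /cmod normc_def /= -sqrtr_sqr; apply: ler_wsqrtr.
by rewrite lerDr sqr_ge0.
Qed.

Lemma cmod_le_ReIm z : cmod z <= `|complex.Re z| + `|complex.Im z|.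
Proof.
rewrite {1}(complexE z); apply: (le_trans (cmodD _ _)).
by rewrite cmodM cmod_i mul1r !cmod_real.
Qed.

Lemma cmod_sum (I : Type) (r : seq I) (P : pred I) (F : I -> R[i]) :
  cmod (\sum_(i <- r | P i) F i) <= \sum_(i <- r | P i) cmod (F i).
Proof.
elim/big_ind2 : _ => [|a b c d h1 h2|//]; first by rewrite cmod0.
by apply: (le_trans (cmodD _ _)); rewrite lerD.
Qed.

Lemma cReD z w : complex.Re (z + w) = complex.Re z + complex.Re w.
Proof. by case: z w => [a b] [c d]. Qed.
Lemma cImD z w : complex.Im (z + w) = complex.Im z + complex.Im w.
Proof. by case: z w => [a b] [c d]. Qed.
Lemma cReB z w : complex.Re (z - w) = complex.Re z - complex.Re w.
Proof. by case: z w => [a b] [c d]. Qed.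
Lemma cImB z w : complex.Im (z - w) = complex.Im z - complex.Im w.
Proof. by case: z w => [a b] [c d]. Qed.
Lemma cReM z w : complex.Re (z * w) =
  complex.Re z * complex.Re w - complex.Im z * complex.Im w.
Proof. by case: z w => [a b] [c d]. Qed.
Lemma cImM z w : complex.Im (z * w) =
  complex.Re z * complex.Im w + complex.Im z * complex.Re w.
Proof. by case: z w => [a b] [c d]. Qed.
Lemma cRe_sum (I : Type) (r : seq I) (P : pred I) (F : I -> R[i]) :
  complex.Re (\sum_(i <- r | P i) F i) = \sum_(i <- r | P i) complex.Re (F i).
Proof. exact: (big_morph _ cReD). Qed.
Lemma cIm_sum (I : Type) (r : seq I) (P : pred I) (F : I -> R[i]) :
  complex.Im (\sum_(i <- r | P i) F i) = \sum_(i <- r | P i) complex.Im (F i).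
Proof. exact: (big_morph _ cImD). Qed.

Lemma complex_eq z w :
  complex.Re z = complex.Re w -> complex.Im z = complex.Im w -> z = w.
Proof. by case: z w => [a b] [c d] /= -> ->. Qed.

(** Convergence in the complex numbers is tested on the real-valued modulus,
    so that the real theory of limits (with its completeness) applies. *)
Lemma cvg_cmodP (T : Type) (F : set_system T) {FF : Filter F}
    (u : T -> R[i]) (l : R[i]) :
  ((u y : R[i]^o) @[y --> F] --> (l : R[i]^o)) <->
  (forall e, 0 < e -> \forall y \near F, cmod (u y - l) < e).
Proof.
have E (y : T) : `|(l : R[i]^o) - u y| = (cmod (u y - l))%:C%C.
  by rewrite cmodBC; exact: cmodE.
split=> [/cvgrPdist_lt h|h]; [|apply/cvgrPdist_lt]; move=> e e0.
  have /h : 0 < e%:C%C by rewrite ltcR.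
  by apply: filterS => y; rewrite E ltcR.
have e0' : 0 < complex.Re e by move: e0; rewrite ltcE => /andP[].
have Ee : e = (complex.Re e)%:C%C.
  by rewrite RRe_real// ger0_real// ltW.
by move/h : e0'; apply: filterS => y; rewrite E [in X in _ -> X]Ee ltcR.
Qed.

Lemma cvg_ReIm (T : Type) (F : set_system T) {FF : Filter F}
    (u : T -> R[i]) (l : R[i]) :
  complex.Re (u y) @[y --> F] --> complex.Re l ->
  complex.Im (u y) @[y --> F] --> complex.Im l ->
  (u y : R[i]^o) @[y --> F] --> (l : R[i]^o).
Proof.
move=> /cvgrPdist_lt hr /cvgrPdist_lt hi; apply/cvg_cmodP => e e0.
have e2 : 0 < e / 2 by rewrite divr_gt0.
apply: filterS2 (hr _ e2) (hi _ e2) => y h1 h2.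
apply: (le_lt_trans (cmod_le_ReIm _)); rewrite cReB cImB.
by rewrite (splitr e) ltrD// distrC.
Qed.

Lemma cvg_Re (T : Type) (F : set_system T) {FF : Filter F}
    (u : T -> R[i]) (l : R[i]) :
  (u y : R[i]^o) @[y --> F] --> (l : R[i]^o) ->
  complex.Re (u y) @[y --> F] --> complex.Re l.
Proof.
move=> /cvg_cmodP h; apply/cvgrPdist_lt => e /h.
by apply: filterS => y; apply: le_lt_trans; rewrite distrC -cReB normRe_le.
Qed.

Lemma cvg_Im (T : Type) (F : set_system T) {FF : Filter F}
    (u : T -> R[i]) (l : R[i]) :
  (u y : R[i]^o) @[y --> F] --> (l : R[i]^o) ->
  complex.Im (u y) @[y --> F] --> complex.Im l.
Proof.
move=> /cvg_cmodP h; apply/cvgrPdist_lt => e /h.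
by apply: filterS => y; apply: le_lt_trans; rewrite distrC -cImB normIm_le.
Qed.

Lemma cvg_cmod_le (u : nat -> R[i]) (l : R[i]) (B : R) :
  ((u n : R[i]^o) @[n --> \oo] --> (l : R[i]^o)) ->
  (forall n, cmod (u n) <= B) -> cmod l <= B.
Proof.
move=> /cvg_cmodP h hB; apply/ler_addgt0Pr => e e0.
have [n _ /(_ n (leqnn n)) hn] := h _ e0.
have -> : l = u n - (u n - l) by rewrite opprB addrC subrK.
by apply: (le_trans (cmodB _ _)); rewrite lerD// ltW.
Qed.

Lemma cvgC_unique (u : nat -> R[i]) (l l' : R[i]) :
  ((u n : R[i]^o) @[n --> \oo] --> (l : R[i]^o)) ->
  ((u n : R[i]^o) @[n --> \oo] --> (l' : R[i]^o)) -> l = l'.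
Proof. exact: (cvg_unique (@norm_hausdorff _ R[i]^o)). Qed.

End Modulus.

(** * Absolutely summable series of complex numbers *)

Section Series.
Variable R : realType.
Implicit Types (z w : nat -> R[i]) (y : nat -> R).

(** Series over [nat] only; a series over the integers is summed in pairs. *)
Definition csum (z : nat -> R[i]) : R[i] := limn (series z : nat -> R[i]^o).

(** A record, rather than its only field, so that unification does not unfold
    the limit. *)
Record hassum (z : nat -> R[i]) (l : R[i]) : Prop := HasSum {
  hassum_cvg : (series z : nat -> R[i]^o) @ \oo --> (l : R[i]^o) }.

Lemma hassum_csum z l : hassum z l -> csum z = l.
Proof. by move=> [h]; apply: (cvg_lim (@norm_hausdorff _ R[i]^o)). Qed.

(** Summability of a nonnegative majorant, with a bound of its sum: the
    explicit bound is what the estimates below transport. *)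
Definition sbd (y : nat -> R) (M : R) : Prop :=
  forall N, \sum_(0 <= n < N) y n <= M.

Lemma sbd_cvg y M : (forall n, 0 <= y n) -> sbd y M ->
  cvgn (series y) /\ limn (series y) <= M.
Proof.
move=> y0 yM.
have nd : nondecreasing_seq (series y).
  by apply/nondecreasing_seqP => n; rewrite seriesSr lerDl.
have cv : cvgn (series y).
  by apply: nondecreasing_is_cvgn => //; exists M => _ [n _ <-]; exact: yM.
by split=> //; apply: limr_le => //; near=> n; exact: yM.
Unshelve. all: by end_near. Qed.

Lemma sbd_tail y M : (forall n, 0 <= y n) -> sbd y M ->
  forall e, 0 < e -> exists N, forall n m, (N <= n)%N ->
    \sum_(n <= k < m) y k < e.
Proof.
move=> y0 yM e e0; have [cv _] := sbd_cvg y0 yM.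
move/cauchy_cvgP/cauchy_seriesP : cv => /(_ _ e0).
case=> [[A B] [[N1 _ hA] [N2 _ hB]] hAB].
exists (maxn N1 N2) => n m; rewrite geq_max => /andP[h1 h2].
have [mn|nm] := leqP m n; first by rewrite big_geq.
have /= := hAB (n, m); rewrite ger0_norm ?sumr_ge0//; apply; split => /=.
  exact: hA.
by apply: hB => /=; rewrite (leq_trans h2)// ltnW.
Qed.

Lemma sbd_hassum z y M : (forall n, cmod (z n) <= y n) -> sbd y M ->
  hassum z (csum z) /\ cmod (csum z) <= M.
Proof.
move=> zy yM.
have y0 n : 0 <= y n by apply: le_trans (zy n); exact: cmod_ge0.
have [cv _] := sbd_cvg y0 yM.
have hre : cvgn (series (fun n => complex.Re (z n))).
  apply: normed_cvg; apply: series_le_cvg cv => n //=.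
  by apply: le_trans (zy n); exact: normRe_le.
have him : cvgn (series (fun n => complex.Im (z n))).
  apply: normed_cvg; apply: series_le_cvg cv => n //=.
  by apply: le_trans (zy n); exact: normIm_le.
pose l : R[i] := (limn (series (fun n => complex.Re (z n))) +i*
                  limn (series (fun n => complex.Im (z n))))%C.
have hl : hassum z l.
  split; apply: cvg_ReIm => /=.
    by rewrite (_ : (fun _ => _) = series (fun n => complex.Re (z n)))//;
       apply/funext => n; rewrite /series /= cRe_sum.
  by rewrite (_ : (fun _ => _) = series (fun n => complex.Im (z n)))//;
     apply/funext => n; rewrite /series /= cIm_sum.
rewrite (hassum_csum hl); split=> //.
apply: (cvg_cmod_le (hassum_cvg hl)) => n; apply: (le_trans (cmod_sum _ _ _)).
by apply: le_trans (yM n); apply: ler_sum => i _.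
Qed.

Lemma hassumD z w a b : hassum z a -> hassum w b ->
  hassum (fun n => z n + w n) (a + b).
Proof.
move=> [ha] [hb]; split.
rewrite (_ : series _ = (fun n => series z n + series w n)).
  exact: (cvgD (V := R[i]^o) ha hb).
by apply/funext => n; rewrite /series /= big_split.
Qed.

Lemma hassumZ z (a l : R[i]) : hassum z l -> hassum (fun n => a * z n) (a * l).
Proof.
move=> [hl]; split.
rewrite (_ : series _ = (fun n => a * series z n)).
  exact: (@cvgZl_tmp _ R[i]^o _ _ _ a (series z) l hl).
by apply/funext => n; rewrite /series /= mulr_sumr.
Qed.

Lemma hassumB z w a b : hassum z a -> hassum w b ->
  hassum (fun n => z n - w n) (a - b).
Proof.
move=> ha hb; have := hassumD ha (hassumZ (-1) hb).
rewrite mulN1r; congr (hassum _ _).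
by apply/funext => n; rewrite mulN1r.
Qed.

Lemma hassum0 : hassum (fun=> 0) 0.
Proof.
split; rewrite (_ : series _ = fun=> 0); first exact: cvg_cst.
by apply/funext => n; rewrite /series /= big1.
Qed.

Lemma hassum_sum (I : Type) (r : seq I) (z : I -> nat -> R[i]) (l : I -> R[i]) :
  (forall i, hassum (z i) (l i)) ->
  hassum (fun n => \sum_(i <- r) z i n) (\sum_(i <- r) l i).
Proof.
move=> h; elim: r => [|i r IH].
  rewrite big_nil (_ : (fun _ => _) = fun=> 0); first exact: hassum0.
  by apply/funext => n; rewrite big_nil.
rewrite big_cons (_ : (fun _ => _) = fun n => z i n + \sum_(i <- r) z i n).
  exact: (hassumD (h i) IH).
by apply/funext => n; rewrite big_cons.
Qed.

Lemma hassum_fin z N : (forall n, (N <= n)%N -> z n = 0) ->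
  hassum z (\sum_(0 <= n < N) z n).
Proof.
move=> hz; split; apply: cvg_near_cst; exists N => // n /= Nn.
rewrite /series /= (@big_cat_nat _ _ _ N 0 n)//=.
rewrite [X in _ + X](_ : _ = 0) ?addr0// big_nat_cond big1//.
by move=> i /andP[/andP[Ni _] _]; exact: hz.
Qed.

Lemma big_nat_shift (V : zmodType) (F : nat -> V) N n :
  \sum_(N <= i < n + N) F i = \sum_(0 <= i < n) F (i + N)%N.
Proof. by rewrite -{1}(add0n N) big_addn addnK. Qed.

Lemma hassum_shift z N l : hassum z l ->
  hassum (fun n => z (n + N)%N) (l - \sum_(0 <= n < N) z n).
Proof.
move=> [hl]; split.
rewrite (_ : series _ =
    (fun n => series z (n + N)%N - \sum_(0 <= n < N) z n)).
  apply: (@cvgB _ R[i]^o); last exact: cvg_cst.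
  by rewrite (cvg_shiftn N (series z : nat -> R[i]^o)).
apply/funext => n; rewrite /series /= (@big_cat_nat _ _ _ N 0 (n + N))//=.
  by rewrite [RHS]addrC addKr big_nat_shift.
exact: leq_addl.
Qed.

Lemma hassum_unshift z N l : hassum (fun n => z (n + N)%N) l ->
  hassum z (\sum_(0 <= n < N) z n + l).
Proof.
move=> [hl]; split; rewrite -(cvg_shiftn N (series z : nat -> R[i]^o)).
rewrite (_ : (fun _ => _) = (fun n => \sum_(0 <= n < N) z n +
    series (fun n => z (n + N)%N) n)).
  by apply: (@cvgD _ R[i]^o); [exact: cvg_cst|exact: hl].
apply/funext => n; rewrite /series /= (@big_cat_nat _ _ _ N 0 (n + N))//=.
  by rewrite big_nat_shift.
exact: leq_addl.
Qed.

Lemma sbd_csum_tail z y M N e : (forall n, cmod (z n) <= y n) -> sbd y M ->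
  (forall m, \sum_(N <= k < m) y k <= e) ->
  cmod (csum z - \sum_(0 <= n < N) z n) <= e.
Proof.
move=> zy yM ye; have [hz _] := sbd_hassum zy yM.
have hs := hassum_shift N hz.
apply: (cvg_cmod_le (hassum_cvg hs)) => n.
rewrite /series /=; apply: (le_trans (cmod_sum _ _ _)).
apply: le_trans (ye (n + N)%N).
by rewrite big_nat_shift; apply: ler_sum.
Qed.

(** Interchange of summations, for a double series dominated by a product: the
    tails of the inner sums are uniformly small against a summable weight. *)
Lemma csum_interchange (z : nat -> nat -> R[i]) (x y : nat -> R) X Y :
  (forall n, 0 <= x n) -> (forall n, 0 <= y n) -> sbd x X -> sbd y Y ->
  (forall n m, cmod (z n m) <= x n * y m) ->
  hassum (fun m => csum (fun n => z n m)) (csum (fun n => csum (z n))).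
Proof.
move=> x0 y0 xX yY zxy.
have X0 : 0 <= X by apply: le_trans (xX 0%N); rewrite big_nil.
have Y0 : 0 <= Y by apply: le_trans (yY 0%N); rewrite big_nil.
have sb1 n : sbd (fun m => x n * y m) (x n * Y).
  by move=> N; rewrite -mulr_sumr ler_wpM2l.
have sb2 m : sbd (fun n => x n * y m) (X * y m).
  by move=> N; rewrite -mulr_suml ler_wpM2r.
have hn n : hassum (z n) (csum (z n)) /\ cmod (csum (z n)) <= x n * Y.
  by apply: sbd_hassum (sb1 n) => m.
have hm m : hassum (fun n => z n m) (csum (fun n => z n m)) /\
    cmod (csum (fun n => z n m)) <= X * y m.
  by apply: sbd_hassum (sb2 m) => n.
have sb3 : sbd (fun n => x n * Y) (X * Y).
  by move=> N; rewrite -mulr_suml ler_wpM2r.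
have sb4 : sbd (fun m => X * y m) (X * Y).
  by move=> N; rewrite -mulr_sumr ler_wpM2l.
have [h1 _] := sbd_hassum (fun n => (hn n).2) sb3.
have [h2 _] := sbd_hassum (fun m => (hm m).2) sb4.
(* Both iterated sums exist by domination; the outer partial sums of the
   first one are shown to converge to the second one. *)
suff -> : csum (fun n => csum (z n)) = csum (fun m => csum (fun n => z n m)).
  exact: h2.
apply: (cvgC_unique (hassum_cvg h1)); apply/cvg_cmodP => e e0.
have e1 : 0 < e / (Y + 1) by rewrite divr_gt0// ltr_wpDl.
have [N hN] := sbd_tail x0 xX e1.
exists N => // n /= Nn; rewrite /series /= cmodBC.
have hfin := hassum_sum (index_iota 0 n) (fun n => (hn n).1).
have -> : csum (fun m => csum (fun n => z n m)) - \sum_(0 <= k < n) csum (z k)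
    = csum (fun m => csum (fun n => z n m) - \sum_(0 <= k < n) z k m).
  exact/esym/hassum_csum/(hassumB h2 hfin).
have tl m : cmod (csum (fun n => z n m) - \sum_(0 <= k < n) z k m) <=
    e / (Y + 1) * y m.
  apply: (sbd_csum_tail _ (sb2 m)) => // m'.
  by rewrite -mulr_suml ler_wpM2r// ltW// hN.
have sb5 : sbd (fun m => e / (Y + 1) * y m) (e / (Y + 1) * Y).
  by move=> k; rewrite -mulr_sumr ler_wpM2l// ltW.
have [_ /le_lt_trans] := sbd_hassum tl sb5; apply.
by rewrite mulrAC ltr_pdivrMr ?ltr_wpDl// ltr_pM2l// ltrDl.
Qed.

Lemma sbd_geometric (t B : R) : 0 <= t -> t < 1 -> 0 <= B ->
  sbd (fun n => B * t ^+ n) (B / (1 - t)).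
Proof.
move=> t0 t1 B0 N; rewrite -mulr_sumr ler_wpM2l//.
rewrite -[X in _ <= X]mul1r ler_pdivlMr ?subr_gt0//.
rewrite big_mkord mulrC -opprB mulNr -subrX1 opprB.
by rewrite lerBlDr lerDl exprn_ge0.
Qed.

(** The Cauchy product is an interchange of summations: the terms
    [x i * y (n - i)], extended by 0 for [n < i], are dominated by the product
    of two geometric series of ratio [sqrt t], because [t ^ n <= sqrt t ^ (i + n)]
    for [i <= n]. *)
Lemma cauchy_product (x y : nat -> R[i]) (A B t : R) :
  0 <= t -> t < 1 ->
  (forall n, cmod (x n) <= A * t ^+ n) -> (forall n, cmod (y n) <= B * t ^+ n) ->
  hassum (fun n => \sum_(i < n.+1) x i * y (n - i)%N) (csum x * csum y).
Proof.
move=> t0 t1 hx hy.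
have A0 : 0 <= A by rewrite -[A]mulr1 -(expr0 t) (le_trans (cmod_ge0 _) (hx _)).
have B0 : 0 <= B by rewrite -[B]mulr1 -(expr0 t) (le_trans (cmod_ge0 _) (hy _)).
pose s := Num.sqrt t.
have s0 : 0 <= s by exact: sqrtr_ge0.
have s1 : s < 1 by rewrite -(sqrtr1 R) ltr_sqrt.
have ts : t = s * s by rewrite -expr2 sqr_sqrtr.
have [hcx _] := sbd_hassum hx (sbd_geometric t0 t1 A0).
have [hcy _] := sbd_hassum hy (sbd_geometric t0 t1 B0).
pose z i n : R[i] := if (i <= n)%N then x i * y (n - i)%N else 0.
have zb i n : cmod (z i n) <= (A * s ^+ i) * (B * s ^+ n).
  rewrite /z; case: ifP => [le_in|_]; last first.
    by rewrite cmod0 !mulr_ge0// exprn_ge0.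
  rewrite cmodM; apply: (le_trans (ler_pM _ _ (hx i) (hy _))); rewrite ?cmod_ge0//.
  rewrite mulrACA [X in _ <= X]mulrACA ler_wpM2l ?mulr_ge0// -exprD subnKC//.
  rewrite ts -expr2 -exprM -exprD; apply: ler_wiXn2l => //; first exact: ltW.
  by rewrite mul2n -addnn leq_add2r.
have h := csum_interchange
  (fun n => mulr_ge0 A0 (exprn_ge0 n s0)) (fun n => mulr_ge0 B0 (exprn_ge0 n s0))
  (sbd_geometric s0 s1 A0) (sbd_geometric s0 s1 B0) zb.
have -> : csum x * csum y = csum (fun i => csum (z i)).
  apply/esym/hassum_csum; rewrite mulrC.
  have := hassumZ (csum y) hcx; congr (hassum _ _); apply/funext => i.
  apply/esym/hassum_csum; rewrite -[_ * _]add0r.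
  have -> : 0 = \sum_(0 <= n < i) z i n.
    rewrite big_nat_cond big1// => n /andP[/andP[_ ni] _].
    by rewrite /z leqNgt ni.
  apply: hassum_unshift; have := hassumZ (x i) hcy.
  rewrite mulrC; congr (hassum _ _); apply/funext => n.
  by rewrite /z leq_addl addnK.
move: h; congr (hassum _ _); apply/funext => n; apply: hassum_csum.
rewrite (_ : \sum_(i < n.+1) _ = \sum_(0 <= i < n.+1) z i n).
  by apply: hassum_fin => i ni; rewrite /z leqNgt ni.
by rewrite big_mkord; apply: eq_bigr => i _; rewrite /z -ltnS ltn_ord.
Qed.

End Series.

(** * Sums over the integers and weights *)

(** Grouping [k] with [- k] turns a series over the integers into a series over
    [nat], as in the definition of [Ainv]. *)
Definition pairing (V : zmodType) (c : int -> V) (n : nat) : V :=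
  if n is 0 then c 0 else c n%:Z + c (- n%:Z).

Section Weights.
Variable R : realType.
Implicit Types (k j : int) (d e x : R).

Definition qnat (n : nat) : R := (n.+1%:R * Num.sqrt n.+1%:R)^-1.

(** The weight [(1 + |k|) ^ (- 3 / 2)] is borderline: square summability with
    [s + 1 > 3 / 2] derivatives bounds the coefficients by it, and it is still
    summable, so that it is stable by convolution. *)
Definition qw k : R := qnat `|k|.

Lemma qnat_gt0 n : 0 < qnat n.
Proof. by rewrite invr_gt0 mulr_gt0 ?sqrtr_gt0. Qed.

Lemma qnat_anti m n : (m <= n)%N -> qnat n <= qnat m.
Proof.
move=> mn; rewrite /qnat lef_pV2 ?posrE ?mulr_gt0 ?sqrtr_gt0//.
by rewrite ler_pM ?sqrtr_ge0 ?ler_nat// ler_wsqrtr// ler_nat.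
Qed.

Lemma qnat_double m n : (m.+1 <= 2 * n.+1)%N -> qnat n <= 3 * qnat m.
Proof.
move=> mn; rewrite /qnat -[3]invrK -invfM lef_pV2 ?posrE; last 2 first.
- by rewrite mulr_gt0 ?sqrtr_gt0.
- by rewrite mulr_gt0 ?invr_gt0// mulr_gt0 ?sqrtr_gt0.
rewrite mulrC ler_pdivrMr//.
have s2 : Num.sqrt 2 <= 3 / 2 :> R.
  by rewrite -[leRHS]ger0_norm ?divr_ge0// -sqrtr_sqr ler_wsqrtr//; lra.
have h1 : m.+1%:R <= 2 * n.+1%:R :> R by rewrite -natrM ler_nat.
have h2 : Num.sqrt m.+1%:R <= 3 / 2 * Num.sqrt n.+1%:R :> R.
  apply: (le_trans (ler_wsqrtr h1)); rewrite sqrtrM//.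
  by rewrite ler_wpM2r ?sqrtr_ge0.
apply: (le_trans (ler_pM _ _ h1 h2)); rewrite ?sqrtr_ge0//; lra.
Qed.

Lemma qw_gt0 k : 0 < qw k.
Proof. exact: qnat_gt0. Qed.

Lemma qw_ge0 k : 0 <= qw k.
Proof. exact/ltW/qw_gt0. Qed.

Lemma qwN k : qw (- k) = qw k.
Proof. by rewrite /qw abszN. Qed.

Lemma qw_le1 k : qw k <= 1.
Proof.
apply: (le_trans (@qnat_anti 0 _ _)) => //.
by rewrite /qnat sqrtr1 mulr1 invr1.
Qed.

(** Either [j] or [k - j] is at least half as large as [k]. *)
Lemma qw_conv k j : qw j * qw (k - j) <= 3 * qw k * (qw j + qw (k - j)).
Proof.
have h (a b : int) : (`|k| <= 2 * `|b|)%N -> qw a * qw b <= 3 * qw k * qw a.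
  move=> h; rewrite mulrC ler_wpM2r ?qw_ge0// /qw.
  by apply: qnat_double; lia.
rewrite mulrDr; have [h1|h1] := leqP `|j| `|k - j|.
  apply: (le_trans (h j (k - j) _)); first by lia.
  by rewrite lerDl !mulr_ge0// qw_ge0.
rewrite mulrC; apply: (le_trans (h (k - j) j _)); first by lia.
by rewrite lerDr !mulr_ge0// qw_ge0.
Qed.

(** A bounded discrete primitive of a majorant of the weight. *)
Let g (n : nat) : R := if n is 0 then 0 else 3 - 2 / Num.sqrt n%:R.

Let qnat_g n : qnat n <= g n.+1 - g n.
Proof.
case: n => [|n]; first by rewrite /qnat /g sqrtr1 mulr1 invr1; lra.
have e (m : nat) : m%:R = Num.sqrt m%:R ^+ 2 :> R by rewrite sqr_sqrtr.
rewrite /g /qnat {1}(e n.+2).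
set a := Num.sqrt n.+1%:R; set b := Num.sqrt n.+2%:R.
have a0 : 0 < a by rewrite sqrtr_gt0.
have ab : a <= b by rewrite ler_wsqrtr// ler_nat.
have b0 : 0 < b by exact: lt_le_trans ab.
have hab : b ^+ 2 - a ^+ 2 = 1.
  by rewrite -!e -natrB// subSnn.
have -> : 3 - 2 / b - (3 - 2 / a) = 2 * (b - a) / (a * b).
  by field; rewrite !gt_eqF.
rewrite -[X in X <= _]mul1r -exprSr.
rewrite ler_pdivrMr ?exprn_gt0// mulrAC ler_pdivlMr ?mulr_gt0// mul1r.
have h3 : (b - a) * (b + a) = 1 by rewrite -hab; ring.
have ba : 0 <= b - a by rewrite subr_ge0.
have -> : 2 * (b - a) * b ^+ 3 = (b - a) * (2 * b) * b ^+ 2 by ring.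
have : 1 * b ^+ 2 <= (b - a) * (2 * b) * b ^+ 2.
  by rewrite ler_wpM2r ?sqr_ge0// -[X in X <= _]h3 ler_wpM2l// mulr_natl mulr2n lerD2l.
by apply: le_trans; rewrite mul1r expr2 ler_pM// ltW.
Qed.

Let G k : R := match k with Posz n => g n | Negz n => - g n.+1 end.

Let g_bounds n : 0 <= g n <= 3.
Proof.
case: n => [|n]; rewrite /g; first by lra.
have s1 : 1 <= Num.sqrt n.+1%:R :> R.
  by rewrite -{1}(sqrtr1 R) ler_wsqrtr// ler1n.
have : 0 <= 2 / Num.sqrt n.+1%:R :> R by rewrite divr_ge0// sqrtr_ge0.
have : 2 / Num.sqrt n.+1%:R <= 2 :> R.
  by rewrite ler_pdivrMr ?(lt_le_trans _ s1)// ler_peMr.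
by lra.
Qed.

Let qw_G k : qw k <= G (k + 1) - G k.
Proof.
case: k => [n|[|n]].
- by rewrite -PoszD addn1 /qw absz_nat /=; exact: qnat_g.
- rewrite (_ : Negz 0 + 1 = 0)//= opprK add0r.
  apply: (le_trans (@qnat_anti 0 1%N _)) => //.
  by have := qnat_g 0; rewrite subr0.
- rewrite (_ : Negz n.+1 + 1 = Negz n)/=; last by lia.
  rewrite opprK addrC; apply: le_trans (qnat_g n.+1).
  by apply: qnat_anti; lia.
Qed.

(** By telescoping.  The bound is uniform in the starting point, since [k] is
    the shift of a convolution in what follows. *)
Lemma sum_qw k n : \sum_(0 <= i < n) qw (k + i%:Z) <= 6.
Proof.
have Gb j : - 3 <= G j <= 3.
  by case: j => m; [have := g_bounds m|have := g_bounds m.+1]; rewrite /G; lra.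
apply: (@le_trans _ _ (G (k + n%:Z) - G k)).
  elim: n => [|n IH]; first by rewrite big_nil addr0 subrr.
  rewrite big_nat_recr//=; apply: (le_trans (lerD IH (qw_G _))).
  by rewrite (_ : k + n.+1%:Z = k + n%:Z + 1); [lra|lia].
by have := Gb (k + n%:Z); have := Gb k; lra.
Qed.

Lemma sum_qwN k n : \sum_(0 <= i < n) qw (k - i%:Z) <= 6.
Proof.
under eq_bigr do rewrite -qwN opprB addrC.
exact: sum_qw.
Qed.

Lemma cmod_pairing (c : int -> R[i]) (y : int -> R) n :
  (forall k, cmod (c k) <= y k) -> cmod (pairing c n) <= pairing y n.
Proof.
by move=> cy; case: n => [|n] //=; apply: (le_trans (cmodD _ _)); rewrite lerD.
Qed.

Lemma sum_pairing_le (y : int -> R) n : (forall k, 0 <= y k) ->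
  \sum_(0 <= i < n) pairing y i <=
  \sum_(0 <= i < n) y i%:Z + \sum_(0 <= i < n) y (0 - i%:Z).
Proof.
move=> y0; rewrite -big_split /=; apply: ler_sum => -[|i] _.
  by rewrite /= lerDl.
by rewrite /= sub0r.
Qed.

Lemma sbd_qw (A : R) : 0 <= A -> sbd (pairing (fun k => A * qw k)) (12 * A).
Proof.
move=> A0 N; apply: (le_trans (sum_pairing_le _ _)).
  by move=> k; rewrite mulr_ge0// qw_ge0.
rewrite -!mulr_sumr -mulrDr mulrC ler_wpM2r//.
have := sum_qw 0 N; have := sum_qwN 0 N.
under [X in _ -> X <= _ -> _]eq_bigr do rewrite add0r; lra.
Qed.

(** One of the two factors is comparable to [qw k] and the other is summable. *)
Lemma sbd_conv (A : R) k : 0 <= A ->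
  sbd (pairing (fun j => A * (qw j * qw (k - j)))) (72 * A * qw k).
Proof.
move=> A0 N.
have -> : 72 * A * qw k = 3 * A * qw k * 24 by ring.
apply: (@le_trans _ _ (\sum_(0 <= i < N)
   pairing (fun j => 3 * A * qw k * (qw j + qw (k - j))) i)).
  have h j : A * (qw j * qw (k - j)) <= 3 * A * qw k * (qw j + qw (k - j)).
    have := ler_wpM2l A0 (qw_conv k j); congr (_ <= _); ring.
  by apply: ler_sum => -[|i] _ /=; [exact: h|rewrite lerD].
apply: (le_trans (sum_pairing_le _ _)).
  by move=> j; rewrite !mulr_ge0 ?addr_ge0 ?qw_ge0.
rewrite -!mulr_sumr -mulrDr ler_wpM2l ?mulr_ge0 ?qw_ge0//.
rewrite !big_split /=.
have := sum_qw 0 N; have := sum_qwN 0 N; have := sum_qwN k N.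
have := sum_qw k N.
under [X in _ -> _ -> _ -> X <= _ -> _]eq_bigr do rewrite add0r.
under [X in _ -> _ -> _ -> _ -> _ + (_ + X) <= _]eq_bigr
  do rewrite sub0r opprK.
lra.
Qed.

(** The exponential is the decay of the Fourier coefficients of a function
    analytic in the strip of half-width [d]. *)
Definition gw d k : R := qw k * expR (- (2 * pi * d * `|k|%:R)).

Lemma gw_gt0 d k : 0 < gw d k.
Proof. by rewrite mulr_gt0 ?qw_gt0 ?expR_gt0. Qed.

Lemma gw_ge0 d k : 0 <= gw d k.
Proof. exact/ltW/gw_gt0. Qed.

Lemma gw0 k : gw 0 k = qw k.
Proof. by rewrite /gw mulr0 mul0r oppr0 expR0 mulr1. Qed.

Lemma gw_anti d e k : d <= e -> gw e k <= gw d k.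
Proof.
move=> de; rewrite /gw ler_wpM2l ?qw_ge0// ler_expR lerN2.
by rewrite ler_wpM2r// ler_wpM2l ?mulr_ge0 ?pi_ge0.
Qed.

Lemma gw_le_qw d k : 0 <= d -> gw d k <= qw k.
Proof. by move=> d0; rewrite -gw0 gw_anti. Qed.

Lemma gwD d e k : gw (d + e) k = gw d k * expR (- (2 * pi * e * `|k|%:R)).
Proof. by rewrite /gw -[RHS]mulrA -expRD; congr (_ * expR _); ring. Qed.

Lemma mul_expRN_le1 x : x * expR (- x) <= 1.
Proof.
rewrite expRN ler_pdivrMr ?expR_gt0// mul1r.
by apply: le_trans (expR_ge1Dx x); rewrite lerDr.
Qed.

(** From [x exp (- x) <= 1]: one derivative costs the reciprocal of the loss in
    the width. *)
Lemma gw_deriv d e k : 0 < e -> 2 * pi * `|k|%:R * gw (d + e) k <= e^-1 * gw d k.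
Proof.
move=> e0; rewrite gwD mulrCA mulrC ler_wpM2r ?gw_ge0//.
rewrite -[X in _ <= X]mul1r ler_pdivlMr//.
apply: le_trans (mul_expRN_le1 (2 * pi * e * `|k|%:R)).
by rewrite le_eqVlt; apply/orP; left; apply/eqP; ring.
Qed.

Lemma gw_conv d k j : 0 <= d ->
  gw d j * gw d (k - j) <= expR (- (2 * pi * d * `|k|%:R)) * (qw j * qw (k - j)).
Proof.
move=> d0; rewrite /gw mulrACA mulrC ler_wpM2r ?mulr_ge0 ?qw_ge0//.
rewrite -expRD ler_expR -opprD lerN2 -mulrDr -natrD ler_wpM2l ?ler_nat//.
  by rewrite !mulr_ge0 ?pi_ge0.
by lia.
Qed.

End Weights.

(** * Fourier coefficients of integrable functions on the circle *)

Section Circle.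
Variable R : realType.
Implicit Types (f g : R -> R[i]) (k j : int) (x y : R).

Definition int01 (h : R -> R) : Prop :=
  lebesgue_measure.-integrable (`[0, 1] : set R) (EFin \o h).

Definition intC f : Prop :=
  int01 (fun x => complex.Re (f x)) /\ int01 (fun x => complex.Im (f x)).

(** A record for the same reason as [hassum]. *)
Record contC f : Prop := ContC { contC_cvg : continuous (f : R -> R[i]^o) }.

Definition cderiv f g : Prop := forall x,
  is_derive x (1 : R) (fun y => complex.Re (f y)) (complex.Re (g x)) /\
  is_derive x (1 : R) (fun y => complex.Im (f y)) (complex.Im (g x)).

Lemma contC_Re f : contC f -> continuous (fun x => complex.Re (f x)).
Proof. by move=> [cf] x; apply: cvg_Re; exact: cf. Qed.

Lemma contC_Im f : contC f -> continuous (fun x => complex.Im (f x)).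
Proof. by move=> [cf] x; apply: cvg_Im; exact: cf. Qed.

Lemma contC_ReIm f : continuous (fun x => complex.Re (f x)) ->
  continuous (fun x => complex.Im (f x)) -> contC f.
Proof. by move=> h1 h2; split=> x; apply: cvg_ReIm; [exact: h1|exact: h2]. Qed.

Lemma contCD f g : contC f -> contC g -> contC (fun x => f x + g x).
Proof. by move=> [cf] [cg]; split=> x; apply: (@cvgD _ R[i]^o); [exact: cf|exact: cg]. Qed.

Lemma contCM f g : contC f -> contC g -> contC (fun x => f x * g x).
Proof.
move=> [cf] [cg]; split=> x.
exact: (@cvgZ _ R[i]^o _ _ _ f g (f x) (g x) (cf x) (cg x)).
Qed.

Lemma contC_cst (a : R[i]) : contC (fun=> a).
Proof. by split=> x; exact: cvg_cst. Qed.

Lemma contCZ (a : R[i]) f : contC f -> contC (fun x => a * f x).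
Proof. by move=> cf; exact: (contCM (contC_cst a) cf). Qed.

Lemma contCB f g : contC f -> contC g -> contC (fun x => f x - g x).
Proof. by move=> [cf] [cg]; split=> x; apply: (@cvgB _ R[i]^o); [exact: cf|exact: cg]. Qed.

Lemma contC_sum (I : Type) (r : seq I) (F : I -> R -> R[i]) :
  (forall i, contC (F i)) -> contC (fun x => \sum_(i <- r) F i x).
Proof.
move=> cF; elim: r => [|i r IH].
  rewrite (_ : (fun _ => _) = (fun=> 0)); first exact: contC_cst.
  by apply/funext => x; rewrite big_nil.
rewrite (_ : (fun _ => _) = (fun x => F i x + \sum_(i <- r) F i x)).
  exact: (contCD (cF i) IH).
by apply/funext => x; rewrite big_cons.
Qed.

Lemma cderiv_contC f g : cderiv f g -> contC f.
Proof.
move=> fg; apply: contC_ReIm => x; apply/differentiable_continuous/derivable1_diffP.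
  by have [[]] := fg x.
by have [_ []] := fg x.
Qed.

Lemma is_derive_congr (u v : R -> R) (x du dv : R) :
  is_derive x (1 : R) u du -> u =1 v -> du = dv -> is_derive x (1 : R) v dv.
Proof. by move=> h /funext <- <-. Qed.

Lemma cderivM f f' g g' : cderiv f f' -> cderiv g g' ->
  cderiv (fun x => f x * g x) (fun x => f' x * g x + f x * g' x).
Proof.
move=> hf hg x; have [fr fi] := hf x; have [gr gi] := hg x; split.
  apply: (is_derive_congr (is_deriveB (is_deriveM fr gr) (is_deriveM fi gi))).
    by move=> y; rewrite cReM.
  by rewrite cReD !cReM /GRing.scale /=; ring.
apply: (is_derive_congr (is_deriveD (is_deriveM fr gi) (is_deriveM fi gr))).
  by move=> y; rewrite cImM.
by rewrite cImD !cImM /GRing.scale /=; ring.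
Qed.

Lemma cderiv_unique f g h : cderiv f g -> cderiv f h -> g = h.
Proof.
move=> hg hh; apply/funext => x; have [a b] := hg x; have [c d] := hh x.
apply: complex_eq.
  by have [_ <-] := a; have [_ <-] := c.
by have [_ <-] := b; have [_ <-] := d.
Qed.

Lemma cderiv_dx f g : cderiv f g -> dx f = g.
Proof.
move=> fg; apply/funext => x; have [[h1 e1] [h2 e2]] := fg x.
by apply: complex_eq => /=; rewrite derive1E.
Qed.

Lemma contC_intC f : contC f -> intC f.
Proof.
move=> cf; split; apply: continuous_compact_integrable; try exact: segment_compact.
  by apply: continuous_subspaceT; exact: contC_Re.
by apply: continuous_subspaceT; exact: contC_Im.
Qed.

Lemma int01D (u v : R -> R) : int01 u -> int01 v -> int01 (fun x => u x + v x).
Proof.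
move=> hu hv.
rewrite /int01 (_ : EFin \o _ = ((EFin \o u) \+ (EFin \o v))%E).
  by apply: integrableD.
by apply/funext => x; rewrite /= EFinD.
Qed.

Lemma int01B (u v : R -> R) : int01 u -> int01 v -> int01 (fun x => u x - v x).
Proof.
move=> hu hv.
rewrite /int01 (_ : EFin \o _ = ((EFin \o u) \- (EFin \o v))%E).
  by apply: integrableB.
by apply/funext => x; rewrite /= EFinB.
Qed.

Lemma intCD f g : intC f -> intC g -> intC (fun x => f x + g x).
Proof.
move=> [f1 f2] [g1 g2]; split.
  have := int01D f1 g1; congr int01; apply/funext => x.
  by rewrite cReD.
have := int01D f2 g2; congr int01; apply/funext => x.
by rewrite cImD.
Qed.

Lemma integrable_mul_cont (b h : R -> R) : continuous b ->
  int01 h -> int01 (fun x => b x * h x).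
Proof.
rewrite /int01.
move=> cb ih.
rewrite (_ : EFin \o _ = ((EFin \o b) \* (EFin \o h))%E)//.
apply: integrableMr => //.
  by apply: measurable_funTS; exact: continuous_measurable_fun.
have /compact_bounded[M [_ mrt]] :
    compact (b @` (`[0, 1] : set R)).
  apply: continuous_compact; last exact: segment_compact.
  exact: continuous_subspaceT.
by exists M; split; rewrite ?num_real // => ? ? ? ?; apply: mrt.
Qed.

Lemma intCM f g : contC f -> intC g -> intC (fun x => f x * g x).
Proof.
move=> cf [g1 g2]; split.
  have := int01B (integrable_mul_cont (contC_Re cf) g1)
                 (integrable_mul_cont (contC_Im cf) g2).
  by congr int01; apply/funext => x; rewrite cReM.
have := int01D (integrable_mul_cont (contC_Re cf) g2)
               (integrable_mul_cont (contC_Im cf) g1).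
by congr int01; apply/funext => x; rewrite cImM.
Qed.

Lemma intCZ (a : R[i]) f : intC f -> intC (fun x => a * f x).
Proof. by apply: intCM; exact: contC_cst. Qed.

Lemma intCB f g : intC f -> intC g -> intC (fun x => f x - g x).
Proof.
move=> hf hg; have := intCD hf (intCZ (-1) hg); congr intC.
by apply/funext => x; rewrite mulN1r.
Qed.

Lemma meanD f g : intC f -> intC g ->
  mean (fun x => f x + g x) = mean f + mean g.
Proof.
move=> [f1 f2] [g1 g2]; rewrite /mean; apply: complex_eq; rewrite ?cReD ?cImD /=.
  by rewrite -RintegralD//; apply: eq_Rintegral => x _; rewrite cReD.
by rewrite -RintegralD//; apply: eq_Rintegral => x _; rewrite cImD.
Qed.

Lemma meanZ (a : R[i]) f : intC f -> mean (fun x => a * f x) = a * mean f.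
Proof.
move=> [f1 f2]; rewrite /mean; apply: complex_eq; rewrite ?cReM ?cImM /=.
  rewrite -!RintegralZl// -RintegralB//.
  - by apply: eq_Rintegral => x _; rewrite cReM.
  - exact: (integrable_mul_cont (@cst_continuous _ _ (complex.Re a)) f1).
  - exact: (integrable_mul_cont (@cst_continuous _ _ (complex.Im a)) f2).
rewrite -!RintegralZl// -RintegralD//.
- by apply: eq_Rintegral => x _; rewrite cImM.
- exact: (integrable_mul_cont (@cst_continuous _ _ (complex.Re a)) f2).
- exact: (integrable_mul_cont (@cst_continuous _ _ (complex.Im a)) f1).
Qed.

Lemma meanB f g : intC f -> intC g ->
  mean (fun x => f x - g x) = mean f - mean g.
Proof.
move=> hf hg; rewrite -[- mean g]mulN1r -meanZ// -meanD//; last exact: intCZ.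
by congr mean; apply/funext => x; rewrite mulN1r.
Qed.

Lemma intC0 : intC (fun=> 0).
Proof. exact/contC_intC/contC_cst. Qed.

Lemma mean0 : mean (fun=> 0 : R[i]) = 0 :> R[i].
Proof.
rewrite -[RHS](mul0r (mean (fun=> 0))) -(meanZ 0 intC0).
by congr mean; apply/funext => x; rewrite mul0r.
Qed.

Lemma intC_sum (I : Type) (r : seq I) (F : I -> R -> R[i]) :
  (forall i, intC (F i)) -> intC (fun x => \sum_(i <- r) F i x).
Proof.
move=> iF; elim: r => [|i r IH].
  rewrite (_ : (fun _ => _) = (fun=> 0)); first exact: intC0.
  by apply/funext => x; rewrite big_nil.
rewrite (_ : (fun _ => _) = (fun x => F i x + \sum_(i <- r) F i x)).
  exact: (intCD (iF i) IH).
by apply/funext => x; rewrite big_cons.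
Qed.

Lemma mean_sum (I : Type) (r : seq I) (F : I -> R -> R[i]) :
  (forall i, intC (F i)) ->
  mean (fun x => \sum_(i <- r) F i x) = \sum_(i <- r) mean (F i).
Proof.
move=> iF; elim: r => [|i r IH].
  rewrite big_nil (_ : (fun _ => _) = (fun=> 0)) ?mean0//.
  by apply/funext => x; rewrite big_nil.
rewrite big_cons -IH -meanD//; last exact: intC_sum.
by congr mean; apply/funext => x; rewrite big_cons.
Qed.

Lemma normr_Rintegral01 (h : R -> R) M : int01 h ->
  (forall x, 0 <= x <= 1 -> `|h x| <= M) ->
  `| \int[lebesgue_measure]_(x in `[0, 1]) h x | <= M.
Proof.
move=> ih hM; apply: (le_trans (le_normr_Rintegral _ ih)) => //.
apply: (@le_trans _ _ (\int[lebesgue_measure]_(x in (`[0, 1] : set R)) M)).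
  apply: le_Rintegral => //.
  - exact: (integrable_norm ih).
  - by apply: continuous_compact_integrable;
      [exact: segment_compact|apply: continuous_subspaceT; exact: cst_continuous].
by rewrite Rintegral_cst//= lebesgue_measure_itv /= lte_fin ltr01 -EFinB subr0 mulr1.
Qed.

(** The factor 2 comes from estimating the real and imaginary parts separately. *)
Lemma cmod_mean f M : intC f -> (forall x, 0 <= x <= 1 -> cmod (f x) <= M) ->
  cmod (mean f) <= 2 * M.
Proof.
move=> [f1 f2] fM; apply: (le_trans (cmod_le_ReIm _)).
rewrite mulr_natl mulr2n lerD//= normr_Rintegral01// => x /fM; apply: le_trans.
  exact: normRe_le.
exact: normIm_le.
Qed.

Lemma mean_deriv f g : cderiv f g -> contC g -> mean g = f 1 - f 0.
Proof.
move=> fg cg.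
have cf := cderiv_contC fg.
rewrite /mean; apply: complex_eq; rewrite ?cReB ?cImB /= /Rintegral.
  rewrite (continuous_FTC2 (F := fun x => complex.Re (f x)))//.
  - by apply: continuous_subspaceT; exact: contC_Re.
  - split.
    + by move=> x _; have [[]] := fg x.
    + by apply: cvg_at_right_filter; exact: contC_Re.
    + by apply: cvg_at_left_filter; exact: contC_Re.
  - by move=> x _; rewrite derive1E; have [[_ ->]] := fg x.
rewrite (continuous_FTC2 (F := fun x => complex.Im (f x)))//.
- by apply: continuous_subspaceT; exact: contC_Im.
- split.
  + by move=> x _; have [_ []] := fg x.
  + by apply: cvg_at_right_filter; exact: contC_Im.
  + by apply: cvg_at_left_filter; exact: contC_Im.
- by move=> x _; rewrite derive1E; have [_ [_ ->]] := fg x.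
Qed.

(** ** The characters of the circle *)

Lemma expiD x y : expi (x + y) = expi x * expi y.
Proof.
by apply: complex_eq; rewrite ?cReM ?cImM /= ?cosD ?sinD 1?addrC// addrC.
Qed.

Lemma expi0 : expi 0 = 1 :> R[i].
Proof. by rewrite /expi cos0 sin0. Qed.

Lemma cmod_expi x : cmod (expi x) = 1.
Proof. by rewrite /cmod normc_def /= cos2Dsin2 sqrtr1. Qed.

Definition char k x : R[i] := expi (2 * pi * k%:~R * x).

Lemma charD k x y : char k (x + y) = char k x * char k y.
Proof. by rewrite /char mulrDr expiD. Qed.

Lemma charM k j x : char (k + j) x = char k x * char j x.
Proof. by rewrite /char -expiD -mulrDl -mulrDr -intrD. Qed.

Lemma char0 x : char 0 x = 1.
Proof. by rewrite /char mulr0 mul0r expi0. Qed.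

Lemma char_0 k : char k 0 = 1.
Proof. by rewrite /char mulr0 expi0. Qed.

Lemma char_1 k : char k 1 = 1.
Proof.
have h1 (n : nat) : char n%:Z 1 = 1.
  elim: n => [|n IH]; first exact: char0.
  rewrite -addn1 PoszD charM IH mul1r /char !mulr1 /expi mulr_natl.
  by rewrite cos2pi sin2pi.
case: (intP k) => [|n|n]; [exact: char0|exact: h1|].
have := charM n.+1%:Z (- n.+1%:Z) 1; rewrite subrr char0 h1 mul1r.
by move=> <-.
Qed.

Lemma cmod_char k x : cmod (char k x) = 1.
Proof. exact: cmod_expi. Qed.

Lemma char_periodic k : periodic1 (char k).
Proof. by move=> x; rewrite charD char_1 mulr1. Qed.

Lemma fourierE f k : fourier f k = mean (fun x => char (- k) x * f x).
Proof.
by congr mean; apply/funext => x; rewrite mulrC /char mulrNz mulrN mulNr.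
Qed.

(** The Fourier symbol of [d/dx]. *)
Definition dsym k : R[i] := ((2 * pi * k%:~R)%:C * 'i)%C.

Lemma cmod_dsym k : cmod (dsym k) = 2 * pi * `|k|%:R.
Proof.
rewrite /dsym cmodM cmod_i mulr1 cmod_real !normrM ger0_norm// ger0_norm ?pi_ge0//.
by rewrite -intr_norm -natr_absz.
Qed.

Lemma cderiv_char k : cderiv (char k) (fun x => dsym k * char k x).
Proof.
move=> x; rewrite /char /expi /dsym /= !(mul0r, mulr0, mulr1, add0r, subr0, sub0r).
pose a := 2 * pi * k%:~R : R.
have h : is_derive x (1 : R) (fun y : R => a * y) a.
  apply: (is_derive_congr (is_deriveZ a (is_derive_id x (1 : R)))) => //.
  by rewrite /GRing.scale /= mulr1.
split.
  apply: (is_derive_congr (is_derive1_comp (is_derive_cos (a * x)) h)) => //.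
  by rewrite /a; ring.
apply: (is_derive_congr (is_derive1_comp (is_derive_sin (a * x)) h)) => //.
by rewrite /a; ring.
Qed.

Lemma contC_char k : contC (char k).
Proof. exact: cderiv_contC (cderiv_char k). Qed.

Lemma dsym_eq0 k : dsym k = 0 -> k = 0.
Proof.
move=> h; have := cmod_dsym k; rewrite h cmod0 => /esym/eqP.
rewrite !mulf_eq0 pnatr_eq0 /= gt_eqF ?pi_gt0//= pnatr_eq0 absz_eq0.
by move/eqP.
Qed.

Lemma mean_char k : mean (char k) = (k == 0)%:R.
Proof.
have [->|k0] := eqVneq k 0.
  rewrite (_ : char 0 = fun=> 1); last by apply/funext => x; rewrite char0.
  have h : cderiv (fun x : R => (x%:C)%C) (fun=> 1).
    by move=> x; split => /=; [exact: is_derive_id|exact: is_derive_cst].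
  by rewrite (mean_deriv h)// ?subr0//; exact: contC_cst.
have h := mean_deriv (cderiv_char k) (contCZ _ (contC_char k)).
apply: (mulfI (x := dsym k)); first by apply/eqP => /dsym_eq0/eqP; rewrite (negPf k0).
rewrite mulr0 -meanZ ?h ?char_1 ?char_0 ?subrr//.
exact/contC_intC/contC_char.
Qed.

Lemma fourierD f g k : intC f -> intC g ->
  fourier (fun x => f x + g x) k = fourier f k + fourier g k.
Proof.
move=> hf hg; rewrite !fourierE -meanD; try exact: intCM (contC_char _) _.
by congr mean; apply/funext => x; rewrite mulrDr.
Qed.

Lemma fourierZ (a : R[i]) f k : intC f ->
  fourier (fun x => a * f x) k = a * fourier f k.
Proof.
move=> hf; rewrite !fourierE -meanZ; last exact: intCM (contC_char _) _.
by congr mean; apply/funext => x; rewrite mulrCA.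
Qed.

Lemma fourierB f g k : intC f -> intC g ->
  fourier (fun x => f x - g x) k = fourier f k - fourier g k.
Proof.
move=> hf hg; rewrite !fourierE -meanB; try exact: intCM (contC_char _) _.
by congr mean; apply/funext => x; rewrite mulrBr.
Qed.

Lemma fourier_sum (I : Type) (r : seq I) (F : I -> R -> R[i]) k :
  (forall i, intC (F i)) ->
  fourier (fun x => \sum_(i <- r) F i x) k = \sum_(i <- r) fourier (F i) k.
Proof.
move=> iF; under [RHS]eq_bigr do rewrite fourierE.
rewrite fourierE -mean_sum => [|i]; last exact: intCM (contC_char _) _.
by congr mean; apply/funext => x; rewrite mulr_sumr.
Qed.

Lemma cmod_fourier f k M : intC f ->
  (forall x, 0 <= x <= 1 -> cmod (f x) <= M) -> cmod (fourier f k) <= 2 * M.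
Proof.
move=> hf fM; rewrite fourierE; apply: cmod_mean.
  exact: intCM (contC_char _) _.
by move=> x x01; rewrite cmodM cmod_char mul1r fM.
Qed.

Lemma fourier_char j k : fourier (char j) k = (j == k)%:R.
Proof.
rewrite fourierE (_ : (fun _ => _) = char (j - k)).
  by rewrite mean_char subr_eq0.
by apply/funext => x; rewrite -charM addrC.
Qed.

Lemma fourier_char_mul f j k : fourier (fun x => char j x * f x) k =
  fourier f (k - j).
Proof.
rewrite !fourierE; congr mean; apply/funext => x.
by rewrite mulrA -charM opprB addrC.
Qed.

Lemma mean_fourier0 f : mean f = fourier f 0.
Proof.
by rewrite fourierE; congr mean; apply/funext => x; rewrite oppr0 char0 mul1r.
Qed.

(** Integration by parts over a period. *)
Lemma fourier_deriv f g k : cderiv f g -> contC g -> f 1 = f 0 ->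
  fourier g k = dsym k * fourier f k.
Proof.
move=> fg cg f10.
have cf := cderiv_contC fg.
have c1 := contCM (contC_char (- k)) cf.
have c2 := contCM (contC_char (- k)) cg.
have c3 := contCM (contCZ (dsym (- k)) (contC_char (- k))) cf.
have := mean_deriv (cderivM (cderiv_char (- k)) fg) (contCD c3 c2).
rewrite (meanD (contC_intC c3) (contC_intC c2)) char_1 char_0 f10 subrr -fourierE.
move=> /eqP; rewrite addrC addr_eq0 => /eqP ->.
rewrite fourierE -(meanZ (dsym k) (contC_intC c1)) -[LHS]mulN1r.
rewrite -(meanZ (-1) (contC_intC c3)).
congr mean; apply/funext => x.
have -> : dsym (- k) = - dsym k.
  by rewrite /dsym mulrNz mulrN; apply: complex_eq; rewrite /=; ring.
by ring.
Qed.

End Circle.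

(** * Trigonometric series *)

Section Synthesis.
Variable R : realType.
Implicit Types (c : int -> R[i]) (f g : R -> R[i]) (k j : int) (x y A B d : R).

Lemma hassum_le (z : nat -> R[i]) (y : nat -> R) M l : hassum z l ->
  (forall n, cmod (z n) <= y n) -> sbd y M -> cmod l <= M.
Proof. by move=> /hassum_csum <- zy yM; have [_] := sbd_hassum zy yM. Qed.

(** Both [p + u] and [p - u] are nondecreasing. *)
Lemma mean_value_ineq (u du p dp : R -> R) (a b : R) : a <= b ->
  (forall x, a <= x <= b -> is_derive x (1 : R) u (du x)) ->
  (forall x, a <= x <= b -> is_derive x (1 : R) p (dp x)) ->
  (forall x, a <= x <= b -> `|du x| <= dp x) ->
  `|u b - u a| <= p b - p a.
Proof.
move=> ab hu hp h.
have key (v dv : R -> R) : (forall x, a <= x <= b -> is_derive x (1 : R) v (dv x)) ->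
    (forall x, a <= x <= b -> 0 <= dv x) -> v a <= v b.
  move=> hv v0; have cv : {within `[a, b], continuous v}.
    apply: derivable_within_continuous => x; rewrite in_itv /= => /hv h1.
    exact: ex_derive.
  have hv' : forall x, x \in `]a, b[%R -> is_derive x (1 : R) v (dv x).
    move=> x; rewrite in_itv /= => /andP[/ltW h1 /ltW h2].
    by apply: hv; rewrite h1.
  have [x] := MVT_segment ab hv' cv.
  rewrite in_itv /= => /v0 h1 h2.
  by rewrite -subr_ge0 h2 mulr_ge0// subr_ge0.
rewrite ler_norml; apply/andP; split.
  have := key (fun x => p x + u x) (fun x => dp x + du x).
  have H1 : forall x, a <= x <= b ->
      is_derive x (1 : R) (fun x => p x + u x) (dp x + du x).
    by move=> x xab; exact: (is_deriveD (hp x xab) (hu x xab)).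
  have H2 : forall x, a <= x <= b -> 0 <= dp x + du x.
    by move=> x /h; rewrite ler_norml => /andP[]; lra.
  by move=> /(_ H1 H2); lra.
have := key (fun x => p x - u x) (fun x => dp x - du x).
have H1 : forall x, a <= x <= b ->
    is_derive x (1 : R) (fun x => p x - u x) (dp x - du x).
  by move=> x xab; exact: (is_deriveB (hp x xab) (hu x xab)).
have H2 : forall x, a <= x <= b -> 0 <= dp x - du x.
  by move=> x /h; rewrite ler_norml => /andP[]; lra.
by move=> /(_ H1 H2); lra.
Qed.

Lemma is_derive_sqr2 x : is_derive x (1 : R) (fun y => y ^+ 2 / 2) x.
Proof.
have dI := is_derive_id x (1 : R).
apply: (is_derive_congr (is_deriveZ (2^-1) (is_deriveM dI dI))).
  by move=> y; rewrite [RHS]mulrC expr2.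
by rewrite /GRing.scale /=; field.
Qed.

(** Each bound is the mean value inequality with the preceding one as majorant. *)
Lemma sin_cos_bounds y : 0 <= y ->
  [/\ `|sin y| <= y, `|cos y - 1| <= y ^+ 2 / 2 & `|sin y - y| <= y ^+ 2 / 2].
Proof.
have dI x : is_derive x (1 : R) (fun y : R => y) 1 by exact: is_derive_id.
have s1 (z : R) : 0 <= z -> `|sin z| <= z.
  move=> z0; have := @mean_value_ineq sin cos (fun y => y) (fun=> 1) 0 z z0.
  rewrite sin0 !subr0; apply => x _; exact: cos_max.
have c1 (z : R) : 0 <= z -> `|cos z - 1| <= z.
  move=> z0; have := @mean_value_ineq cos (fun x => - sin x) (fun y => y)
    (fun=> 1) 0 z z0.
  rewrite cos0 !subr0; apply => x _.
  by rewrite normrN; exact: sin_max.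
move=> y0; split; first exact: s1.
  have := @mean_value_ineq cos (fun x => - sin x) (fun y => y ^+ 2 / 2)
    (fun x => x) 0 y y0.
  rewrite cos0 expr0n /= mul0r subr0; apply => x /andP[x0 _].
    exact: is_derive_sqr2.
  by rewrite normrN; exact: s1.
have := @mean_value_ineq (fun x => sin x - x) (fun x => cos x - 1)
  (fun y => y ^+ 2 / 2) (fun x => x) 0 y y0.
rewrite sin0 subrr expr0n /= mul0r !subr0; apply => x /andP[x0 _].
- exact: is_derive_sqr2.
- exact: c1.
Qed.

Lemma expi_taylor y : cmod (expi y - 1 - (y%:C * 'i)%C) <= y ^+ 2.
Proof.
have h (z : R) : 0 <= z -> cmod (expi z - 1 - (z%:C * 'i)%C) <= z ^+ 2.
  move=> /sin_cos_bounds[_ h1 h2].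
  apply: (le_trans (cmod_le_ReIm _)); rewrite /expi /=.
  rewrite !(mul0r, mulr0, mulr1, add0r, subr0, addr0, oppr0).
  by move: h1 h2; lra.
have [|/ltW y0] := leP 0 y; first exact: h.
have := h (- y); rewrite oppr_ge0 sqrrN => /(_ y0); apply: le_trans.
rewrite /cmod !normc_def /= cosN sinN.
rewrite le_eqVlt; apply/orP; left; apply/eqP; congr Num.sqrt.
by ring.
Qed.

Lemma char_taylor k x h :
  cmod (char k (x + h) - char k x - h%:C%C * (dsym R k * char k x)) <=
  h ^+ 2 * cmod (dsym R k) ^+ 2.
Proof.
have -> : char k (x + h) - char k x - h%:C%C * (dsym R k * char k x) =
  char k x * (expi (2 * pi * k%:~R * h) - 1 - ((2 * pi * k%:~R * h)%:C * 'i)%C).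
  rewrite charD /dsym /char [in RHS]rmorphM /=; ring.
rewrite cmodM cmod_char mul1r; apply: (le_trans (expi_taylor _)).
rewrite /dsym cmodM cmod_i mulr1 cmod_real real_normK ?num_real//.
by rewrite exprMn mulrC.
Qed.

(** Fourier synthesis, the inverse of [fourier] on the functions used here. *)
Definition synth c x : R[i] := csum (pairing (fun k => c k * char k x)).

(** This bound makes the trigonometric series of [c] absolutely convergent. *)
Definition qbd c A : Prop := forall k, cmod (c k) <= A * qw R k.

Lemma qbd_ge0 c A : qbd c A -> 0 <= A.
Proof.
move=> /(_ 0) h; rewrite -(pmulr_lge0 _ (qw_gt0 R 0)).
by apply: le_trans h; exact: cmod_ge0.
Qed.

Lemma pairing_le c (y : int -> R) x n : (forall k, cmod (c k) <= y k) ->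
  cmod (pairing (fun k => c k * char k x) n) <= pairing y n.
Proof. by move=> h; apply: cmod_pairing => k; rewrite cmodM cmod_char mulr1. Qed.

Lemma synth_hassum c A x : qbd c A ->
  hassum (pairing (fun k => c k * char k x)) (synth c x) /\
  cmod (synth c x) <= 12 * A.
Proof.
move=> h; have A0 := qbd_ge0 h.
by apply: sbd_hassum (sbd_qw A0) => n; exact: pairing_le.
Qed.

Lemma qw_pairing_ge0 A n : 0 <= A -> 0 <= pairing (fun k => A * qw R k) n.
Proof.
by move=> A0; case: n => [|n] /=; rewrite ?addr_ge0// mulr_ge0// qw_ge0.
Qed.

(** The symmetric partial sums converge uniformly. *)
Lemma synth_tail c A : qbd c A -> forall e, 0 < e -> exists N, forall n x,
  (N <= n)%N ->
  cmod (synth c x - \sum_(0 <= m < n) pairing (fun k => c k * char k x) m) <= e.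
Proof.
move=> h e e0; have A0 := qbd_ge0 h.
have [N hN] := sbd_tail (fun n => qw_pairing_ge0 n A0) (sbd_qw A0) e0.
exists N => n x Nn; apply: (sbd_csum_tail _ (sbd_qw A0)).
  by move=> m; exact: pairing_le.
by move=> m; apply/ltW/hN.
Qed.

Lemma contC_pairing c n : contC (fun x => pairing (fun k => c k * char k x) n).
Proof.
case: n => [|n]; first exact: (contCZ (c 0) (contC_char R 0)).
exact: (contCD (contCZ (c n.+1) (contC_char R n.+1))
               (contCZ (c (- n.+1%:Z)) (contC_char R (- n.+1%:Z)))).
Qed.

Lemma contC_partial c n :
  contC (fun x => \sum_(0 <= m < n) pairing (fun k => c k * char k x) m).
Proof.
exact: (contC_sum (index_iota 0 n) (contC_pairing c)).
Qed.

Lemma contC_synth c A : qbd c A -> contC (synth c).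
Proof.
move=> h; split=> x; apply/cvg_cmodP => e e0.
have e4 : 0 < e / 4 by rewrite divr_gt0.
have [N hN] := synth_tail h e4.
pose p y := \sum_(0 <= m < N) pairing (fun k => c k * char k y) m.
have /cvg_cmodP/(_ _ e4) := @contC_cvg _ _ (contC_partial c N) x.
apply: filterS => y hy.
have -> : synth c y - synth c x =
    (synth c y - p y) + (p y - p x) - (synth c x - p x) by ring.
have h1 := hN N y (leqnn N); have h2 := hN N x (leqnn N).
apply: (le_lt_trans (cmodB _ _)).
apply: (le_lt_trans (lerD (cmodD _ _) (lexx _))).
rewrite -/(p y) -/(p x) in h1 h2 hy; lra.
Qed.

Lemma synth_periodic c : periodic1 (synth c).
Proof.
move=> x; congr csum; apply/funext => -[|n] /=; by rewrite !char_periodic.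
Qed.

Lemma synthD c (b : int -> R[i]) A B x : qbd c A -> qbd b B ->
  synth (fun k => c k + b k) x = synth c x + synth b x.
Proof.
move=> /(synth_hassum x)[h1 _] /(synth_hassum x)[h2 _].
apply: hassum_csum; have := hassumD h1 h2.
by congr hassum; apply/funext => -[|n] /=; ring.
Qed.

Lemma synthZ (a : R[i]) c A x : qbd c A ->
  synth (fun k => a * c k) x = a * synth c x.
Proof.
move=> /(synth_hassum x)[h1 _].
apply: hassum_csum; have := hassumZ a h1.
by congr hassum; apply/funext => -[|n] /=; ring.
Qed.

Lemma qbdD c (b : int -> R[i]) A B : qbd c A -> qbd b B -> qbd (fun k => c k + b k) (A + B).
Proof.
by move=> h1 h2 k; apply: (le_trans (cmodD _ _)); rewrite mulrDl lerD.
Qed.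

Lemma qbdZ (a : R[i]) c A : qbd c A -> qbd (fun k => a * c k) (cmod a * A).
Proof. by move=> h k; rewrite cmodM -mulrA ler_wpM2l ?cmod_ge0. Qed.

Lemma qbdB c (b : int -> R[i]) A B : qbd c A -> qbd b B -> qbd (fun k => c k - b k) (A + B).
Proof.
by move=> h1 h2 k; apply: (le_trans (cmodB _ _)); rewrite mulrDl lerD.
Qed.

Lemma synthB c (b : int -> R[i]) A B x : qbd c A -> qbd b B ->
  synth (fun k => c k - b k) x = synth c x - synth b x.
Proof.
move=> h1 h2; have := synthD x h1 (qbdZ (-1) h2).
rewrite (synthZ _ x h2) mulN1r => <-; congr (synth _ x).
by apply/funext => k; rewrite mulN1r.
Qed.

Lemma is_derive_littleo (u : R -> R) x du :
  (forall e : R, 0 < e -> exists2 eta : R, 0 < eta & forall h : R, `|h| < eta ->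
     `|u (x + h) - u x - h * du| <= e * `|h|) ->
  is_derive x (1 : R) u du.
Proof.
move=> H.
have cv : h^-1 *: (u (h *: (1 : R) + x) - u x) @[h --> 0^'] --> du.
  apply/cvgrPdist_le => e e0; have [eta eta0 he] := H e e0.
  near=> h.
  have h0 : h != 0 by near: h; exact: nbhs_dnbhs_neq.
  have hh : `|h| < eta by near: h; apply: dnbhs0_lt.
  rewrite /GRing.scale /= mulr1.
  have -> : du - h^-1 * (u (h + x) - u x) = - (h^-1 * (u (x + h) - u x - h * du)).
    by rewrite (addrC h x); field.
  by rewrite normrN normrM normfV ler_pdivrMl ?normr_gt0// [leRHS]mulrC; apply: he.
split; last exact: cvg_lim cv.
by apply/cvg_ex; exists du.
Unshelve. all: by end_near. Qed.

Lemma is_derive_quad (u : R -> R) x du C :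
  (forall h, `|u (x + h) - u x - h * du| <= h ^+ 2 * C) ->
  is_derive x (1 : R) u du.
Proof.
move=> H; have C0 : 0 <= C.
  by have := H 1; rewrite expr1n !mul1r; apply: le_trans; exact: normr_ge0.
apply: is_derive_littleo => e e0; exists (e / (C + 1)).
  by rewrite divr_gt0// ltr_wpDl.
move=> h hh; apply: (le_trans (H h)).
rewrite -real_normK ?num_real// expr2 -mulrA mulrC ler_wpM2r//.
apply: (@le_trans _ _ (e / (C + 1) * C)); first by rewrite ler_wpM2r// ltW.
by rewrite mulrAC ler_pdivrMr ?ltr_wpDl// ler_pM2l// lerDl.
Qed.

(** The second order Taylor remainders of the characters are dominated by
    [h ^ 2] times the twice differentiated series, so that no interchange of
    limits is needed for the termwise derivative. *)
Lemma cderiv_synth c A B : qbd c A -> qbd (fun k => dsym R k ^+ 2 * c k) B ->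
  cderiv (synth c) (synth (fun k => dsym R k * c k)).
Proof.
move=> hA hB.
have hAB : qbd (fun k => dsym R k * c k) (A + B).
  move=> k; rewrite mulrDl; have := hA k; have := hB k.
  rewrite cmodM cmodX (cmodM (dsym R k) (c k)).
  set s := cmod (dsym R k); set b := cmod (c k) => h1 h2.
  apply: le_trans (lerD h2 h1); rewrite -{2}(mul1r b) -mulrDl.
  rewrite ler_wpM2r ?cmod_ge0//; have : 0 <= (s - 1) ^+ 2 by exact: sqr_ge0.
  have : 0 <= s by exact: cmod_ge0.
  by rewrite sqrrB expr1n mulr1 mulr2n; lra.
have key x h : cmod (synth c (x + h) - synth c x -
    h%:C%C * synth (fun k => dsym R k * c k) x) <= h ^+ 2 * (12 * B).
  have [h1 _] := synth_hassum (x + h) hA; have [h2 _] := synth_hassum x hA.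
  have [h3 _] := synth_hassum x hAB.
  have h4 := hassumB (hassumB h1 h2) (hassumZ (h%:C%C) h3).
  have hb : 0 <= h ^+ 2 * B by rewrite mulr_ge0 ?sqr_ge0// (qbd_ge0 hB).
  rewrite mulrCA; apply: (hassum_le h4 _ (sbd_qw hb)) => n.
  rewrite (_ : _ - _ = pairing (fun k => c k * (char k (x + h) - char k x -
    h%:C%C * (dsym R k * char k x))) n); last by case: n => [|n] /=; ring.
  apply: cmod_pairing => k; rewrite cmodM mulrC.
  apply: (le_trans (ler_wpM2r (cmod_ge0 _) (char_taylor k x h))).
  rewrite -[leLHS]mulrA -[leRHS]mulrA ler_wpM2l ?sqr_ge0//.
  by rewrite -cmodX -cmodM; exact: hB.
by move=> x; split; apply: (@is_derive_quad _ _ _ (12 * B)) => h;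
  apply: le_trans (key x h); [have := normRe_le (synth c (x + h) - synth c x -
    h%:C%C * synth (fun k => dsym R k * c k) x)|have := normIm_le (synth c (x + h)
    - synth c x - h%:C%C * synth (fun k => dsym R k * c k) x)];
  rewrite ?cReB ?cReM ?cImB ?cImM /= mul0r ?subr0 ?addr0.
Qed.

Lemma sum_pairing_delta c j n : (`|j| < n)%N ->
  \sum_(0 <= m < n) pairing (fun k => c k * (k == j)%:R) m = c j.
Proof.
move=> jn.
rewrite (@big_cat_nat _ _ _ `|j|.+1)//= [X in _ + X](_ : _ = 0) ?addr0; last first.
  rewrite big_nat_cond big1// => m /andP[/andP[mj _] _]; case: m mj => [//|m] mj /=.
  rewrite (_ : (m.+1%:Z == j) = false); last by apply/eqP; lia.
  by rewrite (_ : (- m.+1%:Z == j) = false) ?mulr0 ?addr0//; apply/eqP; lia.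
rewrite big_nat_recr//= [X in X + _](_ : _ = 0) ?add0r; last first.
  rewrite big_nat_cond big1// => m /andP[/andP[_ mj] _]; case: m mj => [|m] mj /=.
    by rewrite (_ : _ == _ = false) ?mulr0//; apply/eqP; lia.
  rewrite (_ : (m.+1%:Z == j) = false); last by apply/eqP; lia.
  by rewrite (_ : (- m.+1%:Z == j) = false) ?mulr0 ?addr0//; apply/eqP; lia.
case: j jn => [[|n1]|n1] _ /=; first by rewrite mulr1.
  by rewrite eqxx mulr1 mulr0 addr0.
by rewrite mulr0 add0r (_ : - n1.+1%:Z = Negz n1) ?eqxx ?mulr1// NegzE.
Qed.

(** The partial sums of [synth c] converge uniformly, and multiplication of [g]
    by a character translates its coefficients. *)
Lemma fourier_synth_mul c A g M k : qbd c A -> contC g ->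
  (forall x, cmod (g x) <= M) ->
  ((\sum_(0 <= m < n) pairing (fun j => c j * fourier g (k - j)) m : R[i]^o)
     @[n --> \oo] --> (fourier (fun x => synth c x * g x) k : R[i]^o)).
Proof.
move=> hA cg gM; have M0 : 0 <= M by apply: le_trans (gM 0); exact: cmod_ge0.
apply/cvg_cmodP => e e0.
have e1 : 0 < e / (2 * (M + 1)) / 2.
  by rewrite divr_gt0// divr_gt0// mulr_gt0// ltr_wpDl.
have [N hN] := synth_tail hA e1.
exists N => // n /= Nn.
have cp := contC_partial c n.
have -> : \sum_(0 <= m < n) pairing (fun j => c j * fourier g (k - j)) m =
   fourier (fun x => (\sum_(0 <= m < n) pairing (fun j => c j * char j x) m) * g x) k.
  have hm m x : pairing (fun j => c j * char j x) m * g x =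
      pairing (fun j => c j * (char j x * g x)) m.
    by case: m => [|m] /=; ring.
  have ci j : intC (fun x => char j x * g x).
    exact: (contC_intC (contCM (contC_char R j) cg)).
  have ciZ j : intC (fun x => c j * (char j x * g x)).
    exact: (intCZ (c j) (ci j)).
  have cim m : intC (fun x => pairing (fun j => c j * (char j x * g x)) m).
    case: m => [|m] /=; first exact: ciZ.
    exact: (intCD (ciZ m.+1) (ciZ (- m.+1%:Z))).
  rewrite (_ : (fun x => _ * g x) = (fun x => \sum_(0 <= m < n)
      pairing (fun j => c j * (char j x * g x)) m)); last first.
    by apply/funext => x; rewrite mulr_suml; apply: eq_bigr => m _.
  rewrite (fourier_sum (index_iota 0 n) k cim); apply: eq_bigr => -[|m] _ /=.
    by rewrite (fourierZ (c 0) k (ci 0)) fourier_char_mul.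
  rewrite (fourierD k (ciZ m.+1) (ciZ (- m.+1%:Z))).
  by rewrite !(fourierZ _ k (ci _)) !fourier_char_mul.
have i1 := contC_intC (contCM cp cg).
have i2 := contC_intC (contCM (contC_synth hA) cg).
rewrite cmodBC -(fourierB k i2 i1).
apply: (@le_lt_trans _ _ (2 * (e / (2 * (M + 1)) / 2 * M))).
  apply: cmod_fourier; first exact: intCB i2 i1.
  move=> x _; rewrite -mulrBl cmodM ler_pM ?cmod_ge0//.
  exact: hN.
have -> : 2 * (e / (2 * (M + 1)) / 2 * M) = e * (M / (2 * (M + 1))).
  by field; rewrite gt_eqF// ltr_wpDl.
rewrite -[X in _ < X]mulr1 ltr_pM2l// ltr_pdivrMr ?mulr_gt0 ?ltr_wpDl//; lra.
Qed.

Lemma fourier_synth c A k : qbd c A -> fourier (synth c) k = c k.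
Proof.
move=> hA.
have h1 (x : R) : cmod (1 : R[i]) <= 1 by rewrite cmod1.
have := fourier_synth_mul (k := k) hA (contC_cst 1) h1.
rewrite (_ : (fun x => synth c x * 1) = synth c); last first.
  by apply/funext => x; rewrite mulr1.
move=> h; apply: (cvgC_unique h).
apply: cvg_near_cst; exists `|k|.+1 => // n /= kn.
rewrite -[RHS](sum_pairing_delta c kn).
have hj j : fourier (fun=> 1 : R[i]) (k - j) = (j == k)%:R.
  rewrite (_ : (fun=> 1) = char 0); last by apply/funext => x; rewrite char0.
  by rewrite fourier_char (eq_sym 0) subr_eq0 (eq_sym k).
by apply: eq_bigr => -[|m] _ /=; rewrite !hj.
Qed.

(** Used for the power series in time, and for the expansion in powers of the
    exponentials in the strip. *)
Lemma csum_pairing (b : nat -> int -> R[i]) A t : 0 <= t -> t < 1 -> 0 <= A ->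
  (forall n k, cmod (b n k) <= t ^+ n * (A * qw R k)) ->
  hassum (fun n => csum (pairing (b n)))
         (csum (pairing (fun k => csum (fun n => b n k)))).
Proof.
move=> t0 t1 A0 hb.
have Zb m n : cmod (pairing (b n) m) <= pairing (fun k => A * qw R k) m * (1 * t ^+ n).
  apply: (le_trans (cmod_pairing m (hb n))).
  by rewrite mul1r; case: m => [|m] /=; rewrite -?mulrDr mulrC.
have := csum_interchange (fun m => qw_pairing_ge0 m A0)
  (fun n => mulr_ge0 ler01 (exprn_ge0 n t0)) (sbd_qw A0)
  (sbd_geometric t0 t1 ler01) Zb.
have hk k : hassum (fun n => b n k) (csum (fun n => b n k)).
  have sb : sbd (fun n => A * qw R k * t ^+ n) (A * qw R k / (1 - t)).
    by apply: sbd_geometric => //; rewrite mulr_ge0// qw_ge0.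
  have hb' n : cmod (b n k) <= A * qw R k * t ^+ n by rewrite mulrC; exact: hb.
  by have [] := sbd_hassum hb' sb.
congr hassum; congr csum; apply/funext => -[|m] //=.
exact: hassum_csum (hassumD (hk _) (hk _)).
Qed.

(** Up to an arbitrarily small loss in [d], the norm of the spaces [G]; see
    [GC_decay] and [GC_synth].  Unlike the latter, it is given by pointwise
    inequalities. *)
Definition decay c d A : Prop := forall k, cmod (c k) <= A * gw d k.

Lemma decay_ge0 c d A : decay c d A -> 0 <= A.
Proof.
move=> h; rewrite -(pmulr_lge0 _ (gw_gt0 d 0)).
by apply: le_trans (h 0); exact: cmod_ge0.
Qed.

Lemma decay_qbd c d A : 0 <= d -> decay c d A -> qbd c A.
Proof.
move=> d0 h k; apply: le_trans (h k) _.
by rewrite ler_wpM2l ?(decay_ge0 h)// gw_le_qw.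
Qed.

(** The algebra property of the spaces, with an explicit constant that does not
    depend on the width: the exponential weights are submultiplicative. *)
Lemma decay_conv b c d A B : 0 <= d -> decay b d A -> decay c d B ->
  decay (fourier (fun x => synth b x * synth c x)) d (72 * (A * B)).
Proof.
move=> d0 hb hc k.
have qb := decay_qbd d0 hb; have qc := decay_qbd d0 hc.
have A0 := qbd_ge0 qb; have B0 := qbd_ge0 qc.
have h := fourier_synth_mul (k := k) qb (contC_synth qc)
  (fun x => (synth_hassum x qc).2).
apply: (cvg_cmod_le h) => n.
have e0 : 0 <= A * B * expR (- (2 * pi * d * `|k|%:R)).
  by rewrite !mulr_ge0// expR_ge0.
rewrite (_ : 72 * (A * B) * gw d k =
  72 * (A * B * expR (- (2 * pi * d * `|k|%:R))) * qw R k); last first.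
  by rewrite /gw; ring.
apply: le_trans (sbd_conv k e0 n).
apply: (le_trans (cmod_sum _ _ _)); apply: ler_sum => m _.
apply: cmod_pairing => j; rewrite cmodM (fourier_synth _ qc).
apply: (le_trans (ler_pM _ _ (hb j) (hc (k - j)))); rewrite ?cmod_ge0//.
by rewrite mulrACA -[leRHS]mulrA ler_wpM2l ?mulr_ge0// gw_conv.
Qed.

End Synthesis.

(** * Uniqueness of Fourier coefficients *)

Section Uniqueness.
Variable R : realType.
Implicit Types (f g h : R -> R[i]) (k j : int) (x y a b c p t : R).

(** Functions by which one may multiply an integrable function with vanishing
    Fourier coefficients; these contain the algebra of trigonometric
    polynomials. *)
Definition trig_like (P : R -> R[i]) : Prop := contC P /\
  forall h, intC h -> (forall k, fourier h k = 0) ->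
    forall k, fourier (fun x => P x * h x) k = 0.

Lemma trig_like_char j : trig_like (char j).
Proof.
split=> [|h ih h0 k]; first exact: contC_char.
by rewrite fourier_char_mul h0.
Qed.

Lemma trig_likeM P Q : trig_like P -> trig_like Q ->
  trig_like (fun x => P x * Q x).
Proof.
move=> [cP hP] [cQ hQ]; split=> [|h ih h0 k]; first exact: contCM cP cQ.
have := hP _ (intCM cQ ih) (hQ _ ih h0) k.
by congr (fourier _ _ = _); apply/funext => x; rewrite mulrA.
Qed.

Lemma trig_likeD P Q : trig_like P -> trig_like Q ->
  trig_like (fun x => P x + Q x).
Proof.
move=> [cP hP] [cQ hQ]; split=> [|h ih h0 k]; first exact: contCD cP cQ.
have := fourierD k (intCM cP ih) (intCM cQ ih).
rewrite hP// hQ// addr0 => <-.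
by congr fourier; apply/funext => x; rewrite mulrDl.
Qed.

Lemma trig_likeZ (a : R[i]) P : trig_like P -> trig_like (fun x => a * P x).
Proof.
move=> [cP hP]; split=> [|h ih h0 k]; first exact: (contCZ a cP).
have := fourierZ a k (intCM cP ih); rewrite hP// mulr0 => <-.
by congr fourier; apply/funext => x; rewrite mulrA.
Qed.

Lemma trig_like1 : trig_like (fun=> 1).
Proof.
have := trig_like_char 0; congr trig_like.
by apply/funext => x; rewrite char0.
Qed.

Lemma trig_likeX P n : trig_like P -> trig_like (fun x => P x ^+ n).
Proof.
move=> hP; elim: n => [|n IH]; first exact: trig_like1.
have := trig_likeM hP IH; congr trig_like.
by apply/funext => x; rewrite exprS.
Qed.

(** [sin^2 (pi (x - y))], which is small exactly when [x] is close to [y] on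
    the circle. *)
Definition chord y x : R := (1 - cos (2 * pi * (x - y))) / 2.

Lemma trig_like_chord y : trig_like (fun x => (chord y x)%:C%C).
Proof.
have h := trig_likeD (trig_likeZ (2^-1)%:C%C trig_like1)
  (trig_likeD (trig_likeZ (- ((4^-1)%:C%C * char (-1) y)) (trig_like_char 1))
              (trig_likeZ (- ((4^-1)%:C%C * char 1 y)) (trig_like_char (-1)))).
move: h; congr trig_like; apply/funext => x.
have e : char (-1) y * char 1 x + char 1 y * char (-1) x =
    ((2 * cos (2 * pi * (x - y)))%:C)%C :> R[i].
  rewrite /char /expi mulrNz mulrN !mulNr cosN sinN mulrBr cosB.
  rewrite mulr1z mulr1 cosN sinN.
  by apply: complex_eq; rewrite ?(cReD, cReM, cImD, cImM) /=; ring.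
rewrite mulr1 (_ : _ + _ = (2^-1)%:C%C - (4^-1)%:C%C *
  (char (-1) y * char 1 x + char 1 y * char (-1) x)); last by ring.
by rewrite e -rmorphM -rmorphB /chord; congr (_%:C)%C; field.
Qed.

Lemma chord_ge0 y x : 0 <= chord y x.
Proof. by rewrite /chord divr_ge0// subr_ge0 cos_le1. Qed.

Lemma chord_le1 y x : chord y x <= 1.
Proof. by rewrite /chord ler_pdivrMr//; have := cos_geN1 (2 * pi * (x - y)); lra. Qed.

Lemma bernoulli_ineq t n : 0 <= t <= 1 -> 1 - n%:R * t <= (1 - t) ^+ n.
Proof.
move=> /andP[t0 t1]; elim: n => [|n IH]; first by rewrite mul0r subr0 expr0.
rewrite exprS; have h : 0 <= 1 - t by rewrite subr_ge0.
apply: le_trans (ler_wpM2l h IH).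
have : 0 <= n%:R * t ^+ 2 by rewrite mulr_ge0 ?sqr_ge0.
by rewrite -natr1 expr2; lra.
Qed.

Lemma cvg_natM_geometric t : 0 <= t < 1 -> n%:R * t ^+ n @[n --> \oo] --> (0 : R).
Proof.
move=> /andP[t0 t1].
have [->|tn0] := eqVneq t 0.
  apply: cvg_near_cst; exists 1%N => // n /= n0.
  by rewrite expr0n gtn_eqF// mulr0.
have tp : 0 < t by rewrite lt_neqAle eq_sym tn0.
pose s := Num.sqrt t.
have sp : 0 < s by rewrite sqrtr_gt0.
have s1 : s < 1 by rewrite -(sqrtr1 R) ltr_sqrt.
pose u := s^-1 - 1.
have u0 : 0 < u by rewrite subr_gt0 invf_gt1.
have key n : n%:R * s ^+ n <= u^-1.
  have h : 1 + n%:R * u <= (1 + u) ^+ n.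
    elim: n => [|n IH]; first by rewrite mul0r addr0 expr0.
    rewrite exprS; apply: le_trans (ler_wpM2l _ IH); last by rewrite addr_ge0// ltW.
    have : 0 <= n%:R * u ^+ 2 by rewrite mulr_ge0 ?sqr_ge0.
    by rewrite -natr1 expr2; lra.
  have e : 1 + u = s^-1 by rewrite /u; ring.
  rewrite e exprVn in h.
  rewrite -[u^-1]mul1r ler_pdivlMr// mulrAC -ler_pdivlMr ?exprn_gt0// mul1r.
  by apply: le_trans h; rewrite lerDr.
have h1 : (fun n => n%:R * t ^+ n) = (fun n => (n%:R * s ^+ n) * s ^+ n).
  apply/funext => n; rewrite -mulrA -exprMn -expr2 sqr_sqrtr//.
rewrite h1; apply: (@squeeze_cvgr _ _ _ _ (fun=> 0) (fun n => u^-1 * s ^+ n)).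
- near=> n; rewrite !mulr_ge0 ?exprn_ge0 ?(ltW sp)//=.
  by rewrite ler_wpM2r// exprn_ge0// ltW.
- exact: cvg_cst.
- have := @cvg_geometric R u^-1 s; rewrite ger0_norm ?(ltW sp)//; exact.
Unshelve. all: by end_near. Qed.

Definition peak_exp c n : nat := (Num.truncn (n%:R / c ^+ n)).+1.

(** [1 - (1 - p^n)^(n / c^n)] is a smooth cutoff at level [c]: by Bernoulli's
    inequality below, and by comparison with [exp (- n)] above. *)
Lemma peak_cvg c p : 0 < c < 1 -> 0 <= p <= 1 ->
  (1 - p ^+ n) ^+ peak_exp c n @[n --> \oo] --> ((p < c)%R%:R : R).
Proof.
move=> /andP[c0 c1] /andP[p0 p1].
have pn n : 0 <= p ^+ n <= 1 by rewrite exprn_ge0//= exprn_ile1.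
have q0 n : 0 <= n%:R / c ^+ n by rewrite divr_ge0// exprn_ge0// ltW.
have v1 n : (1 - p ^+ n) ^+ peak_exp c n <= 1.
  by have /andP[h1 h2] := pn n; rewrite exprn_ile1 ?subr_ge0// gerBl.
have [pc|cp] := ltP p c => /=.
  have t01 : 0 <= p / c < 1.
    by rewrite divr_ge0 ?(ltW c0)//= ltr_pdivrMr// mul1r.
  apply: (@squeeze_cvgr _ _ _ _ (fun n => 1 - (n%:R * (p / c) ^+ n + p ^+ n)) (fun=> 1)).
  - near=> n; rewrite v1 andbT.
    apply: le_trans (bernoulli_ineq (peak_exp c n) (pn n)).
    rewrite lerD2l lerN2 /peak_exp -natr1 mulrDl mul1r lerD2r.
    rewrite expr_div_n mulrA -mulrAC ler_wpM2r//.
      by have /andP[] := pn n.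
    by rewrite truncn_le.
  - rewrite -[X in _ --> X]subr0; apply: cvgB; first exact: cvg_cst.
    rewrite -[X in _ --> X]addr0; apply: cvgD.
      exact: cvg_natM_geometric.
    apply: cvg_expr; rewrite ger0_norm//; exact: lt_trans pc c1.
  - exact: cvg_cst.
apply: (@squeeze_cvgr _ _ _ _ (fun=> 0) (fun n => n.+1%:R^-1)).
- near=> n; have /andP[h1 h2] := pn n.
  rewrite exprn_ge0 ?subr_ge0//=.
  have cn0 : 0 < c ^+ n by rewrite exprn_gt0.
  have e1 : 1 - p ^+ n <= expR (- p ^+ n) by exact: expR_ge1Dx.
  apply: (@le_trans _ _ (expR (- p ^+ n) ^+ peak_exp c n)).
    by apply: lerXn2r; rewrite ?nnegrE ?subr_ge0 ?expR_ge0.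
  rewrite -expRM_natl mulrN expRN lef_pV2 ?posrE ?expR_gt0//.
  apply: le_trans (expR_ge1Dx _); rewrite -natr1 addrC lerD2l.
  apply: (@le_trans _ _ (n%:R / c ^+ n * c ^+ n)).
    by rewrite divfK// gt_eqF.
  apply: ler_pM => //; first exact: ltW.
    by rewrite ltW// real_truncnS_gt// num_real.
  by apply: lerXn2r; rewrite ?nnegrE// ltW.
- exact: cvg_cst.
- exact: cvg_harmonic.
Unshelve. all: by end_near. Qed.

(** So the cutoffs at the levels of [chord] converge to the indicator functions
    of all intervals of the fundamental domain. *)
Lemma chord_lt a b x : 0 < a -> a < b -> b < 1 -> 0 <= x <= 1 ->
  (chord ((a + b) / 2) x < (1 - cos (pi * (b - a))) / 2) = (a < x < b).
Proof.
move=> a0 ab b1 /andP[x0 x1]; rewrite /chord ltr_pM2r ?invr_gt0//.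
rewrite ltrD2l ltrN2.
set y := x - (a + b) / 2.
have pi0 : 0 < pi :> R := pi_gt0 R.
have -> : cos (2 * pi * y) = cos (2 * pi * `|y|).
  by have [|] := ger0P y => _//; rewrite mulrN cosN.
have -> : (a < x < b) = (`|y| < (b - a) / 2).
  by rewrite ltr_norml /y; apply/andP/andP => -[]; split; lra.
have hr : pi * (b - a) \in `[0, pi].
  rewrite in_itv /= mulr_ge0 ?(ltW pi0) ?subr_ge0 ?(ltW ab)//=.
  by rewrite ler_piMr ?(ltW pi0)//; lra.
have [y2|y2] := leP `|y| (1 / 2).
  rewrite ltr_cos//; last first.
    rewrite in_itv /= !mulr_ge0 ?(ltW pi0)//=.
    by rewrite mulrAC ler_piMl ?(ltW pi0)//; lra.
  by rewrite mulrAC mulrC ltr_pM2l// mulrC ltr_pdivlMr.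
have y3 : `|y| < 1 - (b - a) / 2 by rewrite ltr_norml /y; apply/andP; split; lra.
have -> : cos (2 * pi * `|y|) = cos (2 * pi * (1 - `|y|)).
  rewrite -[RHS]cosN -(cosD2pi (- _)); congr cos; rewrite -mulr_natl; ring.
rewrite ltr_cos//; last first.
  rewrite in_itv /= !mulr_ge0 ?(ltW pi0) ?subr_ge0//=; last by lra.
  by rewrite mulrAC ler_piMl ?(ltW pi0)//; lra.
rewrite (_ : 2 * pi * (1 - `|y|) = pi * (2 * (1 - `|y|))); last by ring.
rewrite ltr_pM2l//.
by apply/idP/idP; lra.
Qed.

Lemma real_trig_integral0 f (P : R -> R) : intC f -> (forall k, fourier f k = 0) ->
  trig_like (fun x => (P x)%:C%C) ->
  \int[lebesgue_measure]_(x in `[0, 1]) (P x * complex.Re (f x)) = 0 /\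
  \int[lebesgue_measure]_(x in `[0, 1]) (P x * complex.Im (f x)) = 0.
Proof.
move=> hf f0 [cP hP]; have := hP _ hf f0 0.
rewrite -mean_fourier0 /mean => -[].
have -> : (fun x => complex.Re ((P x)%:C%C * f x)) = fun x => P x * complex.Re (f x).
  by apply/funext => x; rewrite cReM /= mul0r subr0.
have -> : (fun x => complex.Im ((P x)%:C%C * f x)) = fun x => P x * complex.Im (f x).
  by apply/funext => x; rewrite cImM /= mul0r addr0.
by [].
Qed.

Lemma trig_like_peak y n N :
  trig_like (fun x => ((1 - chord y x ^+ n) ^+ N)%:C%C).
Proof.
have := trig_likeX N (trig_likeD trig_like1
  (trig_likeZ (-1) (trig_likeX n (trig_like_chord y)))).
congr trig_like; apply/funext => x.
by rewrite mulN1r rmorphXn rmorphB rmorph1 rmorphXn.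
Qed.

(** Dominated convergence along the cutoffs of [chord]. *)
Lemma interval_integral0 (u : R -> R) a b : int01 u ->
  (forall y n N, \int[lebesgue_measure]_(x in `[0, 1])
     ((1 - chord y x ^+ n) ^+ N * u x) = 0) ->
  0 < a -> a < b -> b < 1 ->
  \int[lebesgue_measure]_(x in `]a, b[) u x = 0.
Proof.
move=> iu u0 a0 ab b1.
pose mu := @lebesgue_measure R.
pose y := (a + b) / 2; pose c := (1 - cos (pi * (b - a))) / 2.
have c01 : 0 < c < 1.
  have hr : pi * (b - a) \in `[0, pi].
    rewrite in_itv /= mulr_ge0 ?pi_ge0 ?subr_ge0 ?(ltW ab)//=.
    by rewrite ler_piMr ?pi_ge0//; lra.
  have h0 : (0 : R) \in `[0, pi] by rewrite in_itv /= lexx pi_ge0.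
  have hp : (pi : R) \in `[0, pi] by rewrite in_itv /= lexx pi_ge0.
  have h1 : cos (pi * (b - a)) < 1.
    by rewrite -cos0 ltr_cos// mulr_gt0 ?pi_gt0// subr_gt0.
  have h2 : -1 < cos (pi * (b - a)).
    by rewrite -cospi ltr_cos// -[X in _ < X]mulr1 ltr_pM2l ?pi_gt0//; lra.
  by rewrite /c; apply/andP; split; lra.
pose F n x : \bar R := ((1 - chord y x ^+ n) ^+ peak_exp c n * u x)%:E.
pose G x : \bar R := (\1_(`]a, b[ : set R) x * u x)%:E.
have cch : continuous (chord y).
  have [ct _] := trig_like_chord y; exact: (contC_Re ct).
have cpk n : continuous (fun x => (1 - chord y x ^+ n) ^+ peak_exp c n).
  have [ct _] := trig_like_peak y n (peak_exp c n); exact: (contC_Re ct).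
have iF n : mu.-integrable (`[0, 1] : set R) (F n).
  exact: (integrable_mul_cont (cpk n) iu).
have mu1 : measurable_fun (`[0, 1] : set R) u.
  by move/integrableP : iu => [/measurable_EFinP].
have mG : measurable_fun (`[0, 1] : set R) G.
  by apply/measurable_EFinP; apply: measurable_funM.
have FG : {ae mu, forall x, `[0, 1]%classic x -> F ^~ x @ \oo --> G x}.
  apply: aeW => x /=; rewrite in_itv /= => x01.
  apply: cvg_EFin; first by near=> n.
  apply: cvgMr_tmp; rewrite indicE mem_setE in_itv /=.
  rewrite -(chord_lt a0 ab b1 x01).
  apply: peak_cvg => //; by rewrite chord_ge0 chord_le1.
have Fu : {ae mu, forall x n, `[0, 1]%classic x -> (`|F n x| <= `|(u x)%:E|)%E}.
  apply: aeW => x n _; rewrite lee_fin normrM ler_piMl//.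
  have h0 := chord_ge0 y x; have h1 := chord_le1 y x.
  have h2 : 0 <= 1 - chord y x ^+ n by rewrite subr_ge0 exprn_ile1.
  have h3 : 1 - chord y x ^+ n <= 1 by rewrite gerBl exprn_ge0.
  by rewrite ger0_norm ?exprn_ge0// exprn_ile1.
have mF n : measurable_fun (`[0, 1] : set R) (F n) by have /integrableP[] := iF n.
have iu' : mu.-integrable (`[0, 1] : set R) (fun x => `|(u x)%:E|%E).
  exact: integrable_abse.
have [_ _] := @dominated_convergence _ _ _ mu _ (measurable_itv _) F G
  (fun x => `|(u x)%:E|%E) mF mG FG iu' Fu.
have -> : [sequence (\int[mu]_(x in `[0%R, 1%R]) F n x)%E]_n = (fun=> 0%E).
  apply/funext => n /=.
  have := u0 y n (peak_exp c n); rewrite /Rintegral => h.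
  rewrite -[LHS]fineK; first by congr (_%:E).
  by apply: integrable_fin_num => //; exact: iF.
move=> /(cvg_unique _ (cvg_cst _)) => /(_ (@ereal_hausdorff R)) h.
rewrite /Rintegral (_ : `]a, b[%classic = `[0, 1]%classic `&` `]a, b[%classic :> set R); last first.
  apply/seteqP; split => x /=; rewrite !in_itv /=; last by case.
  by move=> /andP[h1 h2]; split => //; apply/andP; split; lra.
rewrite integral_mkcondr (_ : (fun x => (u x)%:E) \_ _ = G) -?h//.
apply/funext => x; rewrite /G patchE indicE.
by case: ifP => _; rewrite ?mul1r ?mul0r.
Unshelve. all: by end_near. Qed.

Lemma fourier0_interval f a b : intC f -> (forall k, fourier f k = 0) ->
  0 < a -> a < b -> b < 1 ->
  \int[lebesgue_measure]_(x in `]a, b[) complex.Re (f x) = 0 /\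
  \int[lebesgue_measure]_(x in `]a, b[) complex.Im (f x) = 0.
Proof.
move=> hf f0 a0 ab b1; have [h1 h2] := hf.
split; apply: interval_integral0 => // y n N.
  by have [] := real_trig_integral0 hf f0 (trig_like_peak y n N).
by have [] := real_trig_integral0 hf f0 (trig_like_peak y n N).
Qed.

Section vanishing.
Variable u : R -> R.
Hypothesis iu : int01 u.
Hypothesis u0 : forall a b, 0 < a -> a < b -> b < 1 ->
  \int[lebesgue_measure]_(x in `]a, b[) u x = 0.

Let v := u \_ (`[0, 1] : set R).

Let F x := \int[lebesgue_measure]_(t in `]-oo, x]) v t.

Let iv (D : set R) : measurable D ->
  lebesgue_measure.-integrable D (EFin \o v).
Proof.
move=> mD; apply: (@integrableS _ _ _ _ setT) => //.
by rewrite /v -restrict_EFin; apply/(integrable_mkcond _ _).1.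
Qed.

(* The vanishing integrals make the primitive [F] constant; by the fundamental
   theorem of calculus, [u] is almost everywhere the derivative of [F]. *)
Let F_cst x y : 0 < x -> x < y -> y < 1 -> F y = F x.
Proof.
move=> x0 xy y1; apply/eqP; rewrite -subr_eq0; apply/eqP.
rewrite /F Rintegral_itvB//; last by rewrite bnd_simp ltW.
  rewrite -(u0 x0 xy y1) -Rintegral_itv_bndo_bndc; last exact: iv.
  apply: eq_Rintegral => z; rewrite inE /= in_itv /= => /andP[h1 h2].
  by rewrite /v patchE mem_setE in_itv /= (ltW (lt_trans x0 h1)) (ltW (lt_trans h2 y1)).
exact: iv.
Qed.

Let F_deriv x : 0 < x -> x < 1 -> derive1 F x = 0.
Proof.
move=> x0 x1; rewrite derive1E.
rewrite (@near_eq_derive _ _ _ F (cst (F x)))//; first exact: derive_cst.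
near=> y.
have y0 : 0 < y by near: y; exact: lt_nbhsr.
have y1 : y < 1 by near: y; exact: lt_nbhsl.
by have [xy|yx|->] := ltgtP x y; [exact: F_cst|exact/esym/F_cst|].
Unshelve. all: by end_near. Qed.

Lemma interval0_ae : {ae lebesgue_measure, forall x, 0 < x < 1 -> u x = 0}.
Proof.
have lv : locally_integrable [set: R] v by apply: integrable_locally.
have := FTC1Ny (fun y => iv (measurable_itv `]-oo, y])) lv.
apply: filterS; first exact: (ae_filter_ringOfSetsType lebesgue_measure).
move=> x [_ Fx] /andP[x0 x1].
move: Fx; rewrite -/F F_deriv// /v patchE mem_setE in_itv /= !ltW//.
Qed.

Lemma interval0_continuous : continuous u -> forall x, 0 < x < 1 -> u x = 0.
Proof.
move=> cu x /andP[x0 x1].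
have vu : \forall y \near x, v y = u y.
  near=> y.
  have y0 : 0 < y by near: y; exact: lt_nbhsr.
  have y1 : y < 1 by near: y; exact: lt_nbhsl.
  by rewrite /v patchE mem_setE in_itv /= !ltW.
have cv : {for x, continuous v}.
  rewrite /continuous_at /prop_for (nbhs_singleton vu).
  by apply: cvg_trans (cu x); apply: near_eq_cvg; near=> y; apply/esym; near: y.
have := @continuous_FTC1 R v -oo%O x 1 x1 (iv (measurable_itv `]-oo, 1])).
move=> /(_ (ltNyr _) cv) [_]; rewrite -/F F_deriv// (nbhs_singleton vu).
by move=> ->.
Unshelve. all: by end_near. Qed.

End vanishing.

Lemma fourier0_ae f : intC f -> (forall k, fourier f k = 0) ->
  {ae lebesgue_measure, forall x, 0 < x < 1 -> f x = 0}.
Proof.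
move=> hf f0; have [h1 h2] := hf.
have r0 a b (a0 : 0 < a) (ab : a < b) (b1 : b < 1) :=
  (fourier0_interval hf f0 a0 ab b1).1.
have i0 a b (a0 : 0 < a) (ab : a < b) (b1 : b < 1) :=
  (fourier0_interval hf f0 a0 ab b1).2.
have := interval0_ae h2 i0; have := interval0_ae h1 r0.
apply: filterS2; first exact: (ae_filter_ringOfSetsType lebesgue_measure).
move=> x hr hi x01; apply: complex_eq; [exact: hr|exact: hi].
Qed.

Lemma periodic1_int (T : Type) (f : R -> T) : periodic1 f ->
  forall (m : int) x, f (x + m%:~R) = f x.
Proof.
move=> pf; have pn (n : nat) x : f (x + n%:R) = f x.
  elim: n x => [|n IH] x; first by rewrite addr0.
  by rewrite -natr1 addrA pf IH.
case=> n x; first exact: pn.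
by rewrite NegzE mulrNz -(pn n.+1) subrK.
Qed.

Lemma periodic_contC0 f : periodic1 f -> contC f ->
  (forall x, 0 < x < 1 -> f x = 0) -> forall x, f x = 0.
Proof.
move=> pf cf f0.
have f00 : f 0 = 0.
  have : (f x : R[i]^o) @[x --> (0 : R)^'+] --> (f 0 : R[i]^o).
    by apply: cvg_at_right_filter; exact: (@contC_cvg _ _ cf).
  move=> /cvg_cmodP h; apply: cmod_eq0; apply/eqP.
  rewrite eq_le cmod_ge0 andbT; apply/ler_addgt0Pr => e e0; rewrite add0r.
  near (0 : R)^'+ => x.
  have x0 : 0 < x by near: x; exact: nbhs_right_gt.
  have x1 : x < 1 by near: x; exact: nbhs_right_lt.
  rewrite -cmodN -[- f 0]add0r -(f0 x) ?x0//; apply: ltW; near: x; exact: h.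
move=> x; have /andP[h1 h2] := floor_itv x.
rewrite -(periodic1_int pf (- Num.floor x)) mulrNz.
have [e|e] := eqVneq (x - (Num.floor x)%:~R) 0; first by rewrite e.
apply: f0; rewrite lt_neqAle eq_sym e subr_ge0 h1 /= ltrBlDl.
by rewrite -[1]/(1%:~R) -intrD.
Unshelve. all: by end_near. Qed.

Lemma fourier0_continuous f : periodic1 f -> contC f ->
  (forall k, fourier f k = 0) -> forall x, f x = 0.
Proof.
move=> pf cf f0; apply: periodic_contC0 => // x x01.
have hf := contC_intC cf; have [h1 h2] := hf.
have r0 a b (a0 : 0 < a) (ab : a < b) (b1 : b < 1) :=
  (fourier0_interval hf f0 a0 ab b1).1.
have i0 a b (a0 : 0 < a) (ab : a < b) (b1 : b < 1) :=
  (fourier0_interval hf f0 a0 ab b1).2.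
apply: complex_eq.
  exact: (interval0_continuous h1 r0 (contC_Re cf)).
exact: (interval0_continuous h2 i0 (contC_Im cf)).
Qed.

Lemma fourier_inj f g : periodic1 f -> contC f -> periodic1 g -> contC g ->
  (forall k, fourier f k = fourier g k) -> f = g.
Proof.
move=> pf cf pg cg fg; apply/funext => x; apply/eqP; rewrite -subr_eq0; apply/eqP.
apply: (fourier0_continuous (f := fun x => f x - g x)).
- by move=> y; rewrite pf pg.
- exact: contCB cf cg.
- by move=> k; rewrite (fourierB _ (contC_intC cf) (contC_intC cg)) fg subrr.
Qed.

Lemma synth_fourier f A : periodic1 f -> contC f -> qbd (fourier f) A ->
  synth (fourier f) = f.
Proof.
move=> pf cf h; apply: fourier_inj => //.
- exact: synth_periodic.
- exact: contC_synth h.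
- by move=> k; rewrite (fourier_synth k h).
Qed.

End Uniqueness.

(** * The spaces of functions analytic in a strip *)

Section Spaces.
Variable R : realType.
Implicit Types (f g : R -> R[i]) (k : int) (d s x B A : R).

Lemma esum_int_le (a : int -> R) B : (forall k, 0 <= a k) ->
  (forall n, \sum_(0 <= i < n) a i%:Z <= B) ->
  (forall n, \sum_(0 <= i < n) a (Negz i) <= B) ->
  (\esum_(k in [set: int]) (a k)%:E <= (B + B)%:E)%E.
Proof.
move=> a0 h1 h2.
have a0' k : (0 <= (a k)%:E)%E by rewrite lee_fin.
rewrite (esumID (range Posz)); last by move=> k _; exact: a0'.
rewrite setTI (_ : ~` range Posz = range Negz); last first.
  apply/seteqP; split => [[n|n] /=|_ [n _ <-] /=].
  - by case; exists n.
  - by exists n.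
  - by case=> m _.
have le (e : nat -> int) : (forall n, \sum_(0 <= i < n) a (e i) <= B) ->
    set_inj [set: nat] e -> (\esum_(k in range e) (a k)%:E <= B%:E)%E.
  move=> he inj; rewrite esum_image// -nneseries_esumT; last by move=> n; exact: a0'.
  apply: lime_le; first by apply: is_cvg_nneseries => n _ _; exact: a0'.
  by apply: nearW => n; rewrite sumEFin lee_fin.
rewrite EFinD setTI; apply: leeD; apply: le => //.
- by move=> m n _ _ [].
- by move=> m n _ _ [].
Qed.

Lemma Gnorm_term d s f k : japanese R k `^ (2 * s) * expR (4 * pi * d * `|k|%:~R)
    * (complex.Re `|fourier f k|) ^+ 2 =
  (japanese R k `^ s * expR (2 * pi * d * `|k|%:R) * cmod (fourier f k)) ^+ 2.
Proof.
rewrite !exprMn; congr (_ * _ * _).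
  by rewrite -powR_mulrn ?powR_ge0// -powRrM mulrC.
rewrite -expRM_natl; congr expR.
by rewrite -[`|k|%:~R]/(`|k|%N%:~R) -pmulrn; ring.
Qed.

Lemma Gnorm_ge0 d s f : (0 <= Gnorm d s f)%E.
Proof. exact: sqrte_ge0. Qed.

Lemma le_Gnorm d s f B : (Gnorm d s f <= B%:E)%E -> forall k,
  japanese R k `^ s * expR (2 * pi * d * `|k|%:R) * cmod (fourier f k) <= B.
Proof.
move=> hB k.
have B0 : 0 <= B by rewrite -lee_fin; apply: le_trans (Gnorm_ge0 d s f) hB.
set t := _ * _.
have t0 : 0 <= t by rewrite /t !mulr_ge0 ?powR_ge0 ?expR_ge0 ?cmod_ge0.
rewrite -(@ler_pXn2r _ 2)// ?nnegrE//; rewrite -lee_fin.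
have -> : ((B ^+ 2)%:E = B%:E ^+ 2 :> \bar R)%E by rewrite EFin_expe.
have e0 : (0 <= \esum_(k in [set: int]) (japanese R k `^ (2 * s) *
    expR (4 * pi * d * `|k|%:~R) * (complex.Re `|fourier f k|) ^+ 2)%:E)%E.
  by apply: esum_ge0 => j _; rewrite lee_fin Gnorm_term sqr_ge0.
apply: (@le_trans _ _ (Gnorm d s f ^+ 2)%E); last first.
  by rewrite lee_sqr// ?Gnorm_ge0 ?lee_fin.
rewrite /Gnorm sqr_sqrte//; apply: esum_ge; exists [set k] => //.
by rewrite fsbig_set1 lee_fin Gnorm_term.
Qed.

Lemma Gnorm_le d s f B : 0 <= B ->
  (\esum_(k in [set: int]) ((japanese R k `^ s * expR (2 * pi * d * `|k|%:R) *
     cmod (fourier f k)) ^+ 2)%:E <= (B ^+ 2)%:E)%E ->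
  (Gnorm d s f <= B%:E)%E.
Proof.
move=> B0 h; rewrite /Gnorm; under eq_esum do rewrite Gnorm_term.
have -> : B%:E = sqrte (B ^+ 2)%:E by rewrite /= sqrtr_sqr ger0_norm.
by rewrite lee_sqrt// lee_fin sqr_ge0.
Qed.

Lemma japanese_bounds k : 1 <= japanese R k /\ japanese R k <= 1 + `|k|%:R /\
  1 + `|k|%:R <= 2 * japanese R k.
Proof.
have e : (k%:~R : R) ^+ 2 = `|k|%:R ^+ 2.
  by rewrite -real_normK ?num_real// -intr_norm -[`|k|%:~R]/(`|k|%N%:~R) -pmulrn.
rewrite /japanese e; set n := `|k|%:R : R.
have n0 : 0 <= n by [].
have h : 0 <= 1 + n ^+ 2 by rewrite addr_ge0// sqr_ge0.
split; first by rewrite -{1}(sqrtr1 R) ler_wsqrtr// lerDl sqr_ge0.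
split.
  rewrite -[leRHS]ger0_norm ?addr_ge0// -sqrtr_sqr ler_wsqrtr//.
  by rewrite sqrrD expr1n mul1r lerD2r lerDl mulrn_wge0.
rewrite -(@ler_pXn2r _ 2)// ?nnegrE ?addr_ge0// ?mulr_ge0 ?sqrtr_ge0//.
rewrite exprMn sqr_sqrtr//; have := sqr_ge0 (n - 1).
by rewrite sqrrB sqrrD !expr1n mulr1 mul1r !mulr2n; have := sqr_ge0 n; lra.
Qed.

(** As [1 + |k| <= 2 <k>], the constant has to be at least [2 ^ (3 / 2)]. *)
Lemma japanese_qw k s : 3 / 2 <= s -> 1 <= 3 * qw R k * japanese R k `^ s.
Proof.
move=> s32; have [j1 [_ j2]] := japanese_bounds k.
set J := japanese R k in j1 j2 *.
have J0 : 0 < J by apply: lt_le_trans j1.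
apply: (@le_trans _ _ (3 * qw R k * J `^ (3 / 2))); last first.
  by rewrite ler_wpM2l ?mulr_ge0 ?qw_ge0// ler_powR.
have -> : J `^ (3 / 2) = J * Num.sqrt J.
  rewrite -powR12_sqrt ?(ltW J0)// -{2}(powRr1 (ltW J0)) -powRD.
    by congr (_ `^ _); field.
  by rewrite gt_eqF ?implybT.
rewrite /qw /qnat mulrAC ler_pdivlMr ?mulr_gt0 ?sqrtr_gt0// mul1r.
have s2 : Num.sqrt 2 <= 3 / 2 :> R.
  by rewrite -[leRHS]ger0_norm ?divr_ge0// -sqrtr_sqr ler_wsqrtr//; lra.
have j3 : `|k|.+1%:R <= 2 * J by rewrite -natr1 addrC.
have h2 : Num.sqrt `|k|.+1%:R <= 3 / 2 * Num.sqrt J :> R.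
  apply: (le_trans (ler_wsqrtr j3)); rewrite sqrtrM//.
  by rewrite ler_wpM2r ?sqrtr_ge0.
by apply: (le_trans (ler_pM _ _ j3 h2)); rewrite ?sqrtr_ge0//; lra.
Qed.

(** A power of [1 + |k|] is absorbed by an arbitrarily small exponential. *)
Lemma japanese_exp s e : 0 < e -> exists2 K : R, 0 < K &
  forall k, japanese R k `^ s <= K * expR (2 * pi * e * `|k|%:R).
Proof.
move=> e0; pose m := (Num.truncn s).+1; pose a := 2 * pi * e : R.
have a0 : 0 < a by rewrite !mulr_gt0 ?pi_gt0.
exists (m`!%:R / a ^+ m * expR a).
  by rewrite mulr_gt0 ?expR_gt0// divr_gt0 ?exprn_gt0// ltr0n fact_gt0.
move=> k; have [j1 [j2 _]] := japanese_bounds k.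
apply: (@le_trans _ _ ((1 + `|k|%:R) ^+ m)).
  apply: (@le_trans _ _ (japanese R k `^ m%:R)).
    by rewrite ler_powR// ltW// real_truncnS_gt// num_real.
  have j0 : 0 <= japanese R k by apply: le_trans j1.
  by rewrite powR_mulrn//; apply: lerXn2r; rewrite ?nnegrE ?addr_ge0.
have h : 0 <= a * (1 + `|k|%:R) by rewrite mulr_ge0 ?(ltW a0)// addr_ge0.
have := expR_ge1Dxn (Num.truncn s) h; rewrite -/m => /(le_trans _) h2.
have {}h2 : (a * (1 + `|k|%:R)) ^+ m / m`!%:R <= expR (a * (1 + `|k|%:R)).
  by apply: h2; rewrite lerDr.
move: h2; rewrite ler_pdivrMr ?ltr0n ?fact_gt0// exprMn mulrC -ler_pdivlMr ?exprn_gt0//.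
by move/le_trans; apply; rewrite mulrDr mulr1 expRD le_eqVlt; apply/orP; left;
  apply/eqP; rewrite -/a; ring.
Qed.

Lemma exp_le_qw e : 0 < e -> exists2 K : R, 0 < K &
  forall k, expR (- (2 * pi * e * `|k|%:R)) <= K * qw R k.
Proof.
move=> e0; have [K K0 hK] := japanese_exp (3 / 2) e0.
exists (3 * K); first by rewrite mulr_gt0.
move=> k; rewrite expRN -[leLHS]mul1r ler_pdivrMr ?expR_gt0//.
apply: le_trans (japanese_qw k (lexx _)) _.
rewrite (_ : 3 * K * qw R k * _ = 3 * qw R k * (K * expR (2 * pi * e * `|k|%:R))).
  by rewrite ler_wpM2l// mulr_ge0// qw_ge0.
by ring.
Qed.

(** Each term is bounded by the whole sum; no width is lost, because [qw] only
    asks for [3 / 2] derivatives. *)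
Lemma decay_fourier d s f B : 3 / 2 <= s -> (Gnorm d s f <= B%:E)%E ->
  decay (fourier f) d (3 * B).
Proof.
move=> s32 /le_Gnorm h k.
have h1 := japanese_qw k s32; have h2 := h k; rewrite /gw expRN.
rewrite mulrA ler_pdivlMr ?expR_gt0//.
apply: (@le_trans _ _ (3 * qw R k * japanese R k `^ s *
   (cmod (fourier f k) * expR (2 * pi * d * `|k|%:R)))).
  by rewrite ler_peMl// mulr_ge0 ?cmod_ge0 ?expR_ge0.
rewrite (_ : 3 * B * qw R k = 3 * qw R k * B); last by ring.
rewrite -[leLHS]mulrA ler_wpM2l ?mulr_ge0 ?qw_ge0//.
by apply: le_trans h2; rewrite le_eqVlt; apply/orP; left; apply/eqP; ring.
Qed.

(** Without enough derivatives, some width has to be given up. *)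
Lemma decay_fourier_slack d e s f B : d < e -> 0 <= s -> (Gnorm e s f <= B%:E)%E ->
  exists A, decay (fourier f) d A.
Proof.
move=> de s0 /[dup] hB /le_Gnorm h.
have B0 : 0 <= B by rewrite -lee_fin; apply: le_trans (Gnorm_ge0 e s f) hB.
have e0 : 0 < e - d by rewrite subr_gt0.
have [K K0 hK] := exp_le_qw e0.
exists (B * K) => k.
have h1 : expR (2 * pi * e * `|k|%:R) * cmod (fourier f k) <= B.
  apply: le_trans (h k); rewrite ler_wpM2r ?cmod_ge0// ler_peMl ?expR_ge0//.
  have [j1 _] := japanese_bounds k.
  by rewrite -(powRr0 (japanese R k)) ler_powR.
have -> : cmod (fourier f k) = expR (2 * pi * e * `|k|%:R) * cmod (fourier f k) *
    expR (- (2 * pi * e * `|k|%:R)) by rewrite mulrAC expRxMexpNx_1 mul1r.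
apply: le_trans (ler_wpM2r _ h1) _; first exact: expR_ge0.
rewrite /gw mulrA -[B * K * _]mulrA -[leRHS]mulrA ler_wpM2l//.
have -> : - (2 * pi * e * `|k|%:R) =
    - (2 * pi * (e - d) * `|k|%:R) + - (2 * pi * d * `|k|%:R) :> R by ring.
by rewrite expRD ler_wpM2r ?expR_ge0.
Qed.

(** Conversely, the surplus of width absorbs the polynomial weight, and the
    squares of [qw] are summable. *)
Lemma Gnorm_decay d e s : d < e -> exists2 K : R, 0 < K &
  forall f A, decay (fourier f) e A -> (Gnorm d s f <= (K * A)%:E)%E.
Proof.
move=> de; have e0 : 0 < e - d by rewrite subr_gt0.
have [K K0 hK] := japanese_exp s e0.
exists (4 * K); first by rewrite mulr_gt0.
move=> f A h; have A0 := decay_ge0 h.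
have KA0 : 0 <= K * A by rewrite mulr_ge0// ltW.
apply: Gnorm_le; first by rewrite mulr_ge0// mulr_ge0// ltW.
pose a k := (K * A) ^+ 2 * qw R k.
apply: (@le_trans _ _ (\esum_(k in [set: int]) (a k)%:E)%E).
  apply: le_esum => k _; rewrite lee_fin /a.
  apply: (@le_trans _ _ ((K * A * qw R k) ^+ 2)); last first.
    rewrite exprMn ler_wpM2l ?sqr_ge0// expr2 ler_piMl ?qw_ge0//.
    exact: qw_le1.
  apply: lerXn2r; rewrite ?nnegrE ?mulr_ge0 ?powR_ge0 ?expR_ge0 ?cmod_ge0 ?qw_ge0 ?(ltW K0)//.
  apply: (le_trans (ler_wpM2l _ (h k))).
    by rewrite mulr_ge0 ?powR_ge0 ?expR_ge0.
  rewrite /gw (_ : _ * (A * _) = A * qw R k * (japanese R k `^ s *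
    (expR (2 * pi * d * `|k|%:R) * expR (- (2 * pi * e * `|k|%:R))))); last by ring.
  rewrite [leRHS](_ : _ = A * qw R k * K); last by ring.
  rewrite ler_wpM2l ?mulr_ge0 ?qw_ge0// -expRD.
  have -> : 2 * pi * d * `|k|%:R + - (2 * pi * e * `|k|%:R) =
    - (2 * pi * (e - d) * `|k|%:R) :> R by ring.
  by rewrite expRN ler_pdivrMr ?expR_gt0.
apply: le_trans (@esum_int_le a (6 * (K * A) ^+ 2) _ _ _) _.
- by move=> k; rewrite mulr_ge0 ?sqr_ge0 ?qw_ge0.
- move=> n; rewrite /a -mulr_sumr mulrC ler_wpM2r ?sqr_ge0//.
  by have := sum_qw R 0 n; under eq_bigr do rewrite add0r.
- move=> n; rewrite /a -mulr_sumr mulrC ler_wpM2r ?sqr_ge0//.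
  have := sum_qwN R (-1) n; congr (_ <= _); apply: eq_bigr => i _.
  by rewrite NegzE; congr (qw R _); lia.
by rewrite lee_fin -[4 * K * A]mulrA; have := sqr_ge0 (K * A); nra.
Qed.

Lemma L2_contC f : periodic1 f -> contC f -> L2 f.
Proof.
move=> pf cf.
have h (u : R -> R) : continuous u -> square_integrable u.
  move=> cu; split.
    by apply: measurable_funTS; exact: continuous_measurable_fun.
  apply: (continuous_compact_integrable (f := fun x => u x ^+ 2)).
    exact: segment_compact.
  apply: continuous_subspaceT => x; rewrite (_ : (fun x => u x ^+ 2) = u \* u).
    by apply: continuousM; exact: cu.
  by apply/funext => y; rewrite expr2.
split=> //; [exact/h/contC_Re|exact/h/contC_Im].
Qed.

Lemma square_integrable_int01 (u : R -> R) : square_integrable u -> int01 u.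
Proof.
move=> [mu iu2].
have i1 : int01 (fun _ : R => 1 : R).
  apply: continuous_compact_integrable; first exact: segment_compact.
  by apply: continuous_subspaceT; exact: cst_continuous.
have := int01D i1 iu2; rewrite /int01.
apply: le_integrable => //; first exact/measurable_EFinP.
move=> x _; rewrite lee_fin /= [leRHS]ger0_norm ?addr_ge0 ?sqr_ge0//.
rewrite -real_normK ?num_real//; have := sqr_ge0 (`|u x| - 1).
rewrite sqrrB expr1n mulr1 mulr2n; have := normr_ge0 (u x).
by have := sqr_ge0 `|u x|; lra.
Qed.

Lemma L2_intC f : L2 f -> intC f.
Proof. by move=> [_ h1 h2]; split; exact: square_integrable_int01. Qed.

Lemma GC_synth (c : int -> R[i]) d e s A : 0 <= d -> d < e -> decay c e A ->
  GC d s (synth c).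
Proof.
move=> d0 de h; have e0 : 0 <= e by apply: le_trans d0 (ltW de).
have q := decay_qbd e0 h; split.
  by apply: L2_contC; [exact: synth_periodic|exact: contC_synth q].
have [K _ hK] := Gnorm_decay s de.
apply: le_lt_trans (hK (synth c) A _) (ltry _).
by move=> k; rewrite (fourier_synth k q).
Qed.

Lemma GC_decay d s f : 3 / 2 <= s -> GC d s f ->
  decay (fourier f) d (3 * fine (Gnorm d s f)).
Proof.
move=> s32 [_ h]; apply: decay_fourier s32 _.
by rewrite fineK// ge0_fin_numE// Gnorm_ge0.
Qed.

End Spaces.

(** * Fourier coefficients of real analytic functions *)

Section Analytic.
Variable R : realType.
Implicit Types (a : nat -> R) (n j : nat) (x z h M C : R).

(** The coefficients of the [n]-th derivative of the power series [a]. *)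
Definition ncoef a n j : R := ((j + n) ^_ n)%:R * a (j + n)%N.

Lemma pseries_diffs_ncoef a n : pseries_diffs (ncoef a n) = ncoef a n.+1.
Proof.
apply/funext => j; rewrite /pseries_diffs /ncoef addSnnS mulrA -natrM.
congr (_%:R * _); apply/eqP; rewrite -(eqn_pmul2r (fact_gt0 j)).
rewrite mulnAC -factS.
have := ffact_fact (leq_addl j.+1 n); rewrite addnK addSnnS mulnC => ->.
by have := ffact_fact (leq_addl j n.+1); rewrite addnK => ->.
Qed.

(** Cauchy estimates for the derivatives of a power series, from the crude bound
    [binomial (j + n) n <= 2 ^ (j + n)]. *)
Lemma ncoef_le a C x n j : 0 < x -> (forall i, `|a i| * x ^+ i <= C) ->
  `|ncoef a n j| <= C * n`!%:R * (2 / x) ^+ n * (2 / x) ^+ j.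
Proof.
move=> x0 hC; have C0 : 0 <= C by apply: le_trans (hC 0%N); rewrite mulr_ge0// exprn_ge0// ltW.
have x0' n' : 0 < x ^+ n' by rewrite exprn_gt0.
rewrite /ncoef normrM ger0_norm//.
have h1 : `|a (j + n)%N| <= C / x ^+ (j + n) by rewrite ler_pdivlMr.
have h2 : ((j + n) ^_ n)%:R <= n`!%:R * 2 ^+ (j + n) :> R.
  rewrite -natrX -natrM ler_nat -bin_ffact mulnC leq_mul2l.
  apply/orP; right; rewrite -[2%N]/(1 + 1)%N expnDn.
  have nj : (n < (j + n).+1)%N by rewrite ltnS leq_addl.
  rewrite (bigD1 (Ordinal nj))//= !exp1n !muln1; exact: leq_addr.
apply: (le_trans (ler_pM _ _ h2 h1)) => //.
rewrite -[leRHS]mulrA -exprD addnC [X in _ <= X * _]mulrC expr_div_n.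
by rewrite le_eqVlt; apply/orP; left; apply/eqP; rewrite addnC; field; rewrite gt_eqF.
Qed.

Lemma is_cvg_ncoef a C x y n : 0 < x -> (forall i, `|a i| * x ^+ i <= C) ->
  `|y| <= x / 3 -> cvgn (pseries (ncoef a n) y).
Proof.
move=> x0 hC hy; apply: normed_cvg.
pose D := C * n`!%:R * (2 / x) ^+ n.
have C0 : 0 <= C by apply: le_trans (hC 0%N); rewrite mulr_ge0// exprn_ge0// ltW.
have D0 : 0 <= D by rewrite !mulr_ge0// exprn_ge0// divr_ge0// ltW.
apply: (series_le_cvg (v_ := geometric D (2 / 3))) => [j /=|j /=|j /=|] //.
- by rewrite mulr_ge0// exprn_ge0//; lra.
- rewrite normrM normrX; apply: (le_trans (ler_wpM2r _ (ncoef_le n j x0 hC))).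
    exact: exprn_ge0.
  rewrite -/D -mulrA -exprMn ler_wpM2l//; apply: lerXn2r; rewrite ?nnegrE//.
    by rewrite mulr_ge0// divr_ge0// ltW.
  apply: le_trans (ler_wpM2l _ hy) _; first by rewrite divr_ge0// ltW.
  by rewrite le_eqVlt; apply/orP; left; apply/eqP; field; rewrite gt_eqF.
- by apply: is_cvg_geometric_series; rewrite ger0_norm; lra.
Qed.

Lemma lim_ncoef_le a C x y n : 0 < x -> (forall i, `|a i| * x ^+ i <= C) ->
  `|y| <= x / 4 ->
  `|limn (pseries (ncoef a n) y)| <= 2 * C * n`!%:R * (2 / x) ^+ n.
Proof.
move=> x0 hC hy.
have hy3 : `|y| <= x / 3 by apply: le_trans hy _; lra.
have cv := is_cvg_ncoef (n := n) x0 hC hy3.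
pose D := C * n`!%:R * (2 / x) ^+ n.
have C0 : 0 <= C by apply: le_trans (hC 0%N); rewrite mulr_ge0// exprn_ge0// ltW.
have D0 : 0 <= D by rewrite !mulr_ge0// exprn_ge0// divr_ge0// ltW.
have bnd N : `|pseries (ncoef a n) y N| <= D / (1 - 1 / 2).
  apply: (le_trans (ler_norm_sum _ _ _)).
  have h2 : (0 : R) <= 1 / 2 by []. have h3 : (1 / 2 : R) < 1 by lra.
  apply: le_trans (sbd_geometric h2 h3 D0 N).
  apply: ler_sum => j _; rewrite normrM normrX.
  apply: (le_trans (ler_wpM2r _ (ncoef_le n j x0 hC))); first exact: exprn_ge0.
  rewrite -/D -mulrA -exprMn ler_wpM2l//; apply: lerXn2r; rewrite ?nnegrE//.
    by rewrite mulr_ge0// divr_ge0// ltW.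
  apply: le_trans (ler_wpM2l _ hy) _; first by rewrite divr_ge0// ltW.
  by rewrite le_eqVlt; apply/orP; left; apply/eqP; field; rewrite gt_eqF.
rewrite [leRHS](_ : _ = D / (1 - 1 / 2)); last by rewrite /D; field.
rewrite ler_norml; apply/andP; split.
  by apply: limr_ge => //; apply: nearW => N; have := bnd N; rewrite ler_norml => /andP[].
by apply: limr_le => //; apply: nearW => N; have := bnd N; rewrite ler_norml => /andP[].
Qed.

Lemma is_derive_translate (f : R -> R) (c y df : R) : is_derive (y + c) (1 : R) f df ->
  is_derive y (1 : R) (fun t => f (t + c)) df.
Proof.
move=> d.
have d1 : is_derive y (1 : R) (fun t : R => t + c) 1.
  have := is_deriveD (is_derive_id y (1 : R)) (is_derive_cst c y (1 : R)).
  by rewrite addr0.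
by have := @is_derive1_comp _ f (fun t => t + c) y _ _ d d1; rewrite mulr1.
Qed.

Variable u : R -> R.
Hypothesis au : analytic_on [set: R] u.

Lemma analytic_local z : exists x a C, 0 < x /\
  (forall i, `|a i| * x ^+ i <= C) /\
  (forall h, `|h| < x / 4 -> u (z + h) = limn (pseries (ncoef a 0) h)).
Proof.
have [a [r [r0 hr]]] := au (I : [set: R] z).
pose x := r / 2; have x0 : 0 < x by rewrite divr_gt0.
have xr : `|x| < r by rewrite ger0_norm ?(ltW x0)// /x; lra.
have cvx : cvgn (pseries a x) by apply/cvg_ex; eexists; exact: hr xr.
have [K [Kr hK]] := cvg_series_bounded cvx.
exists x, a, (`|K| + 1); split=> //; split.
  move=> i; rewrite -[x ^+ i]ger0_norm ?exprn_ge0 ?(ltW x0)// -normrM.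
  by apply: (hK (`|K| + 1)) => //; rewrite (le_lt_trans (ler_norm _))// ltrDl.
move=> h hx; have hr' : `|h| < r by apply: lt_trans hx _; rewrite /x; lra.
have -> : ncoef a 0 = a.
  by apply/funext => j; rewrite /ncoef addn0 ffactn0 mul1r.
by apply/esym/cvg_lim => //; exact: hr.
Qed.

(** The radius does not depend on the order of the derivative: this is what
    gives the factorial growth of the derivatives. *)
Lemma analytic_derive1n z : exists x a C, [/\ 0 < x,
  (forall i, `|a i| * x ^+ i <= C) &
  (forall n h, `|h| < x / 4 ->
     derive1n n u (z + h) = limn (pseries (ncoef a n) h) /\
     is_derive (z + h) (1 : R) (derive1n n u) (limn (pseries (ncoef a n.+1) h)))].
Proof.
have [x [a [C [x0 [hC hu]]]]] := analytic_local z.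
exists x, a, C; split=> //.
have dg n h : `|h| < x / 4 -> is_derive h (1 : R)
    (fun h => limn (pseries (ncoef a n) h)) (limn (pseries (ncoef a n.+1) h)).
  move=> hx; rewrite -pseries_diffs_ncoef.
  have x3 : `|x / 3| <= x / 3 by rewrite ger0_norm//; lra.
  apply: (@pseries_snd_diffs _ _ (x / 3)).
  - exact: (is_cvg_ncoef x0 hC x3).
  - rewrite pseries_diffs_ncoef; exact: (is_cvg_ncoef x0 hC x3).
  - rewrite !pseries_diffs_ncoef; exact: (is_cvg_ncoef x0 hC x3).
  - by rewrite [ltRHS]ger0_norm; lra.
have step n : (forall h, `|h| < x / 4 -> derive1n n u (z + h) =
      limn (pseries (ncoef a n) h)) -> forall h, `|h| < x / 4 ->
    is_derive (z + h) (1 : R) (derive1n n u) (limn (pseries (ncoef a n.+1) h)).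
  move=> hn h hx.
  have d2 : is_derive (z + h) (1 : R)
      (fun y => limn (pseries (ncoef a n) (y - z))) (limn (pseries (ncoef a n.+1) h)).
    apply: (@is_derive_translate (fun h => limn (pseries (ncoef a n) h))).
    by rewrite addrC addKr; exact: dg.
  apply: near_eq_is_derive d2.
  have hx' : 0 < x / 4 - `|h| by rewrite subr_gt0.
  near=> y; have yz : `|y - z| < x / 4.
    have : `|(z + h) - y| < x / 4 - `|h|.
      near: y; exact: (@cvgr_dist_lt _ _ _ _ _ id).
    rewrite (_ : y - z = h - (z + h - y)); last by ring.
    by move=> hh; apply: (le_lt_trans (ler_normB _ _)); lra.
  by rewrite -hn// [z + _]addrC subrK.
elim=> [|n IH] h hx; first by split; [exact: hu|apply: step].
have hn : forall h, `|h| < x / 4 -> derive1n n.+1 u (z + h) =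
    limn (pseries (ncoef a n.+1) h).
  move=> h' hx'; have [_ d] := IH h' hx'.
  by rewrite /= derive1E; have [_ ->] := d.
by split; [exact: hn|exact: step].
Unshelve. all: by end_near. Qed.

Lemma analytic_is_derive n z :
  is_derive z (1 : R) (derive1n n u) (derive1n n.+1 u z).
Proof.
have [x [a [C [x0 hC h]]]] := analytic_derive1n z.
have h0 : `|0 : R| < x / 4 by rewrite normr0 divr_gt0.
have [_ d1] := h n 0 h0; have [d2 _] := h n.+1 0 h0.
by rewrite addr0 in d1 d2; rewrite d2.
Qed.

(** By compactness the Cauchy estimates are uniform over a period. *)
Lemma analytic_bounds : exists2 M : R, 0 < M &
  forall n z, 0 <= z <= 1 -> `|derive1n n u z| <= M * n`!%:R * M ^+ n.
Proof.
have cpt : compact (`[0, 1] : set R) by exact: segment_compact.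
have /compact_near_coveringP := cpt.
move=> /(_ _ (pinfty_nbhs R) (fun M z => forall n,
  `|derive1n n u z| <= M * n`!%:R * M ^+ n)) H.
have : \forall M \near pinfty_nbhs R, forall z, `[0, 1]%classic z ->
    forall n, `|derive1n n u z| <= M * n`!%:R * M ^+ n.
  apply: H => z _.
  have [x [a [C [x0 hC h]]]] := analytic_derive1n z.
  have C0 : 0 <= C by apply: le_trans (hC 0%N); rewrite mulr_ge0// exprn_ge0// ltW.
  have x4 : 0 < x / 4 by rewrite divr_gt0.
  exists ([set y | `|z - y| < x / 4], [set M | 2 * C + 2 / x < M]) => /=.
    split; last by exists (2 * C + 2 / x); split; rewrite ?num_real.
    exact: (nbhsx_ballx z (x / 4) x4).
  move=> [y M] [/= hy hM] n.
  have -> : y = z + (y - z) by rewrite addrC subrK.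
  have hyz : `|y - z| < x / 4 by rewrite distrC.
  have [-> _] := h n (y - z) hyz.
  apply: (le_trans (lim_ncoef_le n x0 hC (ltW hyz))).
  have x2 : 0 <= 2 / x by rewrite divr_ge0// ltW.
  have M2 : 2 * C <= M by lra.
  have M3 : 2 / x <= M by lra.
  apply: ler_pM; [by rewrite !mulr_ge0|by rewrite exprn_ge0|by rewrite ler_wpM2r|].
  by apply: lerXn2r; rewrite ?nnegrE//; lra.
case=> A [Ar hA]; exists (`|A| + 1); first by rewrite ltr_wpDl.
by move=> n z z01; apply: hA => //; rewrite (le_lt_trans (ler_norm _))// ltrDl.
Qed.

Hypothesis pu : periodic1 u.

Lemma derive1n_periodic n : periodic1 (derive1n n u).
Proof.
elim: n => [|n IH] x; first exact: pu.
have d1 := analytic_is_derive n (x + 1); have d2 := analytic_is_derive n x.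
have := is_derive_translate d1.
rewrite (_ : (fun _ => _) = derive1n n u); last by apply/funext => y; exact: IH.
by move=> [_ <-]; have [_ <-] := d2.
Qed.

Lemma fourier_derive1n n k :
  fourier (cplx (derive1n n u)) k = dsym R k ^+ n * fourier (cplx u) k.
Proof.
have dd m : cderiv (cplx (derive1n m u)) (cplx (derive1n m.+1 u)).
  move=> x; split; first exact: analytic_is_derive.
  exact: is_derive_cst.
elim: n => [|n IH]; first by rewrite mul1r.
rewrite (fourier_deriv k (dd n) (cderiv_contC (dd n.+1))).
  by rewrite IH exprS mulrA.
by rewrite /cplx -[in LHS](add0r 1) derive1n_periodic.
Qed.

Lemma contC_analytic : contC (cplx u).
Proof.
have d : cderiv (cplx u) (cplx (derive1 u)).
  by move=> x; split; [exact: (analytic_is_derive 0)|exact: is_derive_cst].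
exact: cderiv_contC d.
Qed.

(** Summing the bounds [|2 pi k|^n |f_k| <= 2 M^(n+1) n!] against
    [1 / ((2 M)^n n!)] gives an exponential. *)
Lemma analytic_fourier : exists2 e : R, 0 < e &
  exists A, decay (fourier (cplx u)) e A.
Proof.
have [M M0 hM] := analytic_bounds.
pose e := (2 * M)^-1.
have e0 : 0 < e by rewrite invr_gt0 mulr_gt0.
have key k : expR (2 * pi * e * `|k|%:R) * cmod (fourier (cplx u) k) <= 4 * M.
  set b := cmod _; have b0 : 0 <= b by exact: cmod_ge0.
  set y := 2 * pi * e * `|k|%:R.
  have y0 : 0 <= y by rewrite !mulr_ge0 ?pi_ge0// ltW.
  have term n : y ^+ n / n`!%:R * b <= 2 * M * (1 / 2) ^+ n.
    have f0 : 0 < n`!%:R :> R by rewrite ltr0n fact_gt0.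
    (* The left-hand side is the modulus of a coefficient of the [n]-th
       derivative, which is bounded by [analytic_bounds]. *)
    have : (2 * pi * `|k|%:R) ^+ n * b <= 2 * (M * n`!%:R * M ^+ n).
      rewrite -cmod_dsym /b -cmodX -cmodM -fourier_derive1n.
      apply: cmod_fourier => [|x x01]; last by rewrite /cplx cmod_real hM.
      apply: contC_intC; apply: (@cderiv_contC _ _ (cplx (derive1n n.+1 u))) => x.
      by split; [exact: analytic_is_derive|exact: is_derive_cst].
    have -> : y = 2 * pi * `|k|%:R * e by rewrite /y; ring.
    move=> h; rewrite [leLHS]mulrAC ler_pdivrMr// exprMn.
    have -> : (2 * pi * `|k|%:R) ^+ n * e ^+ n * b =
      (2 * pi * `|k|%:R) ^+ n * b * e ^+ n by ring.
    apply: le_trans (ler_wpM2r _ h) _; first by rewrite exprn_ge0// ltW.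
    have -> : (1 / 2 : R) = M * e by rewrite /e; field; rewrite gt_eqF.
    by rewrite exprMn le_eqVlt; apply/orP; left; apply/eqP; ring.
  have [->|bn0] := eqVneq b 0; first by rewrite mulr0 mulr_ge0// ltW.
  have bp : 0 < b by rewrite lt_neqAle eq_sym bn0.
  rewrite -ler_pdivlMr// /expR; apply: limr_le; first exact: is_cvg_series_exp_coeff.
  apply: nearW => N; rewrite ler_pdivlMr// mulr_suml.
  have h2 : (0 : R) <= 1 / 2 by []. have h3 : (1 / 2 : R) < 1 by lra.
  have M2 : 0 <= 2 * M by rewrite mulr_ge0// ltW.
  apply: le_trans (_ : 2 * M / (1 - 1 / 2) <= _); last first.
    by rewrite le_eqVlt; apply/orP; left; apply/eqP; field.
  apply: le_trans (sbd_geometric h2 h3 M2 N).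
  by apply: ler_sum => n _; exact: term.
have e2 : 0 < e / 2 by rewrite divr_gt0.
have [K K0 hK] := exp_le_qw e2.
(* Half of the width is spent on the weight [qw]. *)
exists (e / 2) => //; exists (4 * M * K) => k.
rewrite /gw mulrA -[4 * M * K * _]mulrA.
rewrite expRN ler_pdivlMr ?expR_gt0//.
have e4 : expR (2 * pi * e * `|k|%:R) = expR (2 * pi * (e / 2) * `|k|%:R) ^+ 2 :> R.
  by rewrite -expRM_natl; congr expR; field.
have := hK k; rewrite expRN; set E := expR (2 * pi * (e / 2) * `|k|%:R).
have E0 : 0 < E by exact: expR_gt0.
move=> h0; have h1 : 1 <= K * qw R k * E.
  by rewrite -(mulVf (lt0r_neq0 E0)) ler_wpM2r// ltW.
have := key k; rewrite e4 -/E => h2.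
rewrite -(ler_pM2l E0); apply: (@le_trans _ _ (4 * M)).
  by apply: le_trans h2; rewrite le_eqVlt; apply/orP; left; apply/eqP; ring.
rewrite [leRHS](_ : _ = 4 * M * (K * qw R k * E)); last by ring.
by rewrite ler_peMr// mulr_ge0// ltW.
Qed.

End Analytic.

(** * Analytic continuation to the strip *)

Section Strip.
Variable R : realType.
Implicit Types (w z h : R[i]) (k : int) (x y d : R) (c : int -> R[i]).

(** The exponential at complex arguments, by its series. *)
Definition cexp_term w (n : nat) : R[i] := w ^+ n / n`!%:R.

Definition cexp w : R[i] := csum (cexp_term w).

Lemma exp_term_le x n : 0 <= x -> x ^+ n / n`!%:R <= expR x.
Proof.
case: n => [|n] x0; first by rewrite expr0 fact0 divr1 -expR0 ler_expR.
by apply: le_trans (expR_ge1Dxn n x0); rewrite lerDr.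
Qed.

(** A geometric majorant of the exponential series, as required by
    [cauchy_product]. *)
Lemma pow_fact_le x n : 0 <= x -> x ^+ n / n`!%:R <= expR (2 * x) * (1 / 2) ^+ n.
Proof.
move=> x0; have x2 : 0 <= 2 * x by rewrite mulr_ge0.
have -> : x ^+ n / n`!%:R = (2 * x) ^+ n / n`!%:R * (1 / 2) ^+ n.
  by rewrite [RHS]mulrAC -exprMn; congr (_ ^+ n / _); field.
by rewrite ler_wpM2r ?exp_term_le// exprn_ge0.
Qed.

Lemma cmod_cexp_term w n : cmod (cexp_term w n) = cmod w ^+ n / n`!%:R.
Proof. by rewrite cmodM cmodX cmodV cmod_nat. Qed.

Lemma cexp_term_le w n :
  cmod (cexp_term w n) <= expR (2 * cmod w) * (1 / 2) ^+ n.
Proof. by rewrite cmod_cexp_term pow_fact_le ?cmod_ge0. Qed.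

Lemma half_bounds : (0 : R) <= 1 / 2 /\ (1 / 2 : R) < 1.
Proof. by split; lra. Qed.

Lemma cexp_hassum w : hassum (cexp_term w) (cexp w).
Proof.
have [h2 h3] := half_bounds.
have [] := sbd_hassum (cexp_term_le w) (sbd_geometric h2 h3 (expR_ge0 _)).
by [].
Qed.

Lemma cexpD w z : cexp (w + z) = cexp w * cexp z.
Proof.
have [h2 h3] := half_bounds.
have := cauchy_product h2 h3 (cexp_term_le w) (cexp_term_le z).
rewrite (_ : (fun n => _) = cexp_term (w + z)); first by move/hassum_csum.
apply/funext => n; rewrite /cexp_term addrC exprDn mulr_suml.
apply: eq_bigr => i _; have ni : (i <= n)%N by rewrite -ltnS.
have f0 m : (m`!%:R : R[i]) != 0 by rewrite pnatr_eq0 -lt0n fact_gt0.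
rewrite -mulr_natr -(bin_fact ni) !natrM.
have b0 : ('C(n, i)%:R : R[i]) != 0 by rewrite pnatr_eq0 -lt0n bin_gt0.
by field; rewrite !f0 b0.
Qed.

Lemma cmod_cexp w : cmod (cexp w) <= expR (cmod w).
Proof.
have [h] := cexp_hassum w.
apply: (cvg_cmod_le h) => N; apply: (le_trans (cmod_sum _ _ _)).
rewrite /expR; apply: (@le_trans _ _ (series (exp_coeff (cmod w)) N)).
  by apply: ler_sum => n _; rewrite cmod_cexp_term.
apply: nondecreasing_cvgn_le; last exact: is_cvg_series_exp_coeff.
apply/nondecreasing_seqP => n; rewrite seriesSr lerDl.
by apply: exp_coeff_ge0; exact: cmod_ge0.
Qed.

Lemma cexp_i y : cexp (y%:C * 'i)%C = expi y.
Proof.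
have ipow n : ('i%C ^+ n.*2 : R[i]) = ((-1) ^+ n)%:C%C.
  by rewrite -mul2n exprM sqr_i rmorphXn rmorphN1.
have e n : cexp_term (y%:C * 'i)%C n = (cos_coeff y n +i* sin_coeff y n)%C.
  rewrite /cexp_term /cos_coeff /sin_coeff exprMn.
  have -> : (n`!%:R : R[i])^-1 = (n`!%:R^-1)%:C%C.
    by rewrite fmorphV rmorph_nat.
  rewrite -rmorphXn -[n in 'i%C ^+ n]odd_double_half exprD ipow.
  rewrite /= -exprnP; have [on|en] := boolP (odd n).
    have -> : n.-1./2 = n./2 by rewrite -{1}(odd_double_half n) on /= doubleK.
    by rewrite /= mul0r mul1r; apply: complex_eq; rewrite ?(cReM, cImM) /=; ring.
  by rewrite /= mul0r mul1r; apply: complex_eq; rewrite ?(cReM, cImM) /=; ring.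
have h : hassum (cexp_term (y%:C * 'i)%C) (expi y).
  split; apply: cvg_ReIm.
    rewrite /= (_ : (fun _ => _) = series (cos_coeff y)).
      by rewrite /expi /= cos.unlock; exact: is_cvg_series_cos_coeff.
    by apply/funext => N; rewrite /series /= cRe_sum; apply: eq_bigr => n _; rewrite e.
  rewrite /= (_ : (fun _ => _) = series (sin_coeff y)).
    by rewrite /expi /= sin.unlock; exact: is_cvg_series_sin_coeff.
  by apply/funext => N; rewrite /series /= cIm_sum; apply: eq_bigr => n _; rewrite e.
exact: hassum_csum h.
Qed.

Lemma cexp_dsym_real k x : cexp (dsym R k * x%:C%C) = char k x.
Proof.
rewrite (_ : dsym R k * x%:C%C = ((2 * pi * k%:~R * x)%:C * 'i)%C) ?cexp_i//.
by rewrite /dsym; apply: complex_eq; rewrite ?(cReM, cImM) /=; ring.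
Qed.

Lemma cmod_cexp_dsym k z :
  cmod (cexp (dsym R k * z)) <= expR (2 * pi * `|complex.Im z| * `|k|%:R).
Proof.
rewrite {1}(complexE z) mulrDr cexpD cmodM cexp_dsym_real cmod_char mul1r.
apply: (le_trans (cmod_cexp _)).
rewrite ler_expR (cmodM (dsym R k)) (cmodM 'i%C) cmod_dsym cmod_i mul1r cmod_real.
by rewrite le_eqVlt; apply/orP; left; apply/eqP; ring.
Qed.

(** Replacing the characters by complex exponentials continues [synth c]. *)
Definition strip_ext c z : R[i] :=
  csum (pairing (fun k => c k * cexp (dsym R k * z))).

Lemma strip_ext_real c x : strip_ext c x%:C%C = synth c x.
Proof.
congr csum; apply/funext => -[|n] /=; first by rewrite cexp_dsym_real.
by rewrite !cexp_dsym_real.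
Qed.

(** Expanding each exponential at [z] and interchanging the summations gives the
    power series of the continuation at [z]. *)
Lemma strip_ext_analytic c d : (forall e, e < d -> exists A, decay c e A) ->
  analytic_on (strip d) (strip_ext c).
Proof.
move=> hc z; rewrite /strip /= => zd.
pose y := `|complex.Im z|.
have y0 : 0 <= y by exact: normr_ge0.
(* The decay in the width [y + t < d] pays for the height [y] of [z] and for the
   radius [t] of the expansion. *)
pose t := (d - y) / 3; have t0 : 0 < t by rewrite divr_gt0// subr_gt0.
have [A hA] : exists A, decay c (y + t) A.
  by apply: hc; rewrite /t /y; move: zd; lra.
have A0 := decay_ge0 hA.
pose b n k : R[i] := c k * cexp (dsym R k * z) * (dsym R k ^+ n / n`!%:R).
have bbd n k s : 0 <= s -> s <= t ->
    cmod (b n k) * s ^+ n <= (s / t) ^+ n * (A * qw R k).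
  move=> s0 st; rewrite /b !cmodM cmodX cmodV cmod_nat cmod_dsym.
  have f0 : 0 < n`!%:R :> R by rewrite ltr0n fact_gt0.
  set q := 2 * pi * `|k|%:R.
  have q0 : 0 <= q by rewrite !mulr_ge0 ?pi_ge0.
  have h1 : q ^+ n / n`!%:R * s ^+ n <= (s / t) ^+ n * expR (q * t).
    have -> : q ^+ n / n`!%:R * s ^+ n = (s / t) ^+ n * ((q * t) ^+ n / n`!%:R).
      by rewrite -[LHS]mulrAC -exprMn mulrA -exprMn; congr (_ ^+ n / _);
        field; rewrite gt_eqF.
    have st0 : 0 <= s / t by apply: divr_ge0 => //; exact: ltW.
    have qt : 0 <= q * t by apply: mulr_ge0 => //; exact: ltW.
    by rewrite ler_wpM2l ?exprn_ge0// exp_term_le.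
  rewrite -[leLHS]mulrA.
  apply: le_trans (ler_pM _ _ (ler_pM _ _ (hA k) (cmod_cexp_dsym k z)) h1) _;
    rewrite ?mulr_ge0 ?cmod_ge0 ?exprn_ge0 ?invr_ge0 ?(ltW f0)//.
  rewrite /gw -/y le_eqVlt; apply/orP; left; apply/eqP.
  have -> : 2 * pi * (y + t) * `|k|%:R = 2 * pi * y * `|k|%:R + q * t.
    by rewrite /q; ring.
  by rewrite expRN expRD; field; rewrite !gt_eqF ?expR_gt0//.
exists (fun n => csum (pairing (b n))), t%:C%C; split; first by rewrite ltcR.
move=> h; rewrite cmodE ltcR => ht.
have h0 : 0 <= cmod h := cmod_ge0 h.
pose r := cmod h / t.
have r0 : 0 <= r by apply: divr_ge0 => //; exact: ltW.
have r1 : r < 1 by rewrite ltr_pdivrMr// mul1r.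
pose B n k := b n k * h ^+ n.
have Bbd n k : cmod (B n k) <= r ^+ n * (A * qw R k).
  by rewrite /B cmodM cmodX; apply: bbd => //; exact: ltW.
have hz := csum_pairing r0 r1 A0 Bbd.
have bq n : qbd (b n) (A * (t^-1) ^+ n).
  move=> k; have := bbd n k t (ltW t0) (lexx t).
  rewrite divff ?gt_eqF// expr1n mul1r => hb.
  by rewrite exprVn mulrAC (ler_pdivlMr _ _ (exprn_gt0 n t0)).
have e1 : (fun n => csum (pairing (B n))) =
    (fun n => csum (pairing (b n)) * h ^+ n).
  apply/funext => n; have := bq n => /(synth_hassum 0)[hs _].
  rewrite mulrC; apply: hassum_csum.
  have := hassumZ (h ^+ n) hs; rewrite /synth.
  rewrite (_ : pairing (fun k => b n k * char k 0) = pairing (b n)); last first.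
    by apply/funext => -[|m] /=; rewrite !char_0 !mulr1.
  by congr (hassum _ _); apply/funext => -[|m] /=; rewrite /B; ring.
have e2 : (fun k => csum (fun n => B n k)) =
    (fun k => c k * cexp (dsym R k * (z + h))).
  apply/funext => k; apply: hassum_csum; rewrite mulrDr cexpD mulrA.
  have := hassumZ (c k * cexp (dsym R k * z)) (cexp_hassum (dsym R k * h)).
  congr hassum; apply/funext => n; rewrite /B /b /cexp_term exprMn; ring.
by move: hz; rewrite e1 e2 => -[].
Qed.

(** ** From the unit interval to the line *)

(** Lebesgue measure is determined by its values on intervals, and these are
    invariant by translation. *)
Lemma negligible_translate (N : set R) (a : R) :
  lebesgue_measure.-negligible N ->
  lebesgue_measure.-negligible [set x : R | N (x + a)].
Proof.
move=> [B [mB B0 NB]].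
have mt : measurable_fun setT (fun x : measurableTypeR R => (x + a : measurableTypeR R)).
  by apply: continuous_measurable_fun => x; apply: cvgD; [exact: cvg_id|exact: cvg_cst].
pose nu := measure_function_pushforward__canonical__measure_function_Measure
  lebesgue_measure mt.
have e (u v : R) : (fun x => x + a) @^-1` `]u, v]%classic = `]u - a, v - a]%classic.
  by apply/seteqP; split => x /=; rewrite !in_itv /= ltrBlDr lerBrDr.
have nuE : forall A, measurable A -> lebesgue_measure A = nu A.
  apply: lebesgue_measure_unique => X [[u v] _ <-].
  rewrite /= /pushforward e !lebesgue_measure_itv /= !lte_fin ltrD2r.
  by case: ifP => // _; rewrite -!EFinB; congr (_%:E); ring.
exists ((fun x => x + a) @^-1` B); split.
- by have := mt measurableT B mB; rewrite setTI.
- by have := nuE B mB; rewrite B0 => ->.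
- by move=> x /=; exact: NB.
Qed.

(** The exceptional set is a countable union of translates of the exceptional
    set of the unit interval. *)
Lemma periodic_ae (T : Type) (f g : R -> T) : periodic1 f -> periodic1 g ->
  {ae lebesgue_measure, forall x, 0 < x < 1 -> f x = g x} ->
  {ae @lebesgue_measure R, forall x, f x = g x}.
Proof.
move=> pf pg h.
pose N := [set x | 0 <= x < 1 /\ f x <> g x].
have n01 : lebesgue_measure.-negligible N.
  have h1 : lebesgue_measure.-negligible [set 0 : R].
    by exists [set 0]; split => //; rewrite lebesgue_measure_set1.
  apply: negligibleS (negligibleU h1 h) => x [/andP[x0 x1] fg] /=.
  have [->|xn0] := eqVneq x 0; [by left|right] => hx; apply: fg; apply: hx.
  by rewrite lt_neqAle eq_sym xn0 x0.
have nN (m : int) : lebesgue_measure.-negligible [set x : R | N (x + m%:~R)].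
  exact: negligible_translate.
have nU : lebesgue_measure.-negligible
    (\bigcup_n [set x : R | N (x + n%:R)] `|` \bigcup_n [set x : R | N (x - n%:R)]).
  apply: negligibleU; apply: negligible_bigcup => n; first exact: (nN n).
  by have := nN (- n%:Z); rewrite mulrNz.
apply: negligibleS nU => x /= fg.
have /andP[h1 h2] := floor_itv x.
have : N (x + (- Num.floor x)%:~R).
  split; last by rewrite (periodic1_int pf) (periodic1_int pg).
  by rewrite mulrNz subr_ge0 h1 /= ltrBlDl -[1]/(1%:~R) -intrD.
case: (- Num.floor x) => n hN; first by left; exists n.
by right; exists n.+1 => //=; move: hN; rewrite NegzE mulrNz.
Qed.

(** Up to the sign, the imaginary part of the series is that of the difference
    with [phi], all of whose Fourier coefficients vanish. *)
Lemma synth_real (phi : R -> R) A : intC (cplx phi) ->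
  qbd (fourier (cplx phi)) A ->
  forall x, complex.Im (synth (fourier (cplx phi)) x) = 0.
Proof.
move=> iphi q; have cs := contC_synth q.
pose f x := cplx phi x - synth (fourier (cplx phi)) x.
have hf : intC f by exact: intCB iphi (contC_intC cs).
have f0 k : fourier f k = 0.
  by rewrite (fourierB k iphi (contC_intC cs)) (fourier_synth k q) subrr.
have [_ h2] := hf.
have i0 a b (a0 : 0 < a) (ab : a < b) (b1 : b < 1) :=
  (fourier0_interval hf f0 a0 ab b1).2.
have ef : (fun x => complex.Im (f x)) =
    (fun x => - complex.Im (synth (fourier (cplx phi)) x)).
  by apply/funext => x; rewrite /f cImB sub0r.
have cIm : continuous (fun x => complex.Im (f x)).
  by rewrite ef => x; apply: cvgN; exact: (contC_Im cs).
have im0 x : 0 < x < 1 -> complex.Im (synth (fourier (cplx phi)) x) = 0.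
  move=> x01; have := interval0_continuous h2 i0 cIm x01.
  by rewrite (congr1 (fun g => g x) ef) => /eqP; rewrite oppr_eq0 => /eqP.
pose g x : R[i] := ((complex.Im (synth (fourier (cplx phi)) x))%:C)%C.
have : forall x, g x = 0.
  apply: periodic_contC0 => [x||x x01]; last by rewrite /g im0.
    by rewrite /g synth_periodic.
  by apply: contC_ReIm => x /=; [exact: (contC_Im cs)|exact: cst_continuous].
by move=> h x; have := h x => -[].
Qed.

(** A class is represented by its Fourier series, continued by [strip_ext]. *)
Lemma G_sub_A_pos d s : 0 < d -> 0 <= s -> G_sub_A d s.
Proof.
move=> d0 s0 phi [L2phi hG].
have iphi := L2_intC L2phi.
have [pphi _ _] := L2phi.
pose c := fourier (cplx phi).
have hB : (Gnorm d s (cplx phi) <= (fine (Gnorm d s (cplx phi)))%:E)%E.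
  by rewrite fineK// ge0_fin_numE// Gnorm_ge0.
have [A hA] := decay_fourier_slack d0 s0 hB.
have q : qbd c A := decay_qbd (lexx 0) hA.
have cs := contC_synth q.
have re0 : forall x, complex.Im (synth c x) = 0 := synth_real iphi q.
exists (fun x => complex.Re (synth c x)).
  split; first by move=> x; rewrite synth_periodic.
  exists (strip_ext c); split.
    apply: strip_ext_analytic => e ed.
    exact: decay_fourier_slack ed s0 hB.
  move=> x; rewrite strip_ext_real; apply: complex_eq => //=.
apply: periodic_ae => [x|x|]; [by have [] := pphi x|by rewrite synth_periodic|].
have hf : intC (fun x => cplx phi x - synth c x) by exact: intCB iphi (contC_intC cs).
have f0 k : fourier (fun x => cplx phi x - synth c x) k = 0.
  by rewrite (fourierB k iphi (contC_intC cs)) (fourier_synth k q) subrr.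
have := fourier0_ae hf f0.
apply: filterS; first exact: (ae_filter_ringOfSetsType lebesgue_measure).
by move=> x h /h /eqP; rewrite subr_eq0 => /eqP <-.
Qed.

Lemma analytic_G (u : R -> R) : periodic1 u -> analytic_on [set: R] u ->
  exists d, 0 < d /\ forall s, G d s u.
Proof.
move=> pu au; have [e e0 [A hA]] := analytic_fourier au pu.
exists (e / 2); split; first by rewrite divr_gt0.
move=> s; rewrite /G.
have q := decay_qbd (ltW e0) hA.
have pc : periodic1 (cplx u) by move=> x; rewrite /cplx pu.
rewrite -(synth_fourier pc (contC_analytic au) q).
apply: GC_synth hA; first by rewrite divr_ge0// ltW.
by lra.
Qed.

End Strip.

(** * The equation in Fourier coefficients *)

Section Equation.
Variable R : realType.
Implicit Types (f g : R -> R[i]) (b c : int -> R[i]) (k : int) (x d e A B : R).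

(** The Fourier symbol of the operator [A^-1]. *)
Definition asym k : R[i] :=
  if k == 0 then 1 else (((2 * pi * k%:~R : R) ^+ 2)%:C%C)^-1.

Lemma cmod_asym k : cmod (asym k) <= 1.
Proof.
rewrite /asym; case: eqVneq => [_|k0]; first by rewrite cmod1.
have h1 : 1 <= `|k|%:~R :> R by rewrite ler1z; lia.
have h2 : 1 <= 2 * pi :> R by have := pi_ge2 R; lra.
have h : 1 <= (2 * pi * k%:~R : R) ^+ 2.
  rewrite -real_normK ?num_real// normrM -intr_norm exprn_ege1//.
  rewrite ger0_norm; last by apply: le_trans h2.
  by rewrite -[X in X <= _]mulr1 ler_pM.
by rewrite cmodV cmod_real ger0_norm ?sqr_ge0// invf_le1// (lt_le_trans ltr01 h).
Qed.

(** The bilinear form of the equation, before the derivative is applied: the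
    Fourier coefficients of [b c / 2 + A^-1 (3 mu(b) c)]. *)
Definition bil b c k : R[i] :=
  2^-1 * fourier (fun x => synth b x * synth c x) k + 3 * b 0 * asym k * c k.

Lemma decay_le c d e A B : decay c d A -> A <= B -> e <= d -> decay c e B.
Proof.
move=> h AB ed k; apply: le_trans (h k) _.
by rewrite ler_pM ?(decay_ge0 h) ?gw_ge0// gw_anti.
Qed.

Lemma decayD b c d A B : decay b d A -> decay c d B ->
  decay (fun k => b k + c k) d (A + B).
Proof. by move=> h1 h2 k; rewrite mulrDl (le_trans (cmodD _ _))// lerD. Qed.

Lemma decayB b c d A B : decay b d A -> decay c d B ->
  decay (fun k => b k - c k) d (A + B).
Proof. by move=> h1 h2 k; rewrite mulrDl (le_trans (cmodB _ _))// lerD. Qed.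

Lemma decayZ (a : R[i]) c d A : decay c d A ->
  decay (fun k => a * c k) d (cmod a * A).
Proof. by move=> h k; rewrite cmodM -mulrA ler_wpM2l// cmod_ge0. Qed.

Lemma gw00 d : gw d 0 = 1 :> R.
Proof. by rewrite /gw mulr0 oppr0 expR0 mulr1 /qw /qnat sqrtr1 mulr1 invr1. Qed.

(** The constant is [72 / 2 + 3]; it does not depend on the width. *)
Lemma decay_bil b c d A B : 0 <= d -> decay b d A -> decay c d B ->
  decay (bil b c) d (39 * (A * B)).
Proof.
move=> d0 hb hc.
have h1 := decayZ 2^-1 (decay_conv d0 hb hc).
have h2 : decay (fun k => 3 * b 0 * asym k * c k) d (3 * A * B).
  move=> k; rewrite -[3 * A * B * _]mulrA cmodM ler_pM ?cmod_ge0//.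
  rewrite 2!cmodM cmod_nat -[leRHS]mulr1 ler_pM ?mulr_ge0 ?cmod_ge0 ?cmod_asym//.
  by rewrite ler_wpM2l//; have := hb 0; rewrite gw00 mulr1.
apply: decay_le (decayD h1 h2) _ (lexx _).
by rewrite cmodV cmod_nat le_eqVlt; apply/orP; left; apply/eqP; field.
Qed.

Lemma decay_deriv c d e A : 0 < e -> decay c (d + e) A ->
  decay (fun k => dsym R k * c k) d (A / e).
Proof.
move=> e0 h k; rewrite cmodM cmod_dsym -[A / e * _]mulrA.
apply: (le_trans (ler_wpM2l _ (h k))); first by rewrite !mulr_ge0 ?pi_ge0.
by rewrite mulrCA ler_wpM2l ?(decay_ge0 h)// gw_deriv.
Qed.

Lemma cderiv_decay c d A : 0 < d -> decay c d A ->
  cderiv (synth c) (synth (fun k => dsym R k * c k)).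
Proof.
move=> d0 h; have d2 : 0 < d / 2 by rewrite divr_gt0.
have e : d = 0 + d / 2 + d / 2 by field.
rewrite e in h; have h1 := decay_deriv d2 h; have h2 := decay_deriv d2 h1.
have q : qbd c A by apply: decay_qbd h; rewrite add0r addr_ge0// ltW.
apply: (cderiv_synth q (B := A / (d / 2) / (d / 2))) => k.
by have := decay_qbd (lexx 0) h2 k; rewrite expr2 mulrA.
Qed.

Lemma qbd_deriv c d A : 0 < d -> decay c d A ->
  qbd (fun k => dsym R k * c k) (A / d).
Proof.
move=> d0 h; apply: (decay_qbd (lexx 0)); apply: decay_deriv => //.
by rewrite add0r.
Qed.

Lemma Ainv_synth g B : qbd (fourier g) B ->
  Ainv g = synth (fun k => asym k * fourier g k).
Proof.
move=> q; apply/funext => x.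
have q' : qbd (fun k => asym k * fourier g k) B.
  move=> k; apply: le_trans (q k); rewrite cmodM ler_piMl ?cmod_ge0//.
  exact: cmod_asym.
have [[h] _] := synth_hassum x q'.
rewrite /Ainv; set p := pairing _ in h.
have p0 : p 0%N = fourier g 0 by rewrite /p /= char0 /asym eqxx mul1r mulr1.
set L := (X in _ + X = _).
suff -> : L = synth (fun k => asym k * fourier g k) x - p 0%N by rewrite p0 addrC subrK.
apply/(cvg_lim (@norm_hausdorff _ R[i]^o)).
have h2 : ((series p n - p 0%N : R[i]^o) @[n --> \oo] -->
    (synth (fun k => asym k * fourier g k) x - p 0%N : R[i]^o)).
  exact: (@cvgB _ R[i]^o _ _ _ (series p) (fun=> p 0%N) _ _ h (cvg_cst _)).
apply: cvg_trans h2; apply: near_eq_cvg; exists 1%N => // -[//|n] _ /=.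
rewrite /series /= big_nat_recl//= addrAC subrr add0r big_add1 /=.
apply: eq_big_nat => i _.
have ai j : j != 0 -> asym j * fourier g j * char j x =
    fourier g j / ((2 * pi * j%:~R) ^+ 2)%:C%C * expi (2 * pi * j%:~R * x).
  by move=> j0; rewrite /asym (negPf j0) /char mulrC [_ * fourier g j]mulrC mulrC.
by rewrite /p /= !ai.
Qed.

(** As [u u_x] is the derivative of [u ^ 2 / 2], the whole nonlinearity is the
    derivative of the quadratic operator [bil], which is bounded at fixed width:
    only the derivative loses width. *)
Lemma equation_fourier f d A : 0 < d -> periodic1 f -> contC f ->
  decay (fourier f) d A ->
  (fun x => f x * dx f x + dx (Ainv (fun y => 3 * mean f * f y)) x) =
  synth (fun k => dsym R k * bil (fourier f) (fourier f) k).
Proof.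
move=> d0 pf cf h; set c := fourier f.
have q : qbd c A := decay_qbd (ltW d0) h.
have fc : synth c = f := synth_fourier pf cf q.
have df := cderiv_decay d0 h; rewrite -/c in df.
have hs := decay_conv (ltW d0) h h; rewrite -/c in hs.
have qs := decay_qbd (ltW d0) hs.
have cff : contC (fun x => synth c x * synth c x).
  by have cs := contC_synth q; exact: (contCM cs cs).
have pff : periodic1 (fun x => synth c x * synth c x).
  by move=> x; rewrite synth_periodic.
have ffc := synth_fourier pff cff qs.
have dff := cderiv_decay d0 hs; rewrite ffc in dff.
have e1 := cderiv_unique dff (cderivM df df).
pose g x := 3 * mean f * f x.
have fg k : fourier g k = 3 * c 0 * c k.
  by rewrite (fourierZ _ k (contC_intC cf)) mean_fourier0.
have hg : decay (fun k => 3 * c 0 * asym k * c k) d (3 * A * A).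
  move=> k; rewrite -[3 * A * A * _]mulrA cmodM ler_pM ?cmod_ge0//.
  rewrite 2!cmodM cmod_nat -[leRHS]mulr1 ler_pM ?mulr_ge0 ?cmod_ge0 ?cmod_asym//.
  by rewrite ler_wpM2l//; have := h 0; rewrite gw00 mulr1.
have qg : qbd (fourier g) (cmod (3 * c 0) * A).
  by move=> k; rewrite fg; exact: (qbdZ (3 * c 0) q).
have dA := cderiv_decay d0 hg.
rewrite -/g (Ainv_synth qg).
have -> : (fun k => asym k * fourier g k) = (fun k => 3 * c 0 * asym k * c k).
  by apply/funext => k; rewrite fg; ring.
rewrite (cderiv_dx dA) -fc (cderiv_dx df) fc.
apply/funext => x.
have qd1 := qbd_deriv d0 hs; have qd2 := qbd_deriv d0 hg.
have -> : (fun k => dsym R k * bil c c k) = (fun k =>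
    2^-1 * (dsym R k * fourier (fun x => synth c x * synth c x) k) +
    dsym R k * (3 * c 0 * asym k * c k)).
  by apply/funext => k; rewrite /bil; ring.
have E1 := synthD x (qbdZ 2^-1 qd1) qd2.
have E2 := synthZ 2^-1 x qd1.
have E3 : f x * synth (fun k => dsym R k * c k) x = 2^-1 *
    synth (fun k => dsym R k * fourier (fun x => synth c x * synth c x) k) x.
  by rewrite (congr1 (fun u => u x) e1) fc; field.
by rewrite E1 E2 E3.
Qed.

End Equation.

(** * Power series in time *)

Section ComplexTime.
Variable R : realType.
Implicit Types (h t : R[i]).

(** The filter is defined by complex radii, which are compared here with real
    ones. *)
Lemma dnbhs_cmodP (P : R[i] -> Prop) :
  (\forall h \near (0 : R[i]^o)^', P h) <->
  exists2 e : R, 0 < e & forall h, h != 0 -> cmod h < e -> P h.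
Proof.
split.
  rewrite /dnbhs /= => /nbhs_ballP[e /= e0 he].
  have e0' : 0 < complex.Re e by move: e0; rewrite ltcE => /andP[].
  exists (complex.Re e) => // h h0 hh; apply: he => //=.
  rewrite /ball /= sub0r normrN.
  rewrite -(RRe_real (ger0_real (ltW e0))).
  by change (`|h : R[i]| < (complex.Re e)%:C%C); rewrite cmodE ltcR.
move=> [e e0 he]; rewrite /dnbhs /=; apply/nbhs_ballP; exists e%:C%C => /=.
  by rewrite ltcR.
move=> h; rewrite /ball /= sub0r normrN => hh h0; apply: he => //.
have hh' : `|(h : R[i])| < e%:C%C := hh.
by move: hh'; rewrite cmodE ltcR.
Qed.

Lemma dnbhs_GnormP d s (v : R[i] -> R -> R[i]) :
  (Gnorm d s (v h) @[h --> (0 : R[i]^o)^'] --> 0%E) <->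
  (forall e : R, 0 < e -> exists2 eta : R, 0 < eta & forall h, h != 0 ->
     cmod h < eta -> (Gnorm d s (v h) <= e%:E)%E).
Proof.
split=> [/fine_cvgP[F H] e e0|H].
  apply/dnbhs_cmodP; move/cvgrPdist_lt : H => /(_ e e0) H.
  apply: filterS2 F H => h hF; rewrite sub0r normrN /= => hh.
  by rewrite -(fineK hF) lee_fin; apply: ltW; apply: le_lt_trans hh; exact: ler_norm.
apply/fine_cvgP; split.
  apply/dnbhs_cmodP; have [e e0 he] := H 1 ltr01; exists e => // h h0 hh.
  rewrite ge0_fin_numE ?Gnorm_ge0//; exact: le_lt_trans (he h h0 hh) (ltry _).
apply/cvgrPdist_le => e e0; apply/dnbhs_cmodP.
have [eta eta0 he] := H e e0; exists eta => // h h0 hh.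
have := he h h0 hh; have := Gnorm_ge0 d s (v h); rewrite sub0r normrN /=.
by case: (Gnorm d s (v h)) => [r| |] //=; rewrite !lee_fin => r0; rewrite ger0_norm.
Qed.

(** First order Taylor remainder of a power: the inductive bound is itself such
    a remainder, for real arguments. *)
Lemma pow_taylor t h (y : R) n : 0 < y -> cmod h <= y ->
  cmod ((t + h) ^+ n - t ^+ n - n%:R * t ^+ n.-1 * h) <=
  (cmod h / y) ^+ 2 * (cmod t + y) ^+ n.
Proof.
move=> y0 hy; set T := cmod t; have T0 : 0 <= T := cmod_ge0 t.
set r := (cmod h / y) ^+ 2.
have r0 : 0 <= r by rewrite sqr_ge0.
apply: (@le_trans _ _ (r * ((T + y) ^+ n - T ^+ n - n%:R * T ^+ n.-1 * y))); last first.
  rewrite ler_wpM2l// -addrA -opprD gerBl addr_ge0 ?exprn_ge0// !mulr_ge0// ?exprn_ge0//.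
  exact: ltW.
elim: n => [|n IH]; first by rewrite !expr0 !mul0r !subrr ?subr0 cmod0 mulr0.
have e (K : comPzRingType) (a b : K) : (a + b) ^+ n.+1 - a ^+ n.+1 - n.+1%:R * a ^+ n * b =
    (a + b) * ((a + b) ^+ n - a ^+ n - n%:R * a ^+ n.-1 * b) + n%:R * a ^+ n.-1 * b ^+ 2.
  case: n {IH} => [|n]; first by rewrite !expr0 !expr1; ring.
  by rewrite [n.+1.-1]/= -(natr1 n.+1) [a ^+ n.+2]exprS [(a + b) ^+ n.+2]exprS [a ^+ n.+1]exprS; ring.
rewrite [n.+1.-1]/= (e _ t h) (e _ T y); apply: (le_trans (cmodD _ _)).
rewrite [leRHS]mulrDr lerD//.
  rewrite cmodM mulrCA; apply: ler_pM; rewrite ?cmod_ge0//.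
  by apply: (le_trans (cmodD _ _)); rewrite lerD2l.
rewrite (cmodM _ (h ^+ 2)) (cmodM n%:R) cmod_nat !cmodX -/T [leRHS]mulrCA ler_wpM2l ?mulr_ge0 ?exprn_ge0//.
by rewrite /r expr_div_n divfK// expf_neq0// gt_eqF.
Qed.

Lemma pow_deriv_le (T y : R) n : 0 <= T -> 0 < y ->
  n.+1%:R * T ^+ n * y <= (T + y) ^+ n.+1.
Proof.
move=> T0 y0; elim: n => [|n IH]; first by rewrite expr0 expr1 !mul1r lerDr.
rewrite (exprS (T + y)) [leRHS]mulrDl.
apply: (@le_trans _ _ (T * (n.+1%:R * T ^+ n * y) + y * T ^+ n.+1)).
  by rewrite -(natr1 n.+1) exprS le_eqVlt; apply/orP; left; apply/eqP; ring.
rewrite lerD ?ler_wpM2l ?(ltW y0)//.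
by apply: lerXn2r; rewrite ?nnegrE// ?addr_ge0 ?(ltW y0)// lerDl ltW.
Qed.

End ComplexTime.

(** A power series [sum_n t ^ n a_n] in the spaces of Fourier coefficients, which
    converges geometrically in the width [d] for [|t| <= r]. *)
Section PowerSeries.
Variable R : realType.
Variables (a : nat -> int -> R[i]) (r A q d : R).
Hypotheses (r0 : 0 < r) (A0 : 0 <= A) (q0 : 0 <= q) (q1 : q < 1) (d0 : 0 <= d).
Hypothesis ha : forall n k, cmod (a n k) * r ^+ n <= A * gw d k * q ^+ n.
Implicit Types (t h : R[i]) (n : nat) (k : int).

Definition tseries t k : R[i] := csum (fun n => t ^+ n * a n k).

Definition tseries_deriv t k : R[i] := csum (fun n => n.+1%:R * t ^+ n * a n.+1 k).

Let q1' : 0 < 1 - q. Proof. by rewrite subr_gt0. Qed.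

Let sbq k (B : R) : 0 <= B -> sbd (fun n => B * gw d k * q ^+ n) (B / (1 - q) * gw d k).
Proof.
move=> B0; rewrite (_ : _ / _ * _ = B * gw d k / (1 - q)); last by ring.
by apply: sbd_geometric => //; rewrite mulr_ge0 ?gw_ge0.
Qed.

Lemma tseries_term t n k : cmod t <= r -> cmod (t ^+ n * a n k) <= A * gw d k * q ^+ n.
Proof.
move=> tr; apply: le_trans (ha n k); rewrite cmodM cmodX mulrC ler_wpM2l ?cmod_ge0//.
by apply: lerXn2r; rewrite ?nnegrE ?cmod_ge0// ltW.
Qed.

Lemma tseries_hassum t k : cmod t <= r ->
  hassum (fun n => t ^+ n * a n k) (tseries t k).
Proof.
move=> tr; have h n : cmod (t ^+ n * a n k) <= A * gw d k * q ^+ n.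
  exact: tseries_term.
by have [] := sbd_hassum h (sbq k A0).
Qed.

Lemma tseries_decay t : cmod t <= r -> decay (tseries t) d (A / (1 - q)).
Proof.
move=> tr k; have h n : cmod (t ^+ n * a n k) <= A * gw d k * q ^+ n.
  exact: tseries_term.
exact: (hassum_le (tseries_hassum k tr) h (sbq k A0)).
Qed.

Section at_t.
Variable t : R[i].
Hypothesis tr : cmod t < r.

Let y := r - cmod t.
Let y0 : 0 < y. Proof. by rewrite subr_gt0. Qed.
Let ty : cmod t + y = r. Proof. by rewrite addrC subrK. Qed.

Let dterm n k : cmod (n.+1%:R * t ^+ n * a n.+1 k) <= A / y * gw d k * q ^+ n.
Proof.
have h1 := pow_deriv_le n (cmod_ge0 t) y0; rewrite ty in h1.
rewrite 2!cmodM cmodX cmod_nat.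
have -> : A / y * gw d k * q ^+ n = A * gw d k * q ^+ n / y by ring.
rewrite ler_pdivlMr// mulrAC.
apply: (le_trans (ler_wpM2r (cmod_ge0 _) h1)); rewrite mulrC.
apply: (le_trans (ha n.+1 k)); rewrite exprS ler_wpM2l ?(mulr_ge0 A0 (gw_ge0 d k))//.
by rewrite ler_piMl ?exprn_ge0// ltW.
Qed.

Let Ay0 : 0 <= A / y. Proof. by rewrite divr_ge0// ltW. Qed.

Lemma tseries_deriv_hassum k :
  hassum (fun n => n.+1%:R * t ^+ n * a n.+1 k) (tseries_deriv t k).
Proof. by have [] := sbd_hassum (fun n => dterm n k) (sbq k Ay0). Qed.

Lemma tseries_deriv_decay : decay (tseries_deriv t) d (A / y / (1 - q)).
Proof.
by move=> k; exact: (hassum_le (tseries_deriv_hassum k) (fun n => dterm n k) (sbq k Ay0)).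
Qed.

(** In the space of width [d], the first order Taylor remainder is quadratic in
    [h]: termwise, this is [pow_taylor]. *)
Lemma tseries_taylor h k : cmod h <= y ->
  cmod (tseries (t + h) k - tseries t k - h * tseries_deriv t k) <=
  (cmod h / y) ^+ 2 * (A / (1 - q)) * gw d k.
Proof.
move=> hy.
have thr : cmod (t + h) <= r by rewrite -ty (le_trans (cmodD _ _))// lerD2l.
have h3 : hassum (fun n => n%:R * t ^+ n.-1 * a n k) (tseries_deriv t k).
  have := @hassum_unshift R (fun n => n%:R * t ^+ n.-1 * a n k) 1 (tseries_deriv t k).
  rewrite big_nat1 !mul0r add0r; apply.
  have := tseries_deriv_hassum k; congr hassum; apply/funext => n.
  by rewrite addn1.
have := hassumB (hassumB (tseries_hassum k thr) (tseries_hassum k (ltW tr)))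
  (hassumZ h h3).
set C := (cmod h / y) ^+ 2; have C0 : 0 <= C by rewrite sqr_ge0.
move=> /hassum_le; have CA0 : 0 <= C * A by rewrite mulr_ge0.
have -> : C * (A / (1 - q)) * gw d k = C * A / (1 - q) * gw d k by ring.
apply; last exact: sbq CA0.
move=> n; rewrite (_ : _ - _ - _ =
  ((t + h) ^+ n - t ^+ n - n%:R * t ^+ n.-1 * h) * a n k); last by ring.
rewrite cmodM; apply: (le_trans (ler_wpM2r (cmod_ge0 _) (pow_taylor t n y0 hy))).
rewrite ty -/C -!(mulrA C) ler_wpM2l// mulrC; exact: ha.
Qed.

Lemma tseries_is_tderiv e s : 0 <= e -> e < d ->
  is_tderiv e s (fun t => synth (tseries t)) t (synth (tseries_deriv t)).
Proof.
move=> e0 ed; split; first exact: GC_synth e0 ed tseries_deriv_decay.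
have [K K0 hK] := Gnorm_decay s ed.
pose C := K * (A / (1 - q) / y ^+ 2).
have C0 : 0 <= C.
  by rewrite mulr_ge0 ?(ltW K0)// divr_ge0 ?sqr_ge0// divr_ge0// ltW.
apply/dnbhs_GnormP => eps eps0.
have e1 : 0 < eps / (C + 1) by rewrite divr_gt0// ltr_wpDl.
exists (Num.min y (eps / (C + 1))); first by rewrite lt_min y0.
move=> h h0; rewrite lt_min => /andP[/ltW hy he].
have hc : 0 < cmod h.
  by rewrite lt_neqAle cmod_ge0 andbT eq_sym; apply/eqP => /cmod_eq0/eqP; rewrite (negPf h0).
have thr : cmod (t + h) <= r by rewrite -ty (le_trans (cmodD _ _))// lerD2l.
pose b k := h^-1 * (tseries (t + h) k - tseries t k) - tseries_deriv t k.
have hb : decay b d (cmod h * (A / (1 - q) / y ^+ 2)).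
  move=> k; have -> : b k = h^-1 * (tseries (t + h) k - tseries t k -
      h * tseries_deriv t k) by rewrite /b; field.
  rewrite cmodM cmodV ler_pdivrMl//.
  apply: (le_trans (tseries_taylor k hy)).
  by rewrite le_eqVlt; apply/orP; left; apply/eqP; field; rewrite !gt_eqF.
have -> : (fun x => h^-1 * (synth (tseries (t + h)) x - synth (tseries t) x) -
    synth (tseries_deriv t) x) = synth b.
  apply/funext => x.
  have q2 := decay_qbd d0 (tseries_decay thr).
  have q3 := decay_qbd d0 (tseries_decay (ltW tr)).
  have q4 := decay_qbd d0 tseries_deriv_decay.
  have E1 := synthB x q2 q3; have E2 := synthZ h^-1 x (qbdB q2 q3).
  have E3 := synthB x (qbdZ h^-1 (qbdB q2 q3)) q4.
  by rewrite /b E3 E2 E1.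
have qb := decay_qbd d0 hb.
apply: (le_trans (hK (synth b) _ _)).
  by move=> k; rewrite (fourier_synth k qb); exact: hb.
rewrite lee_fin mulrCA -/C.
apply: (@le_trans _ _ (eps / (C + 1) * C)); first by rewrite ler_wpM2r// ltW.
by rewrite mulrAC ler_pdivrMr ?ltr_wpDl// ler_pM2l// lerDl.
Qed.

Let natM_geometric (u : R) n : 0 <= u -> u < 1 -> n.+1%:R * u ^+ n <= (1 - u)^-1.
Proof.
move=> u0 u1; rewrite -[leRHS]mul1r.
apply: le_trans (sbd_geometric u0 u1 ler01 n.+1).
rewrite mulr_natl -[X in _ *+ X]subn0 -sumr_const_nat; apply: ler_sum_nat => i /andP[_ ni].
by rewrite mul1r; apply: ler_wiXn2l => //; exact: ltW.
Qed.

(** The squares of functions are Cauchy products at each point of space, where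
    the functions are values of power series; the coefficients of the resulting
    series of functions are then read off by uniqueness. *)
Lemma bil_tseries k :
  hassum (fun n => t ^+ n * \sum_(i < n.+1) bil (a i) (a (n - i)%N) k)
         (bil (tseries t) (tseries t) k).
Proof.
have tl := ltW tr.
(* The [n + 1] terms of a Cauchy product are of size [q ^ n = w ^ n * w ^ n]; one
   of the factors [w ^ n] absorbs their number. *)
pose w : R := Num.sqrt q.
have w0 : 0 <= w by exact: sqrtr_ge0.
have w1 : w < 1 by rewrite -(sqrtr1 R) ltr_sqrt.
have wq : q = w * w by rewrite -expr2 sqr_sqrtr.
pose b n j : R[i] := t ^+ n * a n j.
have hbA n : decay (b n) d (A * q ^+ n).
  by move=> j; rewrite mulrAC; exact: tseries_term.
have qb n := decay_qbd d0 (hbA n).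
pose P n j : R[i] := \sum_(i < n.+1) fourier (fun x => synth (b i) x * synth (b (n - i)%N) x) j.
have hPi n (i : 'I_n.+1) : qbd (fourier (fun x => synth (b i) x * synth (b (n - i)%N) x))
    (72 * A ^+ 2 * q ^+ n).
  have := decay_qbd d0 (decay_conv d0 (hbA i) (hbA (n - i)%N)).
  congr qbd; rewrite mulrACA -exprD subnKC ?mulrA//.
  by rewrite -ltnS.
have hP n j : cmod (P n j) <= w ^+ n * (72 * A ^+ 2 / (1 - w) * qw R j).
  apply: (le_trans (cmod_sum _ _ _)).
  apply: (@le_trans _ _ (\sum_(i < n.+1) (72 * A ^+ 2 * q ^+ n * qw R j))).
    by apply: ler_sum => i _; exact: hPi.
  rewrite sumr_const card_ord -[leLHS]mulr_natl wq exprMn.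
  rewrite (_ : n.+1%:R * _ = (n.+1%:R * w ^+ n) * (72 * A ^+ 2 * w ^+ n * qw R j)); last by ring.
  rewrite (_ : w ^+ n * _ = (1 - w)^-1 * (72 * A ^+ 2 * w ^+ n * qw R j)); last by ring.
  by rewrite ler_wpM2r ?natM_geometric// !mulr_ge0 ?qw_ge0 ?sqr_ge0 ?exprn_ge0.
have A2 : 0 <= 72 * A ^+ 2 / (1 - w).
  by rewrite divr_ge0 ?mulr_ge0 ?sqr_ge0// subr_ge0 ltW.
have hPk j : hassum (fun n => P n j) (csum (fun n => P n j)) /\
    cmod (csum (fun n => P n j)) <= 72 * A ^+ 2 / (1 - w) / (1 - w) * qw R j.
  have sb := sbd_geometric w0 w1 (mulr_ge0 A2 (qw_ge0 R j)).
  have hP' n : cmod (P n j) <= 72 * A ^+ 2 / (1 - w) * qw R j * w ^+ n.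
    by rewrite mulrC; exact: hP.
  have := sbd_hassum hP' sb.
  by rewrite mulrAC.
have Pfun n x : synth (P n) x =
    \sum_(i < n.+1) synth (b i) x * synth (b (n - i)%N) x.
  have hs (s : seq 'I_n.+1) : synth (fun j => \sum_(i <- s)
      fourier (fun x => synth (b i) x * synth (b (n - i)%N) x) j) x =
      \sum_(i <- s) synth (b i) x * synth (b (n - i)%N) x /\
      exists B, qbd (fun j => \sum_(i <- s)
        fourier (fun x => synth (b i) x * synth (b (n - i)%N) x) j) B.
    elim: s => [|i s [IH [B hB]]].
      have z0 : (fun j : int => \sum_(i <- @nil 'I_n.+1)
          fourier (fun x => synth (b i) x * synth (b (n - i)%N) x) j) = fun=> 0.
        by apply/funext => j; rewrite big_nil.
      rewrite z0 big_nil; split; last by exists 0 => j; rewrite cmod0 mul0r.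
      apply: hassum_csum; have := hassum0 R; congr hassum.
      by apply/funext => -[|m] /=; rewrite ?mul0r ?addr0.
    have z1 : (fun j : int => \sum_(i <- i :: s)
        fourier (fun x => synth (b i) x * synth (b (n - i)%N) x) j) = (fun j =>
        fourier (fun x => synth (b i) x * synth (b (n - i)%N) x) j +
        \sum_(i <- s) fourier (fun x => synth (b i) x * synth (b (n - i)%N) x) j).
      by apply/funext => j; rewrite big_cons.
    rewrite z1 big_cons; split; last by eexists; exact: (qbdD (hPi n i) hB).
    have E := synthD x (hPi n i) hB; rewrite E IH; congr (_ + _).
    have c1 := contC_synth (qb i); have c2 := contC_synth (qb (n - i)%N).
    have := @synth_fourier R (fun x => synth (b i) x * synth (b (n - i)%N) x) _ _ _ (hPi n i).
    move=> ->//; last exact: (contCM c1 c2).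
    by move=> z; rewrite !synth_periodic.
  by have [] := hs (index_enum 'I_n.+1).
have sq x : hassum (fun n => synth (P n) x) (synth (tseries t) x * synth (tseries t) x).
  have hbx n j : cmod (b n j * char j x) <= q ^+ n * (A * qw R j).
    by rewrite cmodM cmod_char mulr1 mulrC mulrAC; exact: qb.
  have hx := csum_pairing q0 q1 A0 hbx.
  have ex : synth (tseries t) x = csum (fun n => synth (b n) x).
    apply/esym/hassum_csum; move: hx; congr hassum; congr csum; congr pairing.
    apply/funext => j; apply: hassum_csum.
    have := hassumZ (char j x) (tseries_hassum j tl).
    by rewrite mulrC; congr hassum; apply/funext => n; rewrite mulrC.
  have hn n : cmod (synth (b n) x) <= 12 * A * q ^+ n.
    by rewrite -mulrA; exact: (synth_hassum x (qb n)).2.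
  rewrite ex; have := cauchy_product q0 q1 hn hn.
  by congr hassum; apply/funext => n; rewrite Pfun.
have hQ : qbd (fun j => csum (fun n => P n j)) (72 * A ^+ 2 / (1 - w) / (1 - w)).
  by move=> j; exact: (hPk j).2.
have sqQ : (fun x => synth (tseries t) x * synth (tseries t) x) =
    synth (fun j => csum (fun n => P n j)).
  apply/funext => x.
  have hPx n j : cmod (P n j * char j x) <= w ^+ n * (72 * A ^+ 2 / (1 - w) * qw R j).
    by rewrite cmodM cmod_char mulr1; exact: hP.
  have hx := csum_pairing w0 w1 A2 hPx.
  rewrite -(hassum_csum (sq x)) (hassum_csum hx) /synth; congr csum; congr pairing.
  apply/funext => j; apply: hassum_csum.
  have := hassumZ (char j x) (hPk j).1.
  by rewrite mulrC; congr hassum; apply/funext => n; rewrite mulrC.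
have E1 : hassum (fun n => P n k)
    (fourier (fun x => synth (tseries t) x * synth (tseries t) x) k).
  by rewrite sqQ (fourier_synth k hQ); exact: (hPk k).1.
have bk j n : cmod (b n j) <= A * qw R j * q ^+ n by rewrite mulrAC; exact: qb.
have E2 : hassum (fun n => \sum_(i < n.+1) b i 0 * b (n - i)%N k)
    (tseries t 0 * tseries t k) := cauchy_product q0 q1 (bk 0) (bk k).
have := hassumD (hassumZ 2^-1 E1) (hassumZ (3 * asym R k) E2).
rewrite /bil; rewrite (_ : 3 * asym R k * _ = 3 * tseries t 0 * asym R k * tseries t k); last by ring.
congr hassum; apply/funext => n; rewrite !mulr_sumr -big_split /=.
apply: eq_bigr => i _; have ni : (i <= n)%N by rewrite -ltnS.
have tt : t ^+ n = t ^+ i * t ^+ (n - i) by rewrite -exprD subnKC.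
have fb : fourier (fun x => synth (b i) x * synth (b (n - i)%N) x) k =
    t ^+ n * fourier (fun x => synth (a i) x * synth (a (n - i)%N) x) k.
  have qa m : qbd (a m) (A * q ^+ m / r ^+ m).
    move=> j; rewrite mulrAC ler_pdivlMr ?exprn_gt0//.
    apply: (le_trans (ha m j)); rewrite mulrAC ler_wpM2l ?mulr_ge0 ?exprn_ge0//.
    exact: gw_le_qw.
  have c1 := contC_synth (qa i); have c2 := contC_synth (qa (n - i)%N).
  rewrite -(fourierZ (t ^+ n) k (contC_intC (contCM c1 c2))).
  congr fourier; apply/funext => x.
  have z1 := synthZ (t ^+ i) x (qa i); have z2 := synthZ (t ^+ (n - i)) x (qa (n - i)%N).
  by rewrite /b z1 z2 tt; ring.
by rewrite fb /b tt; ring.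
Qed.

Lemma tseries_equation k :
  (forall n k, n.+1%:R * a n.+1 k =
     - (dsym R k * \sum_(i < n.+1) bil (a i) (a (n - i)%N) k)) ->
  tseries_deriv t k = - (dsym R k * bil (tseries t) (tseries t) k).
Proof.
move=> rec; have := hassumZ (- dsym R k) (bil_tseries k); rewrite mulNr => h.
apply: hassum_csum; move: h; congr hassum; apply/funext => n.
by rewrite mulrAC rec; ring.
Qed.

End at_t.

End PowerSeries.

(** * Existence *)

Section Coefficients.
Variable R : realType.
Variable a0 : int -> R[i].
Implicit Types (n m : nat) (k : int) (x : R).

(** [history n m] is the coefficient of order [min m n]; each stage keeps the
    earlier ones, since the recursion refers to all of them. *)
Fixpoint history n : nat -> int -> R[i] :=
  if n is n'.+1 then fun m =>
    if (m <= n')%N then history n' m else fun k =>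
      - (n'.+1%:R^-1 * (dsym R k *
          \sum_(i < n'.+1) bil (history n' i) (history n' (n' - i)%N) k))
  else fun=> a0.

Definition coef n := history n n.

Lemma history_coef n m : (m <= n)%N -> history n m = coef m.
Proof.
elim: n => [|n IH]; first by rewrite leqn0 => /eqP->.
rewrite leq_eqVlt ltnS => /orP[/eqP->//|mn] /=.
by rewrite mn IH.
Qed.

Lemma coef0 : coef 0 = a0. Proof. by []. Qed.

Lemma coefS n k : coef n.+1 k = - (n.+1%:R^-1 * (dsym R k *
  \sum_(i < n.+1) bil (coef i) (coef (n - i)%N) k)).
Proof.
rewrite {1}/coef /= ltnn; congr (- (_ * (_ * _))); apply: eq_bigr => i _.
by rewrite !history_coef ?leq_subr// -ltnS.
Qed.

Lemma coef_rec n k : n.+1%:R * coef n.+1 k =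
  - (dsym R k * \sum_(i < n.+1) bil (coef i) (coef (n - i)%N) k).
Proof. by rewrite coefS mulrN mulVKf// pnatr_eq0. Qed.

Lemma sum_inv_sqr n : \sum_(i < n) (i.+1%:R ^+ 2 : R)^-1 <= 2.
Proof.
case: n => [|n]; first by rewrite big_ord0.
suff : \sum_(i < n.+1) (i.+1%:R ^+ 2 : R)^-1 <= 2 - n.+1%:R^-1.
  by move=> h; apply: (le_trans h); rewrite gerBl invr_ge0.
elim: n => [|n IH]; first by rewrite big_ord1 expr1n invr1; lra.
rewrite big_ord_recr /=; apply: (le_trans (lerD IH (lexx _))).
have n0 : 0 < n.+1%:R :> R by [].
have -> : n.+2%:R = n.+1%:R + 1 :> R by rewrite natr1.
move: (n.+1%:R : R) n0 => x x0; rewrite -subr_ge0.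
rewrite (_ : _ - _ = (x * (x + 1) ^+ 2)^-1).
  by rewrite invr_ge0 mulr_ge0 ?sqr_ge0// ltW.
by field; rewrite !gt_eqF ?addr_gt0.
Qed.

(** Partial fractions reduce the convolution of [1 / n ^ 2] with itself to the
    convergent sum of these inverses: this is why the factor [(n + 1) ^ -2] is
    put in the bounds below. *)
Lemma sum_inv_sqr_conv n :
  \sum_(i < n.+1) ((i.+1%:R ^+ 2) * ((n - i).+1%:R ^+ 2) : R)^-1 <= 8 / n.+2%:R ^+ 2.
Proof.
apply: (@le_trans _ _ (\sum_(i < n.+1)
    (2 / n.+2%:R ^+ 2 * ((i.+1%:R ^+ 2)^-1 + ((n - i).+1%:R ^+ 2)^-1) : R))).
  apply: ler_sum => i _; have ni : (i <= n)%N by rewrite -ltnS.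
  have -> : n.+2%:R = i.+1%:R + (n - i).+1%:R :> R.
    by rewrite -natrD; congr (_%:R); lia.
  have x0 : 0 < i.+1%:R :> R by []; have y0 : 0 < (n - i).+1%:R :> R by [].
  move: (i.+1%:R : R) ((n - i).+1%:R : R) x0 y0 => x y x0 y0.
  rewrite -subr_ge0 (_ : _ - _ = (x - y) ^+ 2 / ((x + y) ^+ 2 * x ^+ 2 * y ^+ 2)).
    by apply: divr_ge0; rewrite -?exprMn sqr_ge0.
  by field; rewrite !gt_eqF ?addr_gt0.
rewrite -mulr_sumr big_split /= (_ : 8 / _ = 2 / n.+2%:R ^+ 2 * (2 + 2)); last by ring.
rewrite ler_wpM2l ?divr_ge0 ?sqr_ge0// lerD ?sum_inv_sqr//.
rewrite (reindex_inj rev_ord_inj) /=; apply: le_trans (sum_inv_sqr n.+1).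
apply: ler_sum => i _; rewrite subSS.
by have ni : (i <= n)%N := (ltn_ord i : (i <= n)%N); rewrite subKn.
Qed.

Lemma powS_expR n : ((n.+2%:R / n.+1%:R) ^+ n.+1 : R) <= expR 1.
Proof.
have n0 : n.+1%:R != 0 :> R by rewrite pnatr_eq0.
have h : n.+2%:R / n.+1%:R <= expR (n.+1%:R^-1) :> R.
  apply: le_trans (expR_ge1Dx _).
  by rewrite -(natr1 n.+1) mulrDl mulfV// mul1r.
apply: (@le_trans _ _ (expR (n.+1%:R^-1) ^+ n.+1)).
  by apply: lerXn2r; rewrite ?nnegrE ?expR_ge0// divr_ge0.
by rewrite -[X in _ <= expR X](mulfV n0) expRM_natl.
Qed.

Section bound.
Variables (D B : R).
Hypotheses (D0 : 0 < D) (B0 : 0 < B) (h0 : decay a0 D B).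

(** The inverse of the lifespan; the number [312 = 39 * 8] combines the
    constants of [decay_bil] and [sum_inv_sqr_conv]. *)
Definition growth : R := 312 * expR 1 * B / D.

Lemma growth_gt0 : 0 < growth.
Proof.
have p : 0 < 312 :> R by rewrite ltr0n.
exact: (divr_gt0 (mulr_gt0 (mulr_gt0 p (expR_gt0 1)) B0) D0).
Qed.

(** The abstract Cauchy-Kovalevskaya bound: the width [D (1 - E)] can be any
    number below [D], at the price of the factor [E ^ -n].  In the step the
    convolution is estimated at the loss [E (n + 1) / (n + 2)], and the
    derivative consumes the difference, which costs [(n + 2) / (D E)]; the
    division by [n + 1] in the recursion compensates this growth. *)
Lemma coef_decay n (E : R) : 0 <= E -> E <= 1 -> (n == 0%N) || (0 < E) ->
  decay (coef n) (D * (1 - E)) (B * growth ^+ n / (n.+1%:R ^+ 2 * E ^+ n)).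
Proof.
have [m] := ubnP n; elim: m n E => [//|m IH] [|n] E nm E0 E1 nE.
  rewrite !expr0 expr1n !mulr1 divr1 coef0; apply: decay_le h0 (lexx _) _.
  by rewrite ger_pMr// gerBl.
have nz j : (1 + j%:R : R) != 0 by rewrite addrC natr1 pnatr_eq0.
rewrite orFb in nE; rewrite !ltnS in nm.
pose F := E * (n.+1%:R / n.+2%:R).
have F0 : 0 < F by rewrite mulr_gt0// divr_gt0.
have F1 : F <= 1.
  rewrite -[leRHS]mul1r ler_pM// ?divr_ge0//.
  by rewrite ler_pdivrMr// mul1r ler_nat.
have EF : D * (1 - F) = D * (1 - E) + D * E / n.+2%:R.
  rewrite /F -(natr1 n.+1); have n2 : (n.+1%:R + 1 : R) != 0 by rewrite natr1 pnatr_eq0.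
  by field.
have hF i : (i <= n)%N -> decay (coef i) (D * (1 - F))
    (B * growth ^+ i / (i.+1%:R ^+ 2 * F ^+ i)).
  by move=> i_n; apply: IH; rewrite ?F0 ?orbT ?(ltW F0) ?F1//; exact: leq_ltn_trans i_n nm.
pose M := 39 * B ^+ 2 * growth ^+ n / F ^+ n.
have g0 := growth_gt0.
have M0 : 0 <= M by rewrite divr_ge0 ?exprn_ge0 ?mulr_ge0 ?exprn_ge0 ?(ltW F0) ?(ltW g0)// ltW.
have D1 : 0 <= D * (1 - F).
  by rewrite mulr_ge0 ?subr_ge0// ltW.
have hS : decay (fun k => \sum_(i < n.+1) bil (coef i) (coef (n - i)%N) k)
    (D * (1 - E) + D * E / n.+2%:R) (M * (8 / n.+2%:R ^+ 2)).
  rewrite -EF => k; apply: (le_trans (cmod_sum _ _ _)).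
  apply: (@le_trans _ _ (\sum_(i < n.+1)
      (M * (i.+1%:R ^+ 2 * ((n - i).+1%:R ^+ 2))^-1 * gw (D * (1 - F)) k))).
    apply: ler_sum => i _; have ni : (i <= n)%N by rewrite -ltnS.
    apply: le_trans (decay_bil D1 (hF i ni) (hF (n - i)%N (leq_subr i n)) k) _.
    rewrite le_eqVlt; apply/orP; left; apply/eqP; congr (_ * _).
    have ex (x : R) : x ^+ n = x ^+ i * x ^+ (n - i) by rewrite -exprD subnKC.
    rewrite /M (ex growth) (ex F); field.
    by rewrite !nz !expf_neq0// gt_eqF.
  rewrite -mulr_suml -mulr_sumr ler_wpM2r ?gw_ge0// ler_wpM2l//.
  exact: sum_inv_sqr_conv.
have DE : 0 < D * E / n.+2%:R by rewrite divr_gt0// mulr_gt0.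
have hD := decay_deriv DE hS.
have -> : coef n.+1 = (fun k => - n.+1%:R^-1 * (dsym R k *
    \sum_(i < n.+1) bil (coef i) (coef (n - i)%N) k)).
  by apply/funext => k; rewrite coefS mulNr.
apply: decay_le (decayZ _ hD) _ (lexx _).
rewrite cmodN cmodV cmod_nat /M.
have e1 := powS_expR n.
apply: (@le_trans _ _ (312 * B ^+ 2 * growth ^+ n / (D * n.+2%:R ^+ 2 * E ^+ n.+1) *
   (n.+2%:R / n.+1%:R) ^+ n.+1)).
  have key (p r G : R) : p != 0 -> r != 0 ->
      p^-1 * (39 * B ^+ 2 * G / (E * (p / r)) ^+ n * (8 / r ^+ 2) / (D * E / r)) =
      312 * B ^+ 2 * G / (D * r ^+ 2 * E ^+ n.+1) * (r / p) ^+ n.+1.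
    move=> p0 r0; rewrite exprMn !expr_div_n !(exprS _ n); field.
    by rewrite !expf_neq0 ?p0 ?r0 ?(gt_eqF nE) ?(gt_eqF D0).
  by rewrite /F key ?pnatr_eq0.
apply: (le_trans (ler_wpM2l _ e1)).
  by rewrite divr_ge0 ?mulr_ge0 ?exprn_ge0// ?ltW.
have -> : growth ^+ n.+1 = growth ^+ n * (312 * expR 1 * B / D) by rewrite exprSr.
move: (growth ^+ n) => G; rewrite le_eqVlt; apply/orP; left; apply/eqP.
have p0 : n.+2%:R != 0 :> R by rewrite pnatr_eq0.
move: (n.+2%:R : R) p0 => p p0; rewrite (exprS E n); field.
by rewrite !expf_neq0 ?p0 ?(gt_eqF nE) ?(gt_eqF D0).
Qed.

(** The factor [E ^ - n] of [coef_decay] is harmless on the disk [|t| < r] if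
    [growth * r < E], and the width [D (1 - E)] is larger than [D w] if
    [E < 1 - w]: both are possible when [r < (1 - w) / growth]. *)
Lemma coef_geometric (w c : R) : 0 < w -> w < 1 -> 0 <= c -> c < growth^-1 * (1 - w) ->
  exists r q d : R, [/\ 0 < r, c < r, 0 <= q, q < 1 & D * w < d] /\
    forall n k, cmod (coef n k) * r ^+ n <= B * gw d k * q ^+ n.
Proof.
move=> w0 w1 c0 cw; have g0 := growth_gt0.
pose r := (c + growth^-1 * (1 - w)) / 2.
have cr : c < r by rewrite midf_lt.
have rw : r < growth^-1 * (1 - w) by rewrite midf_lt.
have r0 : 0 < r := le_lt_trans c0 cr.
have rw' : growth * r < 1 - w by rewrite mulrC -ltr_pdivlMr// mulrC.
pose E := (growth * r + (1 - w)) / 2.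
have Er : growth * r < E by rewrite midf_lt.
have Ew : E < 1 - w by rewrite midf_lt.
have E0 : 0 < E by apply: lt_trans Er; rewrite mulr_gt0.
have E1 : E <= 1 by apply: (le_trans (ltW Ew)); rewrite gerBl ltW.
exists r, (growth * r / E), (D * (1 - E)); split; first split => //.
- exact: (divr_ge0 (mulr_ge0 (ltW g0) (ltW r0)) (ltW E0)).
- by rewrite ltr_pdivrMr// mul1r.
- by rewrite ltr_pM2l// ltrBrDr -ltrBrDl.
move=> n k; have hn := @coef_decay n E (ltW E0) E1; rewrite E0 orbT in hn.
apply: (le_trans (ler_wpM2r _ (hn isT k))); first by rewrite exprn_ge0// ltW.
have nE : 0 < E ^+ n by rewrite exprn_gt0.
have n1 : (n.+1%:R ^+ 2 : R)^-1 <= 1.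
  by rewrite invf_le1 ?exprn_gt0// exprn_ege1// ler1n.
rewrite [leRHS](_ : _ = B * (growth ^+ n / E ^+ n) * gw (D * (1 - E)) k * r ^+ n * 1); last first.
  by rewrite expr_div_n exprMn; ring.
rewrite [leLHS](_ : _ = B * (growth ^+ n / E ^+ n) * gw (D * (1 - E)) k * r ^+ n *
    (n.+1%:R ^+ 2)^-1); last by rewrite invfM; ring.
rewrite ler_wpM2l// mulr_ge0 ?exprn_ge0 ?(ltW r0)// mulr_ge0 ?gw_ge0//.
by rewrite mulr_ge0 ?(ltW B0)// divr_ge0 ?(ltW nE)// exprn_ge0// ltW.
Qed.

End bound.
End Coefficients.

Section Existence.
Variable R : realType.

Lemma diskE (r : R) (t : R[i]) : disk r t <-> cmod t < r.
Proof. by rewrite /disk /= cmodE ltcR. Qed.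

(** For complex [t], the value at [t] of the solution is the trigonometric series
    whose coefficients are the sums of the power series in time. *)
Lemma power_series_solution (u0 : R -> R) (D B : R) : 0 < D -> 0 < B ->
  periodic1 u0 -> contC (cplx u0) -> decay (fourier (cplx u0)) D B ->
  forall w s : R, 0 < w -> w < 1 ->
    holomorphic_solution (D * w) s (disk ((growth D B)^-1 * (1 - w))) u0
      (fun t => synth (tseries (coef (fourier (cplx u0))) t)).
Proof.
move=> D0 B0 pu cu hB w s w0 w1; set a := coef _.
have Dw : 0 <= D * w by rewrite mulr_ge0// ltW.
have B0' := ltW B0.
have main t : disk ((growth D B)^-1 * (1 - w)) t ->
    [/\ GC (D * w) s (synth (tseries a t)), contC (synth (tseries a t)),
      is_tderiv (D * w) s (fun t => synth (tseries a t)) t (synth (tseries_deriv a t)) &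
      forall x, synth (tseries_deriv a t) x + synth (tseries a t) x * dx (synth (tseries a t)) x
        + dx (Ainv (fun y => 3 * mean (synth (tseries a t)) * synth (tseries a t) y)) x = 0].
  move=> /diskE ht.
  have [r [q [d [[r0 tr q0 q1 Dd] ha]]]] := coef_geometric D0 B0 hB w0 w1 (cmod_ge0 t) ht.
  have d0 : 0 < d := le_lt_trans Dw Dd.
  have h1 := tseries_decay r0 B0' q0 q1 ha (ltW tr).
  have qb := decay_qbd (ltW d0) h1.
  have ct := contC_synth qb.
  split => //.
  - exact: GC_synth Dw Dd h1.
  - exact: (tseries_is_tderiv r0 B0' q0 q1 (ltW d0) ha tr s Dw Dd).
  move=> x; have fs : fourier (synth (tseries a t)) = tseries a t.
    by apply/funext => k; exact: fourier_synth qb.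
  have h2 := h1; rewrite -fs in h2.
  have pt : periodic1 (synth (tseries a t)) by move=> z; rewrite synth_periodic.
  have E := equation_fourier d0 pt ct h2.
  have Ex := congr1 (fun f : R -> R[i] => f x) E; rewrite /= fs in Ex.
  rewrite -addrA Ex; have -> : tseries_deriv a t =
      fun k => - 1 * (dsym R k * bil (tseries a t) (tseries a t) k).
    apply/funext => k; rewrite mulN1r.
    apply: (tseries_equation r0 B0' q0 q1 (ltW d0) ha tr) => n j.
    exact: coef_rec.
  have hb := decay_bil (ltW d0) h1 h1.
  have E1 := synthZ (-1) x (qbd_deriv d0 hb).
  by rewrite E1 mulN1r addNr.
split.
- by move=> t /main[h1 _ h3 _]; split => //; exists (synth (tseries_deriv a t)).
- by move=> t /main[_ /contC_cvg].
- by move=> t /main[_ _ h3 h4]; exists (synth (tseries_deriv a t)).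
move=> x; have -> : tseries a 0 = fourier (cplx u0).
  apply/funext => k; apply: hassum_csum.
  have := @hassum_fin R (fun n => 0 ^+ n * a n k) 1.
  rewrite big_nat1 expr0 mul1r; apply=> -[//|n] _.
  by rewrite expr0n mul0r.
rewrite (synth_fourier _ cu (decay_qbd (ltW D0) hB))//.
by move=> z; rewrite /cplx pu.
Qed.

End Existence.

(** * Uniqueness *)

Section Lipschitz.
Variable R : realType.
Implicit Types (b c : int -> R[i]) (k : int) (d A M : R).

(** [b ^ 2 - c ^ 2 = (b + c) (b - c)]; the constant is [72 + 6]. *)
Lemma bil_lipschitz b c d A M : 0 <= d -> decay b d A -> decay c d A ->
  decay (fun k => b k - c k) d M ->
  decay (fun k => bil b b k - bil c c k) d (78 * A * M).
Proof.
move=> d0 hb hc hz k.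
have qb := decay_qbd d0 hb; have qc := decay_qbd d0 hc.
have cb := contC_synth qb; have cc := contC_synth qc.
have h1 := decay_conv d0 (decayD hb hc) hz k.
have Ef : fourier (fun x => synth b x * synth b x) k - fourier (fun x => synth c x * synth c x) k =
    fourier (fun x => synth (fun k => b k + c k) x * synth (fun k => b k - c k) x) k.
  rewrite -(fourierB k (contC_intC (contCM cb cb)) (contC_intC (contCM cc cc))).
  congr fourier; apply/funext => x.
  have E1 := synthD x qb qc; have E2 := synthB x qb qc.
  by rewrite E1 E2; ring.
have -> : bil b b k - bil c c k =
    2^-1 * fourier (fun x => synth (fun k => b k + c k) x * synth (fun k => b k - c k) x) k +
    3 * asym R k * (b 0 * (b k - c k) + (b 0 - c 0) * c k).
  by rewrite -Ef /bil; ring.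
have b0 := hb 0; have z0 := hz 0; rewrite gw00 mulr1 in b0; rewrite gw00 mulr1 in z0.
have A0 := decay_ge0 hb; have M0 := decay_ge0 hz.
apply: (@le_trans _ _ (2^-1 * (72 * ((A + A) * M) * gw d k) +
    3 * (A * (M * gw d k) + M * (A * gw d k)))).
  apply: (le_trans (cmodD _ _)); rewrite lerD//.
    by rewrite cmodM cmodV cmod_nat ler_wpM2l.
  rewrite !cmodM cmod_nat; apply: ler_pM; rewrite ?mulr_ge0 ?cmod_ge0//.
    by rewrite ler_piMr// cmod_asym.
  apply: (le_trans (cmodD _ _)); rewrite !cmodM lerD//.
    by apply: ler_pM; rewrite ?cmod_ge0//; exact: hz.
  by apply: ler_pM; rewrite ?cmod_ge0//; exact: hc.
by rewrite le_eqVlt; apply/orP; left; apply/eqP; field.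
Qed.

Lemma is_derive_expw (K a e x : R) :
  is_derive x (1 : R) (fun y => K * expR (a * y + e)) (K * (a * expR (a * x + e))).
Proof.
have h1 : is_derive x (1 : R) (fun y => a * y + e) (a * 1 + 0) :=
  is_deriveD (is_deriveZ a (is_derive_id x 1)) (is_derive_cst e x 1).
rewrite mulr1 addr0 in h1.
have h2 := is_deriveZ K (@is_derive1_comp _ expR (fun y => a * y + e) x _ _ (is_derive_expR (a * x + e)) h1).
by rewrite (mulrC a); exact: h2.
Qed.

End Lipschitz.

(** Two curves of coefficients, bounded in the width [d], whose difference has
    the derivative that the equation prescribes along the ray of direction [t0]. *)
Section Gronwall.
Variable R : realType.
Variables (b c : R -> int -> R[i]) (t0 : R[i]) (A d : R).
Hypotheses (d0 : 0 < d) (A0 : 0 <= A).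
Implicit Types (x y M : R) (k : int).

Let zdot x k := - (t0 * (dsym R k * (bil (b x) (b x) k - bil (c x) (c x) k))).

Hypotheses (hb : forall x, 0 <= x <= 1 -> decay (b x) d A)
  (hc : forall x, 0 <= x <= 1 -> decay (c x) d A)
  (hRe : forall x k, 0 <= x <= 1 ->
     is_derive x (1 : R) (fun y => complex.Re (b y k - c y k)) (complex.Re (zdot x k)))
  (hIm : forall x k, 0 <= x <= 1 ->
     is_derive x (1 : R) (fun y => complex.Im (b y k - c y k)) (complex.Im (zdot x k))).

(** The speed at which the width shrinks. *)
Let L := 4 * (78 * A * cmod t0) + 1.

Let C0 : 0 <= 78 * A * cmod t0.
Proof. by rewrite !mulr_ge0// cmod_ge0. Qed.

Let L0 : 0 < L.
Proof. by rewrite ltr_wpDl// mulr_ge0. Qed.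

(** The derivative in space loses a factor [|k|], which is what one gains by
    integrating in time a weight whose width shrinks linearly.  The speed [L] is
    so large that the bound [M] of the difference improves to [M / 2]. *)
Lemma gronwall_half a M : 0 <= a -> b a = c a ->
  (forall x, a <= x <= 1 -> L * (x - a) <= d ->
     decay (fun k => b x k - c x k) (d - L * (x - a)) M) ->
  forall x, a <= x <= 1 -> L * (x - a) <= d ->
     decay (fun k => b x k - c x k) (d - L * (x - a)) (M / 2).
Proof.
move=> a0 bca hM x ax xd k.
have {ax} [ax x1] := andP ax.
(* [p] is a primitive of the majorant [dp] of the derivative. *)
pose p y := 78 * A * cmod t0 * M / L * gw (d - L * (y - a)) k.
pose dp y := 78 * A * cmod t0 * M * (2 * pi * `|k|%:R * gw (d - L * (y - a)) k).
have hp y : is_derive y (1 : R) p (dp y).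
  pose K := 78 * A * cmod t0 * M / L * qw R k.
  have := is_derive_expw K (2 * pi * L * `|k|%:R) (- (2 * pi * (d + L * a) * `|k|%:R)) y.
  have e z : 2 * pi * L * `|k|%:R * z + - (2 * pi * (d + L * a) * `|k|%:R) =
      - (2 * pi * (d - L * (z - a)) * `|k|%:R) by ring.
  have -> : (fun y => K * expR (2 * pi * L * `|k|%:R * y +
      - (2 * pi * (d + L * a) * `|k|%:R))) = p.
    by apply/funext => z; rewrite e /p /gw /K -!mulrA.
  congr is_derive; rewrite e /dp /K /gw; field.
  exact: lt0r_neq0.
have hz y : a <= y <= x -> cmod (zdot y k) <= dp y.
  move=> /andP[ay yx]; have y01 : 0 <= y <= 1 by rewrite (le_trans a0 ay) (le_trans yx x1).
  have yd : L * (y - a) <= d.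
    by apply: le_trans xd; rewrite ler_pM2l// lerD2r.
  have ay1 : a <= y <= 1 by rewrite ay (le_trans yx x1).
  have w0 : 0 <= d - L * (y - a) by rewrite subr_ge0.
  have wd : d - L * (y - a) <= d by rewrite gerBl mulr_ge0 ?(ltW L0)// subr_ge0.
  have h := bil_lipschitz w0 (decay_le (hb y01) (lexx _) wd)
    (decay_le (hc y01) (lexx _) wd) (hM y ay1 yd) k.
  rewrite /zdot cmodN (cmodM t0) (cmodM (dsym R k)) cmod_dsym.
  apply: (le_trans (ler_wpM2l (cmod_ge0 _) (ler_wpM2l _ h))).
    by rewrite !mulr_ge0 ?pi_ge0.
  by rewrite /dp le_eqVlt; apply/orP; left; apply/eqP; ring.
have p0 : 0 <= p a.
  have M0 : 0 <= M by apply: decay_ge0 (hM a _ _); rewrite ?lexx ?(le_trans ax x1)// subrr mulr0 ltW.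
  by rewrite /p mulr_ge0 ?gw_ge0// divr_ge0 ?(ltW L0)// mulr_ge0.
have hR : `|complex.Re (b x k - c x k)| <= p x.
  have := @mean_value_ineq R (fun y => complex.Re (b y k - c y k))
    (fun y => complex.Re (zdot y k)) p dp a x ax.
  rewrite bca subrr /= subr0 => h; apply: le_trans (h _ (fun y _ => hp y) _) _; last by rewrite gerBl.
  - by move=> y /andP[ay yx]; apply: hRe; rewrite (le_trans a0 ay) (le_trans yx x1).
  - by move=> y /hz; apply: le_trans; exact: normRe_le.
have hI : `|complex.Im (b x k - c x k)| <= p x.
  have := @mean_value_ineq R (fun y => complex.Im (b y k - c y k))
    (fun y => complex.Im (zdot y k)) p dp a x ax.
  rewrite bca subrr /= subr0 => h; apply: le_trans (h _ (fun y _ => hp y) _) _; last by rewrite gerBl.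
  - by move=> y /andP[ay yx]; apply: hIm; rewrite (le_trans a0 ay) (le_trans yx x1).
  - by move=> y /hz; apply: le_trans; exact: normIm_le.
have M0 : 0 <= M by apply: decay_ge0 (hM a _ _); rewrite ?lexx ?(le_trans ax x1)// subrr mulr0 ltW.
apply: (le_trans (cmod_le_ReIm _)); apply: (le_trans (lerD hR hI)).
rewrite /p -mulrDl ler_wpM2r ?gw_ge0// -mulrDl ler_pdivrMr//.
rewrite /L mulrDr mulr1 -subr_ge0.
rewrite (_ : _ - _ = M / 2); first by rewrite divr_ge0.
by field.
Qed.

(** Iterating the improvement, the difference vanishes until the width is used
    up. *)
Lemma gronwall_local a x : 0 <= a -> b a = c a -> a <= x <= 1 -> L * (x - a) <= d ->
  b x = c x.
Proof.
move=> a0 bca ax xd.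
have main n : forall x, a <= x <= 1 -> L * (x - a) <= d ->
     decay (fun k => b x k - c x k) (d - L * (x - a)) ((A + A) / 2 ^+ n).
  elim: n => [|n IH].
    move=> y /andP[ay y1] yd; rewrite expr0 divr1.
    have y01 : 0 <= y <= 1 by rewrite (le_trans a0 ay).
    apply: decay_le (decayB (hb y01) (hc y01)) (lexx _) _.
    by rewrite gerBl mulr_ge0 ?(ltW L0)// subr_ge0.
  move=> y ay yd; apply: decay_le (gronwall_half a0 bca IH ay yd) _ (lexx _).
  by rewrite exprSr invfM mulrA.
apply/funext => k; apply/eqP; rewrite -subr_eq0; apply/eqP/cmod_eq0.
set C := (A + A) * gw (d - L * (x - a)) k; set z := b x k - c x k.
have hn n : cmod z * n%:R <= C.
  apply: (@le_trans _ _ (cmod z * 2 ^+ n)).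
    by rewrite ler_wpM2l ?cmod_ge0// -natrX ler_nat ltnW// ltn_expl.
  rewrite -ler_pdivlMr ?exprn_gt0//; apply: le_trans (main n x ax xd k) _.
  by rewrite /C mulrAC.
apply/eqP; rewrite eq_le cmod_ge0 andbT leNgt; apply/negP => z0.
have := hn (Num.truncn (C / cmod z)).+1.
by rewrite leNgt mulrC -ltr_pdivrMr// truncnS_gt.
Qed.

(** The time until the width is used up is the same from every starting point,
    because the bound [A] is uniform. *)
Lemma gronwall x : b 0 = c 0 -> 0 <= x <= 1 -> b x = c x.
Proof.
move=> bc0 x01.
have main n : forall y, 0 <= y <= 1 -> L * y <= d * n%:R -> b y = c y.
  elim: n => [|n IH] y /andP[y0 y1] hy.
    suff -> : y = 0 by [].
    by apply/eqP; rewrite eq_le y0 andbT -(ler_pM2l L0) mulr0 -(mulr0 d).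
  have [h|h] := leP y (d / L).
    apply: (gronwall_local (lexx 0) bc0); rewrite ?y0// subr0.
    by rewrite mulrC -ler_pdivlMr.
  have a0 : 0 <= y - d / L by rewrite subr_ge0 ltW.
  have dL : 0 <= d / L by rewrite divr_ge0 ?ltW.
  apply: (gronwall_local a0).
  - apply: IH; first by rewrite a0 (le_trans _ y1)// gerBl.
    rewrite mulrBr mulrCA divff ?lt0r_neq0// mulr1 lerBlDr.
    by rewrite -[X in _ + X]mulr1 -mulrDr natr1.
  - by rewrite y1 gerBl dL.
  - by rewrite opprB addrC subrK mulrC divfK// lt0r_neq0.
have [h0 h1] := andP x01.
apply: (main (Num.truncn (L / d)).+1) => //.
apply: (@le_trans _ _ L); first by rewrite ger_pMr.
rewrite mulrC -ler_pdivrMr//; apply: ltW; exact: truncnS_gt.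
Qed.

End Gronwall.

Section Uniqueness.
Variable R : realType.
Variables (d s rho : R) (u0 : R -> R).
Hypotheses (d0 : 0 < d) (s32 : 3 / 2 <= s).
Implicit Types (v w : R[i] -> R -> R[i]) (t h : R[i]) (k : int).

Let sol v := holomorphic_solution d s (disk rho) u0 v.

Lemma solution_regular v t : sol v -> disk rho t ->
  [/\ periodic1 (v t), contC (v t), intC (v t) &
    decay (fourier (v t)) d (3 * fine (Gnorm d s (v t)))].
Proof.
move=> [h1 h2 _ _] tr; have [g _] := h1 t tr; have [l2 _] := g.
split; [by case: l2|exact: ContC (h2 t tr)|exact: L2_intC|exact: GC_decay s32 g].
Qed.

(** Convergence of the difference quotients in the norm of [G], read on the
    Fourier coefficients: it is uniform in [k] relatively to the weight. *)
Lemma solution_derivative v t : sol v -> disk rho t -> exists2 B,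
  decay (fun k => dsym R k * bil (fourier (v t)) (fourier (v t)) k) d B &
  forall e : R, 0 < e -> exists2 eta : R, 0 < eta & forall h, cmod h < eta ->
    decay (fun k => fourier (v (t + h)) k - fourier (v t) k +
      h * (dsym R k * bil (fourier (v t)) (fourier (v t)) k)) d (cmod h * e).
Proof.
move=> hv tr; have [pv cv iv dv] := solution_regular hv tr.
have [_ _ h3 _] := hv; have [ut [gut lim] eqn] := h3 t tr.
have E := equation_fourier d0 pv cv dv.
set c := fourier (v t) in dv E *.
have qd := qbd_deriv d0 (decay_bil (ltW d0) dv dv).
have fut k : fourier ut k = - (dsym R k * bil c c k).
  have -> : ut = synth (fun k => - 1 * (dsym R k * bil c c k)).
    apply/funext => x; have E1 := synthZ (-1) x qd.
    rewrite E1 mulN1r; apply/eqP; rewrite -addr_eq0; apply/eqP.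
    by rewrite -(congr1 (fun f => f x) E) /= addrA; exact: eqn.
  by rewrite (fourier_synth k (qbdZ (-1) qd)) mulN1r.
exists (3 * fine (Gnorm d s ut)).
  by move=> k; rewrite -cmodN -fut; exact: GC_decay.
move=> e e0; have e3 : 0 < e / 3 by rewrite divr_gt0.
have [eta eta0 he] := (dnbhs_GnormP d s _).1 lim _ e3.
have r0 : 0 < rho - cmod t by rewrite subr_gt0; exact/diskE.
exists (Num.min eta (rho - cmod t)); first by rewrite lt_min eta0.
move=> h; rewrite lt_min => /andP[h1 h2].
have tr' : disk rho (t + h).
  by apply/diskE; apply: (le_lt_trans (cmodD _ _)); rewrite addrC -ltrBrDr.
have [-> k|h0] := eqVneq h 0.
  by rewrite addr0 subrr mul0r addr0 cmod0 !mul0r.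
have [_ _ iv' _] := solution_regular hv tr'.
have [l2 _] := gut; have iu := L2_intC l2.
move=> k; have := decay_fourier s32 (he h h0 h1) k.
rewrite (fourierB k (intCZ _ (intCB iv' iv)) iu) (fourierZ h^-1 k (intCB iv' iv)).
rewrite (fourierB k iv' iv) fut opprK -/c => hk.
have -> : fourier (v (t + h)) k - c k + h * (dsym R k * bil c c k) =
    h * (h^-1 * (fourier (v (t + h)) k - c k) + dsym R k * bil c c k).
  by field.
rewrite cmodM -mulrA ler_wpM2l ?cmod_ge0//; apply: (le_trans hk).
by rewrite (_ : 3 * (e / 3) = e)//; field.
Qed.

Variable t0 : R[i].
Hypothesis t0r : disk rho t0.

Let segment_disk (x : R) : 0 <= x <= 1 -> disk rho (x%:C%C * t0).
Proof.
move=> /andP[x0 x1]; apply/diskE; rewrite cmodM cmod_real ger0_norm//.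
by apply: le_lt_trans ((diskE _ _).1 t0r); rewrite ler_piMl// cmod_ge0.
Qed.

(** Differentiability gives a local bound, hence a bound on the compact segment
    from [0] to [t0]. *)
Lemma solution_bound v : sol v -> exists2 A, 0 <= A &
  forall x : R, 0 <= x <= 1 -> decay (fourier (v (x%:C%C * t0))) d A.
Proof.
move=> hv; have cpt : compact (`[0, 1] : set R) by exact: segment_compact.
have /compact_near_coveringP := cpt.
move=> /(_ _ (pinfty_nbhs R) (fun M x => decay (fourier (v (x%:C%C * t0))) d M)) H.
have : \forall M \near pinfty_nbhs R, forall x, `[0, 1]%classic x ->
    decay (fourier (v (x%:C%C * t0))) d M.
  apply: H => x /=; rewrite in_itv /= => x01.
  have xr := segment_disk x01.
  have [_ _ _ dv] := solution_regular hv xr.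
  have [B hB /(_ 1 ltr01)[eta eta0 he]] := solution_derivative hv xr.
  set A := 3 * _ in dv.
  have B0 := decay_ge0 hB; have A0 := decay_ge0 dv.
  have T0 : 0 < cmod t0 + 1 by rewrite ltr_wpDl// cmod_ge0.
  have y0 : 0 < eta / (cmod t0 + 1) by rewrite divr_gt0.
  exists ([set y | `|x - y| < eta / (cmod t0 + 1)], [set M | A + eta * (1 + B) < M]) => /=.
    split; last by exists (A + eta * (1 + B)); split; rewrite ?num_real.
    exact: (nbhsx_ballx x (eta / (cmod t0 + 1)) y0).
  move=> [y M] [/= hy hM].
  pose h := (y - x)%:C%C * t0.
  have hh : cmod h < eta.
    rewrite /h cmodM cmod_real distrC.
    apply: (@le_lt_trans _ _ (`|x - y| * (cmod t0 + 1))); last by rewrite -ltr_pdivlMr.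
    by rewrite ler_wpM2l// lerDl.
  have -> : y%:C%C * t0 = x%:C%C * t0 + h by rewrite /h -mulrDl -rmorphD /= addrC subrK.
  have h1 := decayB (decayD (he h hh) dv) (decayZ h hB).
  move=> k; have -> : fourier (v (x%:C%C * t0 + h)) k =
    fourier (v (x%:C%C * t0 + h)) k - fourier (v (x%:C%C * t0)) k +
      h * (dsym R k * bil (fourier (v (x%:C%C * t0))) (fourier (v (x%:C%C * t0))) k) +
    fourier (v (x%:C%C * t0)) k -
      h * (dsym R k * bil (fourier (v (x%:C%C * t0))) (fourier (v (x%:C%C * t0))) k) by ring.
  apply: (decay_le h1 _ (lexx _)); apply: ltW; apply: le_lt_trans hM.
  rewrite mulr1 (addrC (cmod h)) -addrA lerD2l -{1}(mulr1 (cmod h)) -mulrDr.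
  by rewrite ler_wpM2r ?(ltW hh)// addr_ge0.
case=> A [Ar hA]; exists (`|A| + 1); first by rewrite addr_ge0.
by move=> x x01; apply: hA => //; rewrite (le_lt_trans (ler_norm _))// ltrDl.
Qed.

Lemma solution_is_derive v k (x : R) : sol v -> 0 <= x <= 1 ->
  let c := fourier (v (x%:C%C * t0)) in
  is_derive x (1 : R) (fun y => complex.Re (fourier (v (y%:C%C * t0)) k))
    (complex.Re (- (t0 * (dsym R k * bil c c k)))) /\
  is_derive x (1 : R) (fun y => complex.Im (fourier (v (y%:C%C * t0)) k))
    (complex.Im (- (t0 * (dsym R k * bil c c k)))).
Proof.
move=> hv x01 c; have xr := segment_disk x01.
have [B hB hder] := solution_derivative hv xr.
have main e : 0 < e -> exists2 eta : R, 0 < eta & forall h : R, `|h| < eta ->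
    cmod (fourier (v ((x + h)%:C%C * t0)) k - c k -
      h%:C%C * (- (t0 * (dsym R k * bil c c k)))) <= e * `|h|.
  move=> e0; have T0 : 0 < cmod t0 + 1 by rewrite ltr_wpDl// cmod_ge0.
  have e1 : 0 < e / (cmod t0 + 1) by rewrite divr_gt0.
  have [eta eta0 he] := hder _ e1.
  exists (eta / (cmod t0 + 1)); first by rewrite divr_gt0.
  move=> h hh; have hc : cmod (h%:C%C * t0) <= `|h| * (cmod t0 + 1).
    by rewrite cmodM cmod_real ler_wpM2l// lerDl.
  have hc' : cmod (h%:C%C * t0) < eta by apply: (le_lt_trans hc); rewrite -ltr_pdivlMr.
  have := he _ hc' k; rewrite -mulrDl -rmorphD /= -/c => h1.
  rewrite mulrN opprK (mulrA h%:C%C).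
  apply: (le_trans h1).
  apply: (@le_trans _ _ (`|h| * (cmod t0 + 1) * (e / (cmod t0 + 1)) * 1)).
    apply: ler_pM; first exact: (mulr_ge0 (cmod_ge0 _) (ltW e1)).
    - exact: gw_ge0.
    - by rewrite ler_wpM2r// ltW.
    - apply: (le_trans (gw_le_qw _ (ltW d0))); exact: qw_le1.
  by rewrite mulr1 -mulrA (mulrC (cmod t0 + 1)) divfK ?lt0r_neq0// mulrC.
split; apply: is_derive_littleo => e e0; have [eta eta0 he] := main e e0;
  exists eta => // h hh; apply: le_trans (he h hh).
- by apply: le_trans (normRe_le _); rewrite !cReB cReM /= mul0r subr0.
- by apply: le_trans (normIm_le _); rewrite !cImB cImM /= mul0r addr0.
Qed.

End Uniqueness.

Lemma solution_unique (R : realType) (d s rho : R) (u0 : R -> R) v w :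
  0 < d -> 3 / 2 <= s ->
  holomorphic_solution d s (disk rho) u0 v -> holomorphic_solution d s (disk rho) u0 w ->
  forall t x, disk rho t -> v t x = w t x.
Proof.
move=> d0 s32 hv hw t x tr.
have [Av Av0 hAv] := solution_bound d0 s32 tr hv.
have [Aw Aw0 hAw] := solution_bound d0 s32 tr hw.
pose b (y : R) := fourier (v (y%:C%C * t)); pose c (y : R) := fourier (w (y%:C%C * t)).
have A0 : 0 <= Av + Aw by rewrite addr_ge0.
have dist (a D X Y : R[i]) : - (a * (D * (X - Y))) = - (a * (D * X)) - - (a * (D * Y)) by ring.
have e : b 1 = c 1.
  apply: (@gronwall R b c t (Av + Aw) d d0 A0).
  - by move=> y y01; apply: decay_le (hAv y y01) _ (lexx _); rewrite lerDl.
  - by move=> y y01; apply: decay_le (hAw y y01) _ (lexx _); rewrite lerDr.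
  - move=> y k y01; have [h1 _] := solution_is_derive d0 s32 tr k hv y01.
    have [h2 _] := solution_is_derive d0 s32 tr k hw y01.
    rewrite dist.
    have -> : (fun z => complex.Re (b z k - c z k)) =
        (fun z => complex.Re (b z k) - complex.Re (c z k)) by apply/funext => z; rewrite cReB.
    by rewrite cReB; exact: is_deriveB h1 h2.
  - move=> y k y01; have [_ h1] := solution_is_derive d0 s32 tr k hv y01.
    have [_ h2] := solution_is_derive d0 s32 tr k hw y01.
    rewrite dist.
    have -> : (fun z => complex.Im (b z k - c z k)) =
        (fun z => complex.Im (b z k) - complex.Im (c z k)) by apply/funext => z; rewrite cImB.
    by rewrite cImB; exact: is_deriveB h1 h2.
  - have [_ _ _ v0] := hv; have [_ _ _ w0] := hw.
    by rewrite /b /c !mul0r; congr fourier; apply/funext => z; rewrite v0 w0.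
  - by rewrite ler01 lexx.
have [pv cv _ _] := solution_regular s32 hv tr; have [pw cw _ _] := solution_regular s32 hw tr.
have -> // : v t = w t.
apply: fourier_inj => // k.
by have := congr1 (fun f => f k) e; rewrite /b /c !mul1r.
Qed.

(** * The theorem *)

Theorem theorem16 (R : realType) :
  (forall u0 : R -> R, periodic1 u0 -> analytic_on [set: R] u0 ->
     exists Delta : R, 0 < Delta /\
       forall s : R, 0 <= s -> G Delta (s + 1) u0 /\ G_sub_A Delta (s + 1))
  /\
  (forall Delta s : R, 0 < Delta -> 1 / 2 < s ->
     exists const : R, 0 < const /\
       forall u0 : R -> R, periodic1 u0 -> analytic_on [set: R] u0 ->
         (forall s' : R, 0 <= s' -> G Delta (s' + 1) u0) ->
         exists T : R,
           [/\ 0 < T,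
               (exists x, u0 x <> 0) ->
                 T = const / fine (Gnorm Delta (s + 1) (cplx u0))
             & forall d : R, 0 < d -> d < 1 ->
                 exists2 u : R[i] -> R -> R[i],
                   holomorphic_solution (Delta * d) (s + 1)
                     (disk (T * (1 - d))) u0 u &
                   forall v : R[i] -> R -> R[i],
                     holomorphic_solution (Delta * d) (s + 1)
                       (disk (T * (1 - d))) u0 v ->
                     forall t x, disk (T * (1 - d)) t -> v t x = u t x]).
Proof.
split.
  move=> u0 pu au; have [D [D0 hD]] := analytic_G pu au.
  exists D; split=> // s s0; split; first exact: hD.
  by apply: G_sub_A_pos => //; rewrite addr_ge0.
move=> D s D0 s12; have s32 : 3 / 2 <= s + 1 by move: s12; rewrite -subr_gt0; lra.
have p312 : 0 < 312 :> R by rewrite ltr0n.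
have p : 0 < 312 * expR 1 * 3 :> R by rewrite !mulr_gt0 ?expR_gt0.
(* The factor 3 is the constant of [GC_decay]. *)
exists (D / (312 * expR 1 * 3)); split; first by rewrite divr_gt0.
move=> u0 pu au hu.
have pcu : periodic1 (cplx u0) by move=> x; rewrite /cplx pu.
have cu := contC_analytic au.
have h32 : GC D (s + 1) (cplx u0) by apply: hu; lra.
have hB := GC_decay s32 h32.
set N := fine (Gnorm D (s + 1) (cplx u0)) in hB *.
have N0 : 0 <= N by exact/fine_ge0/Gnorm_ge0.
(* For the zero initial datum any positive [B] will do. *)
have [B [B0 hB' BN]] : exists B : R, [/\ 0 < B, decay (fourier (cplx u0)) D B &
    (exists x, u0 x <> 0) -> B = 3 * N].
  have [N1|N1] := eqVneq N 0.
    have f0 k : fourier (cplx u0) k = 0.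
      apply: cmod_eq0; apply/eqP; rewrite eq_le cmod_ge0 andbT.
      by have := hB k; rewrite N1 mulr0 mul0r.
    have z x : cplx u0 x = 0 by exact: fourier0_continuous pcu cu f0 x.
    exists 1; split=> //; first by apply: decay_le hB _ (lexx _); rewrite N1 mulr0.
    by move=> [x]; case: (z x).
  by exists (3 * N); split=> //; rewrite mulr_gt0// lt_neqAle eq_sym N1.
have g0 := growth_gt0 D0 B0.
exists (growth D B)^-1; split; first by rewrite invr_gt0.
  move=> /BN BE.
  have N1 : N != 0.
    by move: B0; rewrite BE; apply: contraTneq => ->; rewrite mulr0 ltxx.
  rewrite /growth BE; move: (312 : R) p312 p (expR 1) (expR_gt0 (1 : R)) => c c0 _ e e0.
  by field; rewrite N1 !gt_eqF.
move=> d d0 d1; exists (fun t => synth (tseries (coef (fourier (cplx u0))) t)).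
  exact: power_series_solution D0 B0 pu cu hB' _ _ d0 d1.
move=> v hv t x tr; have Dd : 0 < D * d by rewrite mulr_gt0.
have h := solution_unique Dd s32 hv (power_series_solution D0 B0 pu cu hB' (s + 1) d0 d1).
exact: (h t x tr).
Qed.
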